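(* Let $\pi_2$ be a generator of $\mathrm{LT}[\pi^2]$, let $\alpha\in\mathbf{C}$ satisfy $\alpha^{2q^2}=\pi_2$, and let $\sigma\in I_F$ be an element fixing $\pi_2$. Write $\sigma(\alpha)=\zeta\alpha$ with $\zeta\in\mu_{2q^2}$. Then $\sigma$ acts on the reduction $\overline{\mathbf{Z}}^{\pi_2}_{1,1,e_1}$, given by $Z_1^q+\frac1{y^{q^2-1}}+y^{q^2-1}=0$, as $$\sigma:\overline{\mathbf{Z}}^{\pi_2}_{1,1,e_1}\longrightarrow\overline{\mathbf{Z}}^{\pi_2}_{1,1,e_1};\quad (y,Z_1)\mapsto(\zeta^{-1}y,Z_1).$$
   Context: $F$ is a non-archimedean local field of equal characteristic $p>0$ with residue field $\mathbb{F}_q$ and uniformizer $\pi$; $\mathbf{C}$ is the completion of an algebraic closure of $F$, $v$ the valuation on $\mathbf{C}$ with $v(\pi)=1$. All spaces are rigid analytic curves considered over $\mathbf{C}$. $\mu_n$ denotes the group of $n$-th roots of unity. For $u\in\mathbf{C}$ with $v(u)>0$ put $[\pi]_u(X)=X^{q^2}+uX^q+\pi X$ and $[\pi^2]_u=[\pi]_u\circ[\pi]_u$. Put $[\pi]_{\mathrm{LT}}(X)=\pi X-X^q$; a generator of $\mathrm{LT}[\pi^2]$ is an element $\pi_2\in\mathbf{C}$ with $[\pi]_{\mathrm{LT}}([\pi]_{\mathrm{LT}}(\pi_2))=0$ and $[\pi]_{\mathrm{LT}}(\pi_2)\neq 0$; then $v(\pi_2)=\frac{1}{q(q-1)}$.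 For $X_2,Y_2$ with $[\pi^2]_u(X_2)=[\pi^2]_u(Y_2)=0$ write $X_1=[\pi]_u(X_2)$, $Y_1=[\pi]_u(Y_2)$ and $$\mu_2(X_2,Y_2)=X_1Y_2^q-X_1^qY_2-X_2^qY_1+X_2Y_1^q .$$ $\mathcal{X}^{\pi_2}(\pi^2)$ is the rigid analytic curve with $\mathbf{C}$-points $\{(u,X_2,Y_2): v(u)>0,\ [\pi^2]_u(X_2)=[\pi^2]_u(Y_2)=0,\ \mu_2(X_2,Y_2)=\pi_2\}$. $\mathbf{Z}^{\pi_2}_{1,1,e_1}$ is the subspace of $\mathcal{X}^{\pi_2}(\pi^2)$ defined by $v(u)=\frac12$, $v(X_1)=\frac{1}{2(q-1)}$, $v(X_2)=\frac{1}{2q^2(q-1)}$, $v(Y_1)=\frac{1}{2q(q-1)}$, $v(Y_2)=\frac1{2q^3(q-1)}$. The reduction of a reduced affinoid over $\mathbf{C}$ is $\mathrm{Spec}$ of the ring of power-bounded functions modulo the topologically nilpotent functions. Coordinates on the reduction: let $x=X_2/\alpha^q$, $y=Y_2/\alpha$; let $\gamma=\alpha^{q(q-1)^2}$, $\gamma_1^q=\gamma$, $\gamma_2^q=\gamma_1$; define $Z$ by $1+xy^q=\gamma_1Z$ and $Z_1$ by $Z+\frac1{y^{q^2-1}}+y^{q^2-1}=\gamma_2y^{q^2-1}Z_1$. Inertia action: $I_F=\mathrm{Aut}_{\rm cont}(\mathbf{C}/F^{\rm ur})$ acts on the reduction by $\overline{P}\mapsto\overline{P^{\sigma}}$ for points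 $P$ of the affinoid. Convention: in terms of coordinates, $\sigma$ acts on functions by acting on coefficients, so $u,X_i,Y_i$ are fixed and e.g. $(Y_2/\alpha)^\sigma=Y_2/\sigma(\alpha)$ (equivalently $P^\sigma=\sigma^{-1}(P)$). Roots of unity are identified with their images in the residue field. *)

(* Defs.v *)
From HB Require Import structures.
From mathcomp Require Import all_boot all_order all_algebra.
From mathcomp Require Import generic_quotient ring_quotient mpoly.
From mathcomp Require Import boolp classical_sets functions.
From mathcomp Require Import reals constructive_ereal.
Set Implicit Arguments.
Unset Strict Implicit.
Unset Printing Implicit Defensive.
Import Order.TTheory GRing.Theory Num.Theory.
Local Open Scope ring_scope.
Local Open Scope quotient_scope.

Record valuation (R : realType) (K : fieldType) := Valuation {
  val_fun :> K -> \bar R;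
  val_Ny : forall x, val_fun x != -oo%E;
  val_y : forall x, (val_fun x == +oo%E) = (x == 0);
  val_M : forall x y, val_fun (x * y) = (val_fun x + val_fun y)%E;
  val_D : forall x y, (Order.min (val_fun x) (val_fun y) <= val_fun (x + y))%E
}.

Section Valuations.
Variables (R : realType) (K : fieldType) (v : valuation R K).
Implicit Types (x y : K) (M : R).

Definition vcvg (s : nat -> K) x := forall M, exists N : nat,
  forall n, (N <= n)%N -> (M%:E <= v (s n - x)%R)%E.

Definition vcauchy (s : nat -> K) := forall M, exists N : nat,
  forall m n, (N <= m)%N -> (N <= n)%N -> (M%:E <= v (s m - s n)%R)%E.

Definition vcomplete := forall s, vcauchy s -> exists x, vcvg s x.

Definition vcontinuous (f : K -> K) := forall x M, exists N : R,
  forall y, (N%:E <= v (y - x)%R)%E -> (M%:E <= v (f y - f x)%R)%E.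

Lemma val0 : v 0 = +oo%E.
Proof. by apply/eqP; rewrite val_y. Qed.

Lemma val_fin x : x != 0 -> exists r : R, v x = r%:E.
Proof.
rewrite -(val_y v); move: (val_Ny v x); case: (v x) => // r _ _.
by exists r.
Qed.

Lemma val1 : v 1 = 0%E.
Proof.
have [r vr] := val_fin (oner_neq0 K); have := val_M v 1 1.
rewrite mulr1 vr -EFinD => -[] /eqP; rewrite -subr_eq0 opprD addNKr oppr_eq0.
by move=> /eqP ->.
Qed.

Lemma valN1 : v (-1) = 0%E.
Proof.
have [r vr] := val_fin (negbT (eq_trans (oppr_eq0 (1 : K)) (oner_eq0 K))).
have := val_M v (-1) (-1); rewrite mulrNN mulr1 val1 vr -EFinD => -[] /esym/eqP.
by rewrite -mulr2n mulrn_eq0 => /eqP ->.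
Qed.

Lemma valN x : v (- x) = v x.
Proof. by rewrite -mulN1r val_M valN1 add0e. Qed.

Lemma val_ge_add (a : \bar R) x y :
  (a <= v x -> a <= v y -> a <= v (x + y)%R)%E.
Proof. by move=> ax ay; apply: le_trans (val_D v x y); rewrite le_min ax. Qed.

Lemma val_ge_sub (a : \bar R) x y :
  (a <= v x -> a <= v y -> a <= v (x - y)%R)%E.
Proof. by move=> ax ay; apply: val_ge_add => //; rewrite valN. Qed.

Lemma val_ge_mul (a b : R) x y :
  (a%:E <= v x -> b%:E <= v y -> (a + b)%:E <= v (x * y)%R)%E.
Proof. by move=> ax by_; rewrite val_M EFinD; apply: leeD. Qed.

Lemma val_ge_sum (I : Type) (s : seq I) (P : pred I) (F : I -> K) (a : \bar R) :
  (forall i, P i -> (a <= v (F i)%R)%E) -> (a <= v (\sum_(i <- s | P i) F i)%R)%E.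
Proof.
move=> aF; elim/big_ind: _ => //; first by rewrite val0 leey.
exact: val_ge_add.
Qed.

Lemma valX_fin x r n : v x = r%:E -> v (x ^+ n) = (r *+ n)%:E.
Proof.
move=> vx; elim: n => [|n IHn]; first by rewrite expr0 val1.
by rewrite exprS val_M IHn vx -EFinD mulrS.
Qed.

Lemma valX_ge a x n : (a%:E <= v x)%E -> ((a *+ n)%:E <= v (x ^+ n)%R)%E.
Proof.
move=> ax; elim: n => [|n IHn]; first by rewrite expr0 val1.
by rewrite exprS mulrS; apply: val_ge_mul.
Qed.

Lemma valV x : x != 0 -> v x = 0%E -> v x^-1 = 0%E.
Proof.
by move=> x0 vx; rewrite -[LHS]add0e -[X in (X + _)%E]vx -val_M divff ?val1.
Qed.

Definition integral_elts : {pred K} := fun x => (0 <= v x)%E.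

Lemma integral_eltsE x : (x \in integral_elts) = (0 <= v x)%E.
Proof. by []. Qed.

Lemma integral_elts_subring : subring_closed integral_elts.
Proof.
split=> [|x y|x y]; rewrite !integral_eltsE ?val1 //; first exact: val_ge_sub.
by move=> x0 y0; rewrite val_M adde_ge0.
Qed.
HB.instance Definition _ :=
  GRing.isSubringClosed.Build K integral_elts integral_elts_subring.

Record val_ring := ValRing { vr_val :> K; _ : vr_val \in integral_elts }.
HB.instance Definition _ := [isSub for vr_val].
HB.instance Definition _ := [Choice of val_ring by <:].
HB.instance Definition _ := [SubChoice_isSubComNzRing of val_ring by <:].

Definition max_ideal : {pred val_ring} := fun a => (0 < v (val a))%E.

Lemma max_idealE (a : val_ring) : (a \in max_ideal) = (0 < v (val a))%E.
Proof. by []. Qed.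

Lemma max_ideal_closed : idealr_closed max_ideal.
Proof.
split; rewrite ?max_idealE ?rmorph0 ?rmorph1 ?val0 ?ltry ?val1 ?ltxx //.
move=> a x y; rewrite !max_idealE rmorphD rmorphM /= => x0 y0.
apply: lt_le_trans (val_D v _ _); rewrite lt_min y0 andbT val_M.
by apply: lt_le_trans x0 _; rewrite leeDr //; exact: (valP a).
Qed.
HB.instance Definition _ := isIdealr.Build val_ring max_ideal max_ideal_closed.

Definition residue_field : Type := {ideal_quot max_ideal}.
HB.instance Definition _ := Quotient.on residue_field.
HB.instance Definition _ := GRing.ComNzRing.on residue_field.

(** Residue class of [x : K], with the junk value [0] when [v x < 0]. *)
Definition res x : residue_field := \pi_residue_field (insubd (0 : val_ring) x).

Lemma residue_eqE (a b : val_ring) :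
  (\pi_residue_field a == \pi_residue_field b) = (0 < v (val a - val b)%R)%E.
Proof. by rewrite -[RHS](max_idealE (a - b)) Quotient.idealrBE. Qed.

Lemma residue_eq0E (a : val_ring) :
  (\pi_residue_field a == 0) = (0 < v (val a))%E.
Proof.
rewrite -[X in _ == X](rmorph0 (\pi_residue_field : {rmorphism _ -> _})).
by rewrite residue_eqE subr0.
Qed.

Definition residue_inv (c : residue_field) : residue_field :=
  res (val (repr c))^-1.

Lemma residue_mulV : forall c, c != 0 -> residue_inv c * c = 1.
Proof.
move=> c c0; set a := repr c; have ca : c = \pi_residue_field a by rewrite reprK.
have va : v (val a) = 0%E.
  apply/eqP; rewrite eq_le (valP a : (0 <= _)%E) andbT leNgt.
  by rewrite -residue_eq0E -ca.
have a_neq0 : val a != 0 by rewrite -(val_y v) va.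
rewrite [X in _ * X]ca /residue_inv /res -/a.
rewrite -rmorphM -[RHS](rmorph1 (\pi_residue_field : {rmorphism _ -> _})).
apply/eqP; rewrite residue_eqE rmorphM rmorph1 /= insubdK; last first.
  by rewrite integral_eltsE valV.
by rewrite mulVf // subrr val0 ltry.
Qed.

Lemma residue_inv0 : residue_inv 0 = 0.
Proof.
rewrite /residue_inv /res; set a := repr _.
have va : (0 < v (val a))%E by rewrite -residue_eq0E reprK.
have [a0|a0] := eqVneq (val a) 0.
  apply/eqP; rewrite a0 invr0 residue_eq0E insubdK ?val0 ?ltry //.
  by rewrite integral_eltsE val0 leey.
rewrite /insubd insubN ?rmorph0 // integral_eltsE -ltNge.
have [r vr] := val_fin (invr_neq0 a0); have [s vs] := val_fin a0.
have := val_M v (val a) (val a)^-1.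
rewrite divff // val1 vr vs -EFinD => -[] /esym/eqP.
by rewrite addr_eq0 => /eqP sr; move: va; rewrite vs !lte_fin sr oppr_gt0.
Qed.

HB.instance Definition _ :=
  GRing.ComNzRing_isField.Build residue_field residue_mulV residue_inv0.

End Valuations.

Section Affinoids.
Variables (R : realType) (K : fieldType) (v : valuation R K).

(** [gauss_ge M G]: the Gauss valuation of the polynomial [G] is at least [M]. *)
Definition gauss_ge n (M : R) (G : {mpoly K[n]}) :=
  forall m, (M%:E <= v G@_m)%E.

Definition gauss_cauchy n (G : nat -> {mpoly K[n]}) := forall M, exists N : nat,
  forall i j, (N <= i)%N -> (N <= j)%N -> gauss_ge M (G i - G j).

Variables (T : Type) (n : nat) (t : 'I_n -> T -> K).
Implicit Types (f g : T -> K) (M : R) (P : T).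

(** [t] presents the point set [T] of a reduced affinoid as a Zariski closed
    subset of the closed unit polydisc.  The Tate algebra [K<X_1, .., X_n>] is
    the completion of [K[X_1, .., X_n]] for the Gauss norm, and the functions on
    the affinoid are the restrictions of its elements to [T] (a reduced affinoid
    algebra over an algebraically closed field embeds in the functions on its
    points). *)
Definition affinoid_fun f := exists2 G : nat -> {mpoly K[n]},
  gauss_cauchy G & forall P, vcvg v (fun i => (G i).@[fun k => t k P]) (f P).

(** The Banach topology of a reduced affinoid algebra is that of the supremum
    norm on [T]. *)
Definition power_bounded f := exists M, forall (k : nat) P,
  (M%:E <= v (f P ^+ k)%R)%E.

Definition top_nilpotent f := forall M, exists N : nat,
  forall k, (N <= k)%N -> forall P, (M%:E <= v (f P ^+ k)%R)%E.

Lemma power_boundedP f : power_bounded f <-> forall P, (0 <= v (f P))%E.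
Proof.
split=> [[M fM] P|f0]; last first.
  exists 0 => k P; rewrite -[0](mul0rn _ k); exact: valX_ge.
rewrite leNgt; apply/negP => fP.
have fP0 : f P != 0 by rewrite -(val_y v); case: (v (f P)) fP.
have [r vr] := val_fin v fP0; rewrite vr lte_fin in fP.
pose k := Num.bound (`|M| / `|r|).
have := fM k P; rewrite (valX_fin _ vr) lee_fin leNgt => /negP; apply.
have := archi_boundP (divr_ge0 (normr_ge0 M) (normr_ge0 r)).
rewrite -/k ltr_pdivrMr ?normr_gt0 ?lt_eqF // (ltr0_norm fP) mulrN mulr_natl.
by rewrite ltrNr => /lt_le_trans; apply; rewrite lerNl -normrN ler_norm.
Qed.

Lemma top_nilpotentP f : top_nilpotent f <->
  exists2 e : R, 0 < e & forall P, (e%:E <= v (f P))%E.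
Proof.
split=> [/(_ 1)[N fN]|[e e0 fe] M]; last first.
  exists (Num.bound (`|M| / e)) => k kN P.
  apply: le_trans (valX_ge k (fe P)); rewrite lee_fin.
  apply: le_trans (ler_norm M) _; rewrite -mulr_natl -ler_pdivrMr //.
  apply: le_trans (ltW (archi_boundP _)) _; last by rewrite ler_nat.
  by rewrite divr_ge0 // ltW.
exists (N.+1%:R^-1) => [|P]; first by rewrite invr_gt0 ltr0n.
have := fN N.+1 (leqnSn N) P.
have [->|fP0] := eqVneq (f P) 0; first by rewrite val0 leey.
have [r vr] := val_fin v fP0; rewrite (valX_fin _ vr) vr !lee_fin.
by rewrite -[r *+ _]mulr_natr -ler_pdivrMr ?ltr0n // div1r.
Qed.

Lemma gauss_bounded (G : {mpoly K[n]}) : exists M : R, gauss_ge M G.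
Proof.
suff [M MG] : exists M : R, forall m, m \in msupp G -> (M%:E <= v G@_m)%E.
  exists M => m; have [/MG //|mG] := boolP (m \in msupp G).
  by rewrite (memN_msupp_eq0 mG) val0 leey.
elim: (msupp G : seq _) => [|m s [M IH]]; first by exists 0.
have [r mr] : exists r : R, (r%:E <= v G@_m)%E.
  have [->|/val_fin-/(_ _ v)[r ->]] := eqVneq G@_m 0; last by exists r.
  by exists 0; rewrite val0 leey.
exists (Num.min M r) => m'; rewrite inE => /predU1P[->|/IH m'M].
  by apply: le_trans mr; rewrite lee_fin ge_min lexx orbT.
by apply: le_trans m'M; rewrite lee_fin ge_min lexx.
Qed.

Lemma gauss_ge_le M M' (G : {mpoly K[n]}) :
  M' <= M -> gauss_ge M G -> gauss_ge M' G.
Proof. by move=> MM' GM m; apply: le_trans (GM m); rewrite lee_fin. Qed.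

Lemma gauss_geB M (G H : {mpoly K[n]}) :
  gauss_ge M G -> gauss_ge M H -> gauss_ge M (G - H).
Proof. by move=> GM HM m; rewrite mcoeffB; apply: val_ge_sub. Qed.

Lemma gauss_geD M (G H : {mpoly K[n]}) :
  gauss_ge M G -> gauss_ge M H -> gauss_ge M (G + H).
Proof. by move=> GM HM m; rewrite mcoeffD; apply: val_ge_add. Qed.

Lemma gauss_geM M M' (G H : {mpoly K[n]}) :
  gauss_ge M G -> gauss_ge M' H -> gauss_ge (M + M') (G * H).
Proof.
move=> GM HM m; rewrite mcoeffM; apply: val_ge_sum => k _.
exact: val_ge_mul.
Qed.

Lemma gauss_cauchy_bounded (G : nat -> {mpoly K[n]}) : gauss_cauchy G ->
  exists M : R, exists N : nat, forall i, (N <= i)%N -> gauss_ge M (G i).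
Proof.
move=> /(_ 0)[N GN]; have [M MG] := gauss_bounded (G N).
exists (Num.min M 0), N => i Ni; rewrite -[G i](subrK (G N)).
by apply: gauss_geD; [apply: gauss_ge_le (GN i N Ni _)|apply: gauss_ge_le MG];
  rewrite // ge_min lexx ?orbT.
Qed.

Lemma vcvg_bounded s x : vcvg v s x ->
  exists M : R, exists N : nat, forall i, (N <= i)%N -> (M%:E <= v (s i))%E.
Proof.
move=> /(_ 0)[N sN].
have [r xr] : exists r : R, (r%:E <= v x)%E.
  have [->|/val_fin-/(_ _ v)[r ->]] := eqVneq x 0; last by exists r.
  by exists 0; rewrite val0 leey.
exists (Num.min r 0), N => i Ni; rewrite -[s i](subrK x).
by apply: val_ge_add; [apply: le_trans (sN i Ni)|apply: le_trans xr];
  rewrite lee_fin ge_min lexx ?orbT.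
Qed.

Lemma affinoid_fun_cst c : affinoid_fun (fun=> c).
Proof.
exists (fun=> c%:MP) => [M|P M]; exists 0%N => *.
  by move=> m; rewrite subrr mcoeff0 val0 leey.
by rewrite mevalC subrr val0 leey.
Qed.

Lemma affinoid_funB f g : affinoid_fun f -> affinoid_fun g ->
  affinoid_fun (fun P => f P - g P).
Proof.
move=> [G Gc Gf] [H Hc Hg]; exists (fun i => G i - H i) => [M|P M].
  have [N GN] := Gc M; have [N' HN] := Hc M; exists (maxn N N') => i j.
  rewrite !geq_max => /andP[? ?] /andP[? ?].
  rewrite -[_ - _](_ : (G i - G j) - (H i - H j) = _); last first.
    by rewrite !opprB addrACA [RHS]addrACA [- G j + _]addrC.
  by apply: gauss_geB; [apply: GN|apply: HN].
have [N GN] := Gf P M; have [N' HN] := Hg P M; exists (maxn N N') => i.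
rewrite geq_max => /andP[? ?].
rewrite mevalB.
rewrite -[_ - _](_ : ((G i).@[t^~ P] - f P) - ((H i).@[t^~ P] - g P) = _).
  by apply: val_ge_sub; [apply: GN|apply: HN].
by rewrite !opprB addrACA [RHS]addrACA [- f P + _]addrC.
Qed.

Lemma affinoid_funM f g : affinoid_fun f -> affinoid_fun g ->
  affinoid_fun (fun P => f P * g P).
Proof.
move=> [G Gc Gf] [H Hc Hg]; exists (fun i => G i * H i) => [M|P M].
  have [B [N0 GB]] := gauss_cauchy_bounded Gc.
  have [B' [N0' HB]] := gauss_cauchy_bounded Hc.
  have [N GN] := Gc (M - B'); have [N' HN] := Hc (M - B).
  exists (maxn (maxn N N') (maxn N0 N0')) => i j.
  rewrite !geq_max => /andP[/andP[? ?] /andP[? ?]] /andP[/andP[? ?] /andP[? ?]].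
  rewrite -[_ - _](_ : (G i - G j) * H i + G j * (H i - H j) = _); last first.
    by rewrite mulrBl mulrBr addrA subrK.
  apply: gauss_geD.
    by rewrite -[M](subrK B'); apply: gauss_geM; [apply: GN|apply: HB].
  by rewrite -[M](subrK B) addrC; apply: gauss_geM; [apply: GB|apply: HN].
have [B [N0 GB]] := vcvg_bounded (Gf P).
have [r gr] : exists r : R, (r%:E <= v (g P))%E.
  have [->|/val_fin-/(_ _ v)[r ->]] := eqVneq (g P) 0; last by exists r.
  by exists 0; rewrite val0 leey.
have [N GN] := Gf P (M - r); have [N' HN] := Hg P (M - B).
exists (maxn N0 (maxn N N')) => i; rewrite !geq_max => /and3P[? ? ?].
rewrite mevalM -[_ - _](_ : ((G i).@[t^~ P] - f P) * g P
   + (G i).@[t^~ P] * ((H i).@[t^~ P] - g P) = _); last first.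
  by rewrite mulrBl mulrBr addrC addrA subrK.
apply: val_ge_add.
  by rewrite -[M](subrK r); apply: val_ge_mul; [apply: GN|].
by rewrite -[M](subrK B) addrC; apply: val_ge_mul; [apply: GB|apply: HN].
Qed.

Definition pb_funs : {pred (T -> K)} :=
  fun f => `[< affinoid_fun f /\ power_bounded f >].

Lemma pb_funsP f : reflect (affinoid_fun f /\ power_bounded f) (f \in pb_funs).
Proof. exact: asboolP. Qed.

Lemma pb_funs_subring : subring_closed pb_funs.
Proof.
split=> [|f g|f g].
- apply/pb_funsP; split; first exact: affinoid_fun_cst.
  by apply/power_boundedP => P; rewrite val1.
- move=> /pb_funsP[fa /power_boundedP f0] /pb_funsP[ga /power_boundedP g0].
  apply/pb_funsP; split; first exact: affinoid_funB.
  by apply/power_boundedP => P; apply: val_ge_sub.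
- move=> /pb_funsP[fa /power_boundedP f0] /pb_funsP[ga /power_boundedP g0].
  apply/pb_funsP; split; first exact: affinoid_funM.
  by apply/power_boundedP => P; rewrite val_M adde_ge0.
Qed.
HB.instance Definition _ :=
  GRing.isSubringClosed.Build (T -> K) pb_funs pb_funs_subring.

Record pb_ring := PbRing { pb_val :> T -> K; _ : pb_val \in pb_funs }.
HB.instance Definition _ := [isSub for pb_val].
HB.instance Definition _ := [Choice of pb_ring by <:].
HB.instance Definition _ := GRing.SubChoice_isSubComPzRing.Build
  (T -> K) pb_funs pb_ring pb_funs_subring.

Definition tn_ideal : {pred pb_ring} := fun h => `[< top_nilpotent h >].

Lemma tn_idealP (f : pb_ring) : reflect (top_nilpotent f) (f \in tn_ideal).
Proof. exact: asboolP. Qed.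

Lemma pb_ge0 (f : pb_ring) P : (0 <= v (f P))%E.
Proof. by have /pb_funsP[_ /power_boundedP] := valP f. Qed.

Lemma tn_ideal_closed : zmod_closed tn_ideal.
Proof.
split=> [|f g].
  by apply/tn_idealP/top_nilpotentP; exists 1 => // P; rewrite val0 leey.
move=> /tn_idealP/top_nilpotentP[d d0 fd] /tn_idealP/top_nilpotentP[e e0 ge].
apply/tn_idealP/top_nilpotentP; exists (Num.min d e) => [|P].
  by rewrite lt_min d0.
apply: val_ge_sub; [apply: le_trans (fd P)|apply: le_trans (ge P)];
by rewrite lee_fin ge_min lexx ?orbT.
Qed.
HB.instance Definition _ :=
  GRing.isZmodClosed.Build pb_ring tn_ideal tn_ideal_closed.

Lemma tn_idealMr (f g : pb_ring) : g \in tn_ideal -> f * g \in tn_ideal.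
Proof.
move=> /tn_idealP/top_nilpotentP[e e0 ge]; apply/tn_idealP/top_nilpotentP.
exists e => // P; rewrite -[e]add0r; apply: val_ge_mul => //; exact: pb_ge0.
Qed.

Definition reduction : Type := Quotient.quot tn_ideal.
HB.instance Definition _ := Quotient.on reduction.
HB.instance Definition _ := GRing.Zmodule.on reduction.

Lemma reduction_eqE (f g : pb_ring) :
  (\pi_reduction f == \pi_reduction g) = (f - g \in tn_ideal).
Proof. by rewrite Quotient.idealrBE. Qed.

Definition red_one : reduction := \pi_reduction 1.
Definition red_mul (a b : reduction) : reduction :=
  \pi_reduction (repr a * repr b).

Lemma red_mulE (f g : pb_ring) :
  red_mul (\pi_reduction f) (\pi_reduction g) = \pi_reduction (f * g).
Proof.
apply/eqP; rewrite reduction_eqE; set f' := repr _; set g' := repr _.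
have f'f : f' - f \in tn_ideal by rewrite -reduction_eqE reprK.
have g'g : g' - g \in tn_ideal by rewrite -reduction_eqE reprK.
rewrite -[_ - _](_ : g' * (f' - f) + f * (g' - g) = _).
  by rewrite rpredD // tn_idealMr.
by rewrite mulrBr mulrBr addrA [g' * f]mulrC subrK [g' * f']mulrC.
Qed.

Lemma red_mulA : associative red_mul.
Proof.
elim/quotW => f; elim/quotW => g; elim/quotW => h.
by rewrite (red_mulE g h) (red_mulE f g) !red_mulE mulrA.
Qed.

Lemma red_mulC : commutative red_mul.
Proof. by move=> a b; rewrite /red_mul mulrC. Qed.

Lemma red_mul1 : left_id red_one red_mul.
Proof. by elim/quotW => f; rewrite red_mulE mul1r. Qed.

Lemma red_mulDl : left_distributive red_mul +%R.
Proof.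
elim/quotW => f; elim/quotW => g; elim/quotW => h.
rewrite (red_mulE f h) (red_mulE g h).
have piD (a b : pb_ring) :
    \pi_reduction (a + b) = \pi_reduction a + \pi_reduction b.
  exact: (raddfD (\pi_reduction : {additive _ -> _})).
by rewrite -!piD red_mulE mulrDl.
Qed.

HB.instance Definition _ := GRing.Zmodule_isComPzRing.Build reduction
  red_mulA red_mulC red_mul1 red_mulDl.

Definition red (f : pb_ring) : reduction := \pi_reduction f.

Lemma red_zmod_morphism : zmod_morphism red.
Proof. exact: (raddfB (\pi_reduction : {additive pb_ring -> reduction})). Qed.

Lemma red_monoid_morphism : monoid_morphism red.
Proof. by split=> // f g; rewrite /red -red_mulE. Qed.

HB.instance Definition _ :=
  GRing.isZmodMorphism.Build pb_ring reduction red red_zmod_morphism.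
HB.instance Definition _ :=
  GRing.isMonoidMorphism.Build pb_ring reduction red red_monoid_morphism.

Lemma red_eqE (f g : pb_ring) : (red f == red g) = (f - g \in tn_ideal).
Proof. exact: reduction_eqE. Qed.

Lemma cst_pb (a : val_ring v) : (fun=> val a) \in pb_funs.
Proof.
apply/pb_funsP; split; first exact: affinoid_fun_cst.
by apply/power_boundedP => P; exact: (valP a).
Qed.

Definition red_cst (c : residue_field v) : reduction :=
  red (PbRing (cst_pb (repr c))).

Lemma red_cstE (a : val_ring v) :
  red_cst (\pi_(residue_field v) a) = red (PbRing (cst_pb a)).
Proof.
apply/eqP; rewrite red_eqE; apply/tn_idealP/top_nilpotentP; set b := repr _.
have ab : (0 < v (val b - val a)%R)%E by rewrite -residue_eqE reprK.
have [e|e0] := eqVneq (val b - val a) 0.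
  by exists 1 => // P; rewrite -[X in v X]/(val b - val a) e val0 leey.
have [r vr] := val_fin v e0; move: ab; rewrite vr lte_fin => r0.
by exists r => // P; rewrite -[X in v X]/(val b - val a) vr.
Qed.

Lemma red_cst_zmod_morphism : zmod_morphism red_cst.
Proof.
elim/quotW => a; elim/quotW => b.
rewrite -[_ - _](raddfB (\pi_(residue_field v) : {additive _ -> _})) !red_cstE.
by rewrite -raddfB; congr red; apply: val_inj.
Qed.

Lemma red_cst_monoid_morphism : monoid_morphism red_cst.
Proof.
split=> [|].
  rewrite -[1 in LHS](rmorph1 (\pi_(residue_field v) : {rmorphism _ -> _})).
  by rewrite red_cstE -(rmorph1 red); congr red; apply: val_inj.
elim/quotW => a; elim/quotW => b.
rewrite -[_ * _ in LHS](rmorphM (\pi_(residue_field v) : {rmorphism _ -> _})).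
by rewrite !red_cstE -rmorphM; congr red; apply: val_inj.
Qed.

HB.instance Definition _ := GRing.isZmodMorphism.Build
  (residue_field v) reduction red_cst red_cst_zmod_morphism.
HB.instance Definition _ := GRing.isMonoidMorphism.Build
  (residue_field v) reduction red_cst red_cst_monoid_morphism.

(** The closed point of the spectrum of the reduction to which [P] specializes,
    as the evaluation homomorphism with values in the residue field. *)
Definition red_pt P (a : reduction) : residue_field v := res v (repr a P).

Lemma red_ptE P (f : pb_ring) : red_pt P (red f) = res v (f P).
Proof.
apply/eqP; rewrite residue_eqE !insubdK ?integral_eltsE ?pb_ge0 //.
have : repr (red f) - f \in tn_ideal by rewrite -red_eqE /red reprK.
move=> /tn_idealP/top_nilpotentP[e e0 /(_ P)].
by apply: lt_le_trans; rewrite lte_fin.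
Qed.

Lemma resB (x y : K) :
  (0 <= v x)%E -> (0 <= v y)%E -> res v (x - y) = res v x - res v y.
Proof.
move=> x0 y0; rewrite /res -raddfB; congr (\pi _); apply: val_inj.
by rewrite /= !insubdK // integral_eltsE val_ge_sub.
Qed.

Lemma resM (x y : K) :
  (0 <= v x)%E -> (0 <= v y)%E -> res v (x * y) = res v x * res v y.
Proof.
move=> x0 y0; rewrite /res -rmorphM; congr (\pi _); apply: val_inj.
by rewrite /= !insubdK // integral_eltsE val_M adde_ge0.
Qed.

Lemma res1 : res v 1 = 1.
Proof.
rewrite -[RHS](rmorph1 (\pi_(residue_field v) : {rmorphism _ -> _})) /res.
by congr (\pi _); apply: val_inj; rewrite /= insubdK // integral_eltsE val1.
Qed.

Lemma red_pt_zmod_morphism P : zmod_morphism (red_pt P).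
Proof.
elim/quotW => f; elim/quotW => g.
by rewrite -[\pi f]/(red f) -[\pi g]/(red g) -raddfB !red_ptE resB ?pb_ge0.
Qed.

Lemma red_pt_monoid_morphism P : monoid_morphism (red_pt P).
Proof.
split; first by rewrite -(rmorph1 red) red_ptE res1.
elim/quotW => f; elim/quotW => g.
by rewrite -[\pi f]/(red f) -[\pi g]/(red g) -rmorphM !red_ptE resM ?pb_ge0.
Qed.

HB.instance Definition _ P := GRing.isZmodMorphism.Build
  reduction (residue_field v) (red_pt P) (red_pt_zmod_morphism P).
HB.instance Definition _ P := GRing.isMonoidMorphism.Build
  reduction (residue_field v) (red_pt P) (red_pt_monoid_morphism P).

(** [mmap red_cst h G], which the library only has for nontrivial target rings. *)
Definition red_eval m (h : 'I_m -> reduction) (G : {mpoly (residue_field v)[m]}) :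
    reduction :=
  \sum_(a <- msupp G) red_cst G@_a * \prod_(l < m) h l ^+ a l.

End Affinoids.

Section LocalFields.
Variables (R : realType) (F : fieldType) (vF : valuation R F).

(** [F] is a local field of equal characteristic [p] with residue field of
    cardinal [q], uniformizer [pi], and valuation normalized by [vF pi = 1]. *)
Record local_field (p q : nat) (pi : F) : Prop := LocalField {
  lf_char : p \in [pchar F];
  lf_complete : vcomplete vF;
  lf_uniformizer : vF pi = 1%E;
  lf_discrete : forall x, x != 0 -> exists n : int, vF x = (n%:~R)%:E;
  lf_residue : exists f : 'I_q -> residue_field vF, bijective f
}.

Variables (Fbar : closedFieldType) (C : fieldType) (v : valuation R C).
Variables (i : {rmorphism F -> Fbar}) (j : {rmorphism Fbar -> C}).

(** [Fbar] is an algebraic closure of [F], and [C], with a valuation extending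
    that of [F], is its completion. *)
Record completed_closure : Prop := CompletedClosure {
  cc_algebraic : forall x, algebraicOver i x;
  cc_extends : forall a, v (j (i a)) = vF a;
  cc_dense : forall x M, exists a, (M%:E <= v (x - j a)%R)%E;
  cc_complete : vcomplete v
}.

(** [x] lies in the maximal unramified extension of [F]: the value group of
    [F(x) = F[x]] is that of [F] (residue fields are perfect). *)
Definition unramified (x : Fbar) := forall g : {poly F},
  (map_poly i g).[x] != 0 ->
  exists n : int, v (j (map_poly i g).[x]) = (n%:~R)%:E.

Record inertia := Inertia {
  inertia_fun :> {rmorphism C -> C};
  inertia_inv : C -> C;
  inertiaK : cancel inertia_fun inertia_inv;
  inertia_invK : cancel inertia_inv inertia_fun;
  inertia_continuous : vcontinuous v inertia_fun;
  inertia_fix : forall x, unramified x -> inertia_fun (j x) = j x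
}.

End LocalFields.

Section LevelCurve.
Local Open Scope classical_set_scope.
Variables (R : realType) (C : fieldType) (v : valuation R C).
Variables (q : nat) (pi : C).

Definition pi_LT (X : C) := pi * X - X ^+ q.

Definition LT2_generator (pi2 : C) := pi_LT (pi_LT pi2) = 0 /\ pi_LT pi2 != 0.

Definition pi_mul (u X : C) := X ^+ (q ^ 2) + u * X ^+ q + pi * X.

Record point := Point { pt_u : C; pt_X2 : C; pt_Y2 : C }.

Definition pt_X1 P := pi_mul (pt_u P) (pt_X2 P).
Definition pt_Y1 P := pi_mul (pt_u P) (pt_Y2 P).

Definition mu2 P :=
  pt_X1 P * pt_Y2 P ^+ q - pt_X1 P ^+ q * pt_Y2 P
  - pt_X2 P ^+ q * pt_Y1 P + pt_X2 P * pt_Y1 P ^+ q.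

Definition level_curve (pi2 : C) : set point := [set P |
  [/\ (0 < v (pt_u P))%E,
      pi_mul (pt_u P) (pi_mul (pt_u P) (pt_X2 P)) = 0,
      pi_mul (pt_u P) (pi_mul (pt_u P) (pt_Y2 P)) = 0
    & mu2 P = pi2]].

Definition Z11e1 (pi2 : C) : set point := [set P |
  level_curve pi2 P /\
  [/\ v (pt_u P) = (2%:R^-1)%:E,
      v (pt_X1 P) = ((2 * (q - 1))%N%:R^-1)%:E,
      v (pt_X2 P) = ((2 * q ^ 2 * (q - 1))%N%:R^-1)%:E,
      v (pt_Y1 P) = ((2 * q * (q - 1))%N%:R^-1)%:E
    & v (pt_Y2 P) = ((2 * q ^ 3 * (q - 1))%N%:R^-1)%:E]].

Variables (pi2 alpha gamma1 gamma2 : C).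

(** The functions u, X_1, X_2, Y_1, Y_2 rescaled to have valuation 0 (when
    [alpha ^+ (2 * q ^ 2) = pi2], [v alpha = 1 / (2 q^3 (q - 1))]), together with
    their inverses: they embed the affinoid in a closed unit polydisc. *)
Definition Z_units (P : point) : seq C :=
  [:: pt_u P / alpha ^+ (q ^ 3 * (q - 1)); pt_X1 P / alpha ^+ (q ^ 3);
      pt_X2 P / alpha ^+ q; pt_Y1 P / alpha ^+ (q ^ 2); pt_Y2 P / alpha].

Definition Z_coord (k : 'I_10) (P : Z11e1 pi2) : C :=
  (Z_units (val P) ++ [seq a^-1 | a <- Z_units (val P)])`_k.

Definition x_fun (P : Z11e1 pi2) : C := pt_X2 (val P) / alpha ^+ q.
Definition y_fun (P : Z11e1 pi2) : C := pt_Y2 (val P) / alpha.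
Definition Z_fun (P : Z11e1 pi2) : C := (1 + x_fun P * y_fun P ^+ q) / gamma1.
Definition Z1_fun (P : Z11e1 pi2) : C :=
  (Z_fun P + (y_fun P ^+ (q ^ 2 - 1))^-1 + y_fun P ^+ (q ^ 2 - 1))
  / (gamma2 * y_fun P ^+ (q ^ 2 - 1)).

Definition Z_pb := pb_ring v Z_coord.
Definition Z_red := reduction v Z_coord.

Local Notation k := (residue_field v).
Local Notation Y := ('X_(@Ordinal 3 0 isT) : {mpoly k[3]}).
Local Notation W := ('X_(@Ordinal 3 1 isT) : {mpoly k[3]}).
Local Notation Z1 := ('X_(@Ordinal 3 2 isT) : {mpoly k[3]}).

(** The ring [Z_red] is k[y, 1/y, Z_1] / (Z_1^q + 1/y^(q^2-1) + y^(q^2-1)). *)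
Definition Z_red_presented (y w z : Z_red) : Prop :=
  let ev := red_eval (fun l : 'I_3 => [:: y; w; z]`_l) in
  (forall a, exists G, ev G = a) /\
  (forall G, ev G = 0 <-> exists A B, G = A * (Y * W - 1)
     + B * (Z1 ^+ q + W ^+ (q ^ 2 - 1) + Y ^+ (q ^ 2 - 1))).

Definition map_pt (f : C -> C) (P : point) :=
  Point (f (pt_u P)) (f (pt_X2 P)) (f (pt_Y2 P)).

End LevelCurve.

Section InertiaAction.
Variables (R : realType) (F : fieldType) (Fbar : closedFieldType) (C : fieldType).
Variables (v : valuation R C).
Variables (i : {rmorphism F -> Fbar}) (j : {rmorphism Fbar -> C}).
Variables (q : nat) (pi pi2 alpha : C).

(** The action P |-> P^s = s^-1(P) on points is defined on the affinoid and
    induces on its reduction the automorphism with comorphism [Phi]. *)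
Definition acts_on_reduction (s : inertia v i j)
    (Phi : Z_red v q pi pi2 alpha -> Z_red v q pi pi2 alpha) : Prop :=
  (forall P, Z11e1 v q pi pi2 P -> Z11e1 v q pi pi2 (map_pt (inertia_inv s) P)) /\
  (forall P Ps : Z11e1 v q pi pi2, val Ps = map_pt (inertia_inv s) (val P) ->
     forall a : Z_red v q pi pi2 alpha, red_pt Ps a = red_pt P (Phi a)).

End InertiaAction.

(* Main.v *)
From HB Require Import structures.
From mathcomp Require Import all_boot all_order all_algebra.
From mathcomp Require Import generic_quotient ring_quotient mpoly.
From mathcomp Require Import boolp classical_sets functions.
From mathcomp Require Import reals constructive_ereal.
From mathcomp Require finfield.
From mathcomp Require Import ring lra zify.
Require Import Defs.

(** The affinoid is studied through the units [u], [X_1], [X_2], [Y_1], [Y_2]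
    divided by the powers of [alpha] of the same valuation; they satisfy the
    equations [normal_system], whose coefficients other than 1 are divisible by
    [alpha].

    Presentation of the reduction. Modulo [alpha] the equations say that
    [y_1 = y^(q^2)], [x_1 = x^(q^2)], [u = - y^(q^4 - q^3)] and
    [(1 + x y^q)^q = 0]. They are contractions for [u], [y_1] and [x_1]
    ([appr_u], [clos_x1]), so all coordinates and their inverses are uniform
    limits of integral polynomials in [x], [y], [1/y]; and [x^q] is congruent to
    [- y^(-q^2)], so degrees less than [q] in [x] suffice
    ([gen_normal_approx]). Now [x] is affine in [Z_1] over [C[y, 1/y]], so every
    affinoid function is a uniform limit of Laurent polynomials in [y] with
    degree less than [q] in [Z_1] ([affinoid_z_approx]). The next order of the
    equation [mu_2 = pi_2] gives [Z_1^q + y^-(q^2-1) + y^(q^2-1)] positive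
    valuation ([normal_relation]).

    For a Laurent polynomial of degree less than [q] in [Z_1], the supremum norm
    is the maximum of the coefficients ([integral_coefficients]), because
    [1, z, .., z^(q-1)] are independent over the functions of [y] on the curve
    [z^q = - (y^-(q^2-1) + y^(q^2-1))] ([curve_independence]). This yields both
    that [y], [1/y], [Z_1] generate the reduction and that the relations are the
    stated ones. It requires a point of the affinoid above every residue class of
    [y]: for [y] in the algebraic closure of [F], the equations for [u] and then
    for [x] have a root of valuation 0 ([normal_points], [unit_root]), and the
    solution is a torsion point because a nonzero defect would have the wrong
    valuation ([mu2_defect], [normal_Z11e1]).

    Action of inertia. A continuous automorphism that fixes [pi] preserves the
    valuation ([inertia_val]), and [sigma] fixes the roots of unity of [Fbar]
    that represent the nonzero residues, hence acts trivially on residues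
    ([inertia_residue]). Therefore the comorphism of [P |-> sigma^-1(P)] on the
    reduction is induced by [f |-> sigma o f o sigma^-1], which is [C]-semilinear,
    preserves affinoid functions ([twist_affinoid]) and fixes constants of the
    reduction. In characteristic [p], [zeta^(2 q^2) = 1] forces [zeta^2 = 1]; so
    [gamma_1], [gamma_2], [x y^q] and [y^(q^2-1)] are unchanged, [Z_1] is fixed
    and [y = Y_2 / alpha] is divided by [zeta]. *)

Set Implicit Arguments.
Unset Strict Implicit.
Unset Printing Implicit Defensive.
Import Order.TTheory GRing.Theory Num.Theory.
Local Open Scope ring_scope.
Local Open Scope quotient_scope.

(** * Valuations and unit roots *)

Section Valuations.
Variables (R : realType) (K : fieldType) (v : valuation R K).
Implicit Types (x y : K) (a : \bar R) (r s : R).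

Lemma val_fin_neq0 x r : v x = r%:E -> x != 0.
Proof. by move=> vx; rewrite -(val_y v) vx. Qed.

Lemma val_ge_fin x r : v x = r%:E -> (r%:E <= v x)%E.
Proof. by move=> ->. Qed.

Lemma val_unit_ge0 x : v x = 0%E -> (0 <= v x)%E.
Proof. by move=> ->. Qed.

Lemma valB x y : v (x - y) = v (y - x).
Proof. by rewrite -valN opprB. Qed.

Lemma valV_fin x r : v x = r%:E -> v x^-1 = (- r)%:E.
Proof.
move=> vx; have x0 := val_fin_neq0 vx.
have [s vs] := val_fin v (invr_neq0 x0); have := val_M v x x^-1.
rewrite divff // val1 vx vs -EFinD => -[] /esym/eqP.
by rewrite addrC addr_eq0 => /eqP ->.
Qed.

Lemma valM_fin x y r s : v x = r%:E -> v y = s%:E -> v (x * y) = (r + s)%:E.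
Proof. by move=> vx vy; rewrite val_M vx vy. Qed.

(** If [v (x + y)] exceeded [v x], so would the valuation of
    [x = (x + y) - y]. *)
Lemma valDl x y : (v x < v y)%E -> v (x + y) = v x.
Proof.
move=> xy; apply/eqP; rewrite eq_le; apply/andP; split; last first.
  by apply: val_ge_add => //; exact: ltW.
rewrite leNgt; apply/negP => h.
have := val_D v (x + y) (- y); rewrite addrK valN => h'.
by have := lt_le_trans _ h'; move=> /(_ (v x)); rewrite lt_min h xy ltxx => /(_ isT).
Qed.

Lemma val_gt_add a x y : (a < v x -> a < v y -> a < v (x + y)%R)%E.
Proof. by move=> ax ay; apply: lt_le_trans (val_D v _ _); rewrite lt_min ax. Qed.

Lemma val_gt_sub a x y : (a < v x -> a < v y -> a < v (x - y)%R)%E.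
Proof. by move=> ax ay; apply: val_gt_add; rewrite ?valN. Qed.

Lemma val_ge0M x y : (0 <= v x -> 0 <= v y -> 0 <= v (x * y)%R)%E.
Proof. by move=> x0 y0; rewrite val_M adde_ge0. Qed.

Lemma val_ge0X x n : (0 <= v x -> 0 <= v (x ^+ n)%R)%E.
Proof. by move=> x0; have := valX_ge n x0; rewrite mul0rn. Qed.

Lemma val_unitM x y : v x = 0%E -> v y = 0%E -> v (x * y) = 0%E.
Proof. by move=> vx vy; rewrite val_M vx vy adde0. Qed.

Lemma val_unitX x n : v x = 0%E -> v (x ^+ n) = 0%E.
Proof. by move=> vx; rewrite (valX_fin n vx) mul0rn. Qed.

Lemma val_unit_neq0 x : v x = 0%E -> x != 0.
Proof. exact: val_fin_neq0. Qed.

Lemma val_unitV x : v x = 0%E -> v x^-1 = 0%E.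
Proof. by move=> vx; apply: valV => //; exact: val_unit_neq0. Qed.

Lemma val_unitD x y : v x = 0%E -> (0 < v y)%E -> v (x + y) = 0%E.
Proof. by move=> vx vy; rewrite valDl vx. Qed.

Lemma val_gt0Ml x y : (0 < v x -> 0 <= v y -> 0 < v (x * y)%R)%E.
Proof. by move=> x0 y0; rewrite val_M; apply: lt_le_trans x0 _; rewrite leeDl. Qed.

Lemma val_gt0Mr x y : (0 <= v x -> 0 < v y -> 0 < v (x * y)%R)%E.
Proof. by move=> x0 y0; rewrite mulrC; exact: val_gt0Ml. Qed.

Lemma val_gt0X x n : (0 < v x -> 0 < v (x ^+ n.+1)%R)%E.
Proof.
by move=> x0; rewrite exprS; apply: val_gt0Ml => //; apply/val_ge0X/ltW.
Qed.

Lemma val_ge_mul0 r x y : (r%:E <= v x -> 0 <= v y -> r%:E <= v (x * y)%R)%E.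
Proof. by move=> hx hy; rewrite -[r]addr0; exact: val_ge_mul. Qed.

Lemma val_ge_mul0r r x y : (0 <= v x -> r%:E <= v y -> r%:E <= v (x * y)%R)%E.
Proof. by move=> hx hy; rewrite mulrC; exact: val_ge_mul0. Qed.

Lemma val_ge_trans r s x : s <= r -> (r%:E <= v x -> s%:E <= v x)%E.
Proof. by move=> sr; apply: le_trans; rewrite lee_fin. Qed.

Lemma val_gt0_fin x : (0 < v x)%E -> exists2 r, 0 < r & (r%:E <= v x)%E.
Proof.
have [->|x0] := eqVneq x 0; first by exists 1 => //; rewrite val0 leey.
by have [r ->] := val_fin v x0; rewrite lte_fin => r0; exists r.
Qed.

Lemma val_lb x : exists r, (r%:E <= v x)%E.
Proof.
have [->|/(val_fin v)[r ->]] := eqVneq x 0; first by exists 0; rewrite val0 leey.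
by exists r.
Qed.

Lemma val_Xgt0 x n : (0 < v (x ^+ n)%R)%E -> (0 < v x)%E.
Proof.
have [->|/(val_fin v)[r vx]] := eqVneq x 0; first by rewrite val0 ltry.
rewrite (valX_fin n vx) vx !lte_fin; case: n => [|n]; first by rewrite ltxx.
by rewrite pmulrn_lgt0.
Qed.

Lemma val_Xge n r x : (0 < n)%N ->
  ((r *+ n)%:E <= v (x ^+ n)%R)%E -> (r%:E <= v x)%E.
Proof.
have [->|/(val_fin v)[s vx]] := eqVneq x 0; first by rewrite val0 leey.
by move=> n0; rewrite (valX_fin n vx) vx !lee_fin lerMn2r eqn0Ngt n0.
Qed.

Lemma val_Xfin n r x : (0 < n)%N -> v (x ^+ n) = (r *+ n)%:E -> v x = r%:E.
Proof.
move=> n0; have [->|/(val_fin v)[s vx]] := eqVneq x 0.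
  by rewrite expr0n -(prednK n0) /= val0.
rewrite (valX_fin n vx) vx => -[] /eqP; rewrite eqrMn2r ?eqn0Ngt ?n0 //.
by move=> /eqP ->.
Qed.

(** The valuation is separated; this turns approximate identities obtained
    from limits into identities. *)
Lemma val_eq0_ge x : (forall n : nat, (n%:R%:E <= v x)%E) -> x = 0.
Proof.
move=> h; apply/eqP; apply/negPn/negP => /(val_fin v)[r vx].
have := h (Num.bound `|r|); rewrite vx lee_fin.
move=> /(lt_le_trans (archi_boundP (normr_ge0 r))) /lt_le_trans/(_ (ler_norm r)).
by rewrite ltxx.
Qed.

Lemma val_prod_gt0 (s : seq K) (F : K -> K) :
  (0 < v (\prod_(z <- s) F z)%R)%E -> exists2 z, z \in s & (0 < v (F z))%E.
Proof.
elim: s => [|z s IH]; first by rewrite big_nil val1 ltxx.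
rewrite big_cons => h; have [h1|h1] := ltP 0%E (v (F z)).
  by exists z => //; rewrite mem_head.
have [|t ts ht] := IH; last by exists t => //; rewrite inE ts orbT.
move: h; rewrite val_M ltNge => h; rewrite ltNge; apply: contra h => h.
by rewrite -[0%E]adde0 leeD.
Qed.

End Valuations.

Section UnitRoot.
Variables (R : realType) (K : closedFieldType) (v : valuation R K).

(** The Newton polygon of [P] has a segment of slope 0. Indeed an integral root
    is a unit, as [P`_0] is; and if no root were integral, [P] would be
    [P`_0] times a product of factors [1 - z^-1 X] with [z^-1] in the maximal
    ideal, so that all coefficients of [P] but the first would lie there. *)
Lemma unit_root (P : {poly K}) n : (forall k, (0 <= v P`_k)%E) ->
  v P`_0 = 0%E -> (0 < n)%N -> v P`_n = 0%E ->
  exists2 z, root P z & v z = 0%E.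
Proof.
move=> P0 Pc n0 Pn.
have [s Ps] := closed_field_poly_normal P.
have P_neq0 : P != 0.
  by apply: contra_eq_neq Pc => ->; rewrite coef0 val0.
have rootP z : root P z = (z \in s).
  by rewrite Ps rootZ ?lead_coef_eq0 // root_prod_XsubC.
have [[z zs z0]|noroot] := pselect (exists2 z, z \in s & (0 <= v z)%E).
  exists z; first by rewrite rootP.
  apply/eqP; rewrite eq_le z0 andbT leNgt; apply/negP => z_gt0.
  have := rootP z; rewrite zs => /eqP Pz.
  suff : (0 < v (P`_0)%R)%E by rewrite Pc ltxx.
  have {Pz} : P`_0 = - \sum_(i < (size P).-1) P`_i.+1 * z ^+ i.+1.
    apply/eqP; rewrite -addr_eq0; apply/eqP; rewrite -[RHS]Pz horner_coef.
    case E : (size P) => [|m]; first last.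
      by rewrite big_ord_recl expr0 mulr1.
    by move/eqP: E; rewrite size_poly_eq0 (negPf P_neq0).
  move=> ->; rewrite valN; elim/big_ind: _ => [|x y|i _].
  - by rewrite val0 ltry.
  - exact: val_gt_add.
  - by apply: val_gt0Mr => //; exact: val_gt0X.
have sN z : z \in s -> (0 < v (z^-1)%R)%E.
  move=> zs; have [z0|] := ltP (v z) 0%E; last by move=> h; case: noroot; exists z; [exact: zs|exact: h].
  have [zz|/(val_fin v)[r vz]] := eqVneq z 0; first by move: z0; rewrite zz val0.
  by move: z0; rewrite (valV_fin vz) vz !lte_fin oppr_gt0.
have sn0 z : z \in s -> z != 0.
  move=> zs; have [z0|//] := eqVneq z 0.
  by case: noroot; exists z => //; rewrite z0 val0 leey.
pose Q (t : seq K) := \prod_(z <- t) (1 - z^-1 *: 'X) : {poly K}.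
have QE t : {subset t <= s} ->
    \prod_(z <- t) ('X - z%:P) = (\prod_(z <- t) (- z)) *: Q t.
  move=> ts; rewrite /Q -mul_polyC rmorph_prod -big_split /=.
  apply: eq_big_seq => z zt; rewrite mulrBr mulr1 polyCN mulNr opprK addrC.
  by rewrite -mul_polyC mulrA -polyCM divff ?mul1r // sn0 // ts.
have Q1 (t : seq K) : {subset t <= s} -> forall k, (0 < v ((Q t - 1)`_k)%R)%E.
  elim: t => [|z t IH] ts k; first by rewrite /Q big_nil subrr coef0 val0 ltry.
  have {}IH : forall k, (0 < v ((Q t - 1)`_k)%R)%E.
    by apply: IH => u ut; apply: ts; rewrite inE ut orbT.
  rewrite /Q big_cons -/(Q t) mulrBl mul1r addrAC coefB; apply: val_gt_sub => //.
  rewrite -scalerAl coefZ; apply: val_gt0Ml; first by rewrite sN // ts ?mem_head.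
  rewrite coefXM; case: k => [|k] /=; first by rewrite val0 leey.
  rewrite -[Q t](subrK 1) coefD; apply: val_ge_add; first exact: ltW.
  by rewrite coef1; case: k => [|k] /=; rewrite ?val1 ?val0 ?leey.
have PQ : P = P`_0 *: Q s.
  have : P`_0 = lead_coef P * \prod_(z <- s) - z * (Q s)`_0.
    by rewrite {1}Ps QE // !coefZ mulrA.
  have -> : (Q s)`_0 = 1.
    rewrite /Q coef0_prod big1 // => z _.
    by rewrite coefB coefZ coefX coef1 mulr0 subr0.
  by rewrite mulr1 => ->; rewrite {1}Ps QE // scalerA.
have := Q1 s (fun _ h => h) n; rewrite coefB coef1 eqn0Ngt n0 subr0.
by move: Pn; rewrite PQ coefZ val_M Pc add0e => ->; rewrite ltxx.
Qed.

End UnitRoot.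

(** * Frobenius and Teichmueller representatives *)

(** The bijection transports the theory of finite fields to [k]. *)
Lemma finite_field_card (k : fieldType) (p q : nat) (f : 'I_q -> k) :
  bijective f -> p \in [pchar k] ->
  (exists2 n, (0 < n)%N & q = (p ^ n)%N) /\ forall x : k, x ^+ q = x.
Proof.
move=> [g fK gK] pk.
pose kc : countType := HB.pack (GRing.Field.sort k) (CanIsCountable gK).
pose kt : finType := HB.pack (GRing.Field.sort k) kc
  (CanIsFinite (gK : @cancel 'I_q kc g f)).
pose kf : finFieldType := HB.pack (GRing.Field.sort k) k kt.
have q_card : #|kf| = q.
  by rewrite -[RHS]card_ord; apply: (@bij_eq_card kf _ g); exists f.
have [n n0 card_kf] : exists2 n, (0 < n)%N & #|kf| = (p ^ n)%N.
  have := @finfield.card_pprimeChar p kf pk.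
  set n := logn _ _ => E; exists n => //.
  rewrite lt0n; apply/eqP => n0; move: E; rewrite n0 expn0 => E.
  by have := finfield.finNzRing_gt1 kf; rewrite E.
split; first by exists n; rewrite // -q_card.
by move=> x; rewrite -q_card; exact: (@finfield.expf_card kf).
Qed.

Section Frobenius.
Variables (K : idomainType) (N : nat) (NK : [pchar K].-nat N).
Implicit Types x y : K.

Lemma frobD x y : (x + y) ^+ N = x ^+ N + y ^+ N.
Proof. exact: exprDn_pchar. Qed.

Lemma frobN x : (- x) ^+ N = - x ^+ N.
Proof. exact: exprNn_pchar. Qed.

Lemma frobB x y : (x - y) ^+ N = x ^+ N - y ^+ N.
Proof. by rewrite frobD frobN. Qed.

Lemma frob_sum (I : Type) (s : seq I) (P : pred I) (G : I -> K) :
  (\sum_(i <- s | P i) G i) ^+ N = \sum_(i <- s | P i) G i ^+ N.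
Proof.
elim/big_rec2: _ => [|i x y _ <-]; last by rewrite frobD.
by rewrite expr0n eqn0Ngt; case/andP: NK => ->.
Qed.

Lemma frob_inj : injective (fun x => x ^+ N).
Proof.
move=> x y /eqP; rewrite -subr_eq0 -frobB expf_eq0 subr_eq0.
by move=> /andP[_ /eqP].
Qed.

End Frobenius.

Section LocalField.
Variables (R : realType) (F : fieldType) (vF : valuation R F).
Variables (p q : nat) (pi : F).
Hypothesis F_local : local_field vF p q pi.

Lemma local_residue :
  (exists2 n, (0 < n)%N & q = (p ^ n)%N) /\
  forall x : residue_field vF, x ^+ q = x.
Proof.
case: F_local => pF _ _ _ [f fbij]; apply: finite_field_card fbij _.
have pp := pcharf_prime pF; rewrite inE pp /=.
rewrite -(rmorph_nat (\pi_(residue_field vF) : {rmorphism _ -> _})).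
rewrite residue_eq0E rmorph_nat (eqP (_ : p%:R == 0 :> F)) ?val0 ?ltry //.
by case/andP: pF.
Qed.

Lemma local_q_gt1 : (1 < q)%N.
Proof.
have [[n n0 ->] _] := local_residue.
have pp := pcharf_prime (lf_char F_local).
by rewrite -{1}(expn0 p) ltn_exp2l // prime_gt1.
Qed.

Lemma local_q_pchar : [pchar F].-nat q.
Proof.
have [[n n0 ->] _] := local_residue; rewrite pnatX pnatE ?(lf_char F_local) //.
exact: pcharf_prime (lf_char F_local).
Qed.

Lemma local_frob a : (0 <= vF a)%E -> (0 < vF (a ^+ q - a)%R)%E.
Proof.
move=> a0; have [_ /(_ (res vF a))/eqP] := local_residue.
rewrite /res -rmorphXn residue_eqE rmorphXn /=.
by rewrite insubdK // integral_eltsE.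
Qed.

Lemma local_ge1 a : (0 < vF a -> 1 <= vF a)%E.
Proof.
have [->|a0] := eqVneq a 0; first by rewrite val0 leey.
have [n ->] := lf_discrete F_local a0; rewrite lte_fin lee_fin.
by rewrite ltr0z ler1z.
Qed.

(** In characteristic [p] the difference of successive powers [a ^+ (q ^ n)] is
    [(a ^+ q - a) ^+ (q ^ n)], of valuation at least [q ^ n]; the limit is the
    Teichmueller representative of [a], and such elements are closed under
    addition. *)
Lemma teichmueller a : (0 <= vF a)%E ->
  exists2 t, t ^+ q = t & (0 < vF (a - t)%R)%E.
Proof.
move=> a0; have q1 := local_q_gt1.
have qnF n : [pchar F].-nat (q ^ n)%N by rewrite pnatX local_q_pchar.
pose s n := a ^+ (q ^ n).
have vs n : (n%:R%:E <= vF (s n.+1 - s n)%R)%E.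
  rewrite /s expnS exprM -frobB //.
  have h := local_ge1 (local_frob a0).
  apply: le_trans (valX_ge (q ^ n) h); rewrite lee_fin ler_nat.
  exact: ltnW (ltn_expl _ _).
have vsm N m : (N%:R%:E <= vF (s (N + m)%N - s N)%R)%E.
  elim: m => [|m IH]; first by rewrite addn0 subrr val0 leey.
  rewrite addnS -(subrKA (s (N + m)%N)); apply: val_ge_add => //.
  apply: le_trans (vs _); rewrite lee_fin ler_nat leq_addr //.
have [M|t ts] := lf_complete F_local (s := s).
  exists (Num.bound `|M|) => m n /subnKC <- /subnKC <-.
  set N := Num.bound _.
  rewrite -[_ - _](_ : (s (N + (m - N))%N - s N) - (s (N + (n - N))%N - s N) = _).
    have NM : (M%:E <= N%:R%:E)%E.
      rewrite lee_fin; apply: le_trans (ler_norm M) _; apply: ltW.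
      exact: archi_boundP.
    by apply: val_ge_sub; apply: le_trans NM _.
  by rewrite opprB addrA subrK.
have stq n M : (M%:E <= vF (s n - t)%R -> (0 <= M)%R -> M%:E <= vF (s n.+1 - t ^+ q)%R)%E.
  move=> h M0; rewrite /s expnSr exprM -frobB ?local_q_pchar //.
  apply: le_trans (valX_ge q h); rewrite lee_fin -mulr_natl ler_peMl //.
  by rewrite ler1n ltnW.
exists t; last first.
  have [N /(_ N (leqnn N)) h] := ts 1.
  rewrite -(subrKA (s N)); apply: val_gt_add; last by apply: lt_le_trans h; rewrite lte_fin.
  rewrite valB; elim: N {h} => [|N IH]; first by rewrite /s expn0 expr1 subrr val0 ltry.
  rewrite -(subrKA (s N)); apply: val_gt_add => //.
  rewrite /s expnSr exprM; apply: local_frob; exact: val_ge0X.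
apply/eqP; rewrite -subr_eq0; apply/eqP; apply: (val_eq0_ge (v := vF)) => n.
have [N h] := ts n%:R.
rewrite -(subrKA (s N.+1)); apply: val_ge_add; last by apply: h.
by rewrite valB; apply: stq => //; apply: h.
Qed.

End LocalField.

(** * Residues in the algebraic closure *)

Section ValuationPullback.
Variables (R : realType) (L K : fieldType) (v : valuation R K).
Variable f : {rmorphism L -> K}.

Lemma val_comp_Ny x : v (f x) != -oo%E. Proof. exact: val_Ny. Qed.

Lemma val_comp_y x : (v (f x) == +oo%E) = (x == 0).
Proof. by rewrite val_y fmorph_eq0. Qed.

Lemma val_comp_M x y : v (f (x * y)) = (v (f x) + v (f y))%E.
Proof. by rewrite rmorphM val_M. Qed.

Lemma val_comp_D x y :
  (Order.min (v (f x)) (v (f y)) <= v (f (x + y)%R))%E.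
Proof. by rewrite rmorphD; exact: val_D. Qed.

Definition val_comp : valuation R L :=
  Valuation val_comp_Ny val_comp_y val_comp_M val_comp_D.

Lemma val_compE x : val_comp x = v (f x). Proof. by []. Qed.

End ValuationPullback.

Section Closure.
Variables (R : realType) (F : fieldType) (vF : valuation R F).
Variables (p q : nat) (pi : F).
Hypothesis F_local : local_field vF p q pi.
Variables (Fbar : fieldType) (vb : valuation R Fbar) (i : {rmorphism F -> Fbar}).
Hypothesis i_alg : forall x, algebraicOver i x.
Hypothesis i_val : forall a, vb (i a) = vF a.
Implicit Types (x : Fbar).

(** The residue of [x] is algebraic over the residue field of [F]: dividing
    an equation of [x] by its last coefficient of minimal valuation gives an
    integral relation that becomes monic modulo the maximal ideal. *)
Lemma residual_relation x : (0 <= vb x)%E -> exists d (b : nat -> F),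
  (forall k, 0 <= vF (b k))%E /\
  (0 < vb (x ^+ d - \sum_(k < d) i (b k) * x ^+ k)%R)%E.
Proof.
move=> x0; have [P P0 Px] := i_alg x.
have sP : (0 < size P)%N by rewrite size_poly_gt0.
set n := size P in sP *; pose a (k : 'I_n) := vF P`_k.
case: (Order.TotalTheory.arg_minP (i0 := Ordinal sP) (P := predT) a isT).
move=> i1 _ i1min.
case: (arg_maxnP (P := fun k => a k == a i1) (i0 := i1) (@nat_of_ord n) (eqxx _)).
move=> [d dn] /eqP ad dmax.
have Pd0 : P`_d != 0.
  rewrite -(val_y vF) -[vF _]/(a (Ordinal dn)) ad.
  have : P`_n.-1 != 0 by rewrite -lead_coefE lead_coef_eq0.
  have nn : (n.-1 < n)%N by rewrite prednK.
  rewrite -(val_y vF) -[vF _]/(a (Ordinal nn)) => h.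
  by apply: contraNneq h => e; have := i1min (Ordinal nn) isT; rewrite e leye_eq.
have [m vPd] := val_fin vF Pd0.
pose c k := P`_k / P`_d.
have c0 k : (0 <= vF (c k))%E.
  rewrite /c; have [kn|kn] := ltnP k n; last by rewrite nth_default // mul0r val0 leey.
  have := i1min (Ordinal kn) isT; rewrite -ad -[a _]/(vF P`_d) -[a _]/(vF P`_k) vPd.
  have [->|/(val_fin vF)[s vs]] := eqVneq P`_k 0; first by rewrite mul0r val0 !leey.
  by rewrite (valM_fin vs (valV_fin vPd)) vs !lee_fin subr_ge0.
have c1 k : (d < k)%N -> (0 < vF (c k))%E.
  move=> dk; rewrite /c.
  have [kn|kn] := ltnP k n; last by rewrite nth_default // mul0r val0 ltry.
  have := i1min (Ordinal kn) isT; rewrite le_eqVlt => /orP[/eqP h|].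
    by have := dmax (Ordinal kn); rewrite h eqxx /= => /(_ isT); rewrite leqNgt dk.
  rewrite -ad -[a _]/(vF P`_d) -[a _]/(vF P`_k) vPd.
  have [->|/(val_fin vF)[s vs]] := eqVneq P`_k 0; first by rewrite mul0r val0 !ltry.
  by rewrite (valM_fin vs (valV_fin vPd)) vs !lte_fin subr_gt0.
exists d, (fun k => - c k); split=> [k|]; first by rewrite valN.
have E : \sum_(0 <= k < n) i (c k) * x ^+ k = 0.
  move/eqP: Px; rewrite horner_coef size_map_poly -/n big_mkord => Px.
  transitivity (i (P`_d)^-1 * \sum_(k < n) (map_poly i P)`_k * x ^+ k).
    rewrite mulr_sumr; apply: eq_bigr => k _.
    by rewrite coef_map /= /c rmorphM [i _ * _]mulrC mulrA.
  by rewrite Px mulr0.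
suff -> : x ^+ d - \sum_(k < d) i (- c k) * x ^+ k =
    - \sum_(d.+1 <= k < n) i (c k) * x ^+ k.
  rewrite valN big_nat; elim/big_ind: _ => [|y z|k /andP[dk _]].
  - by rewrite val0 ltry.
  - exact: val_gt_add.
  - by apply: val_gt0Ml; [rewrite i_val; apply: c1|apply: val_ge0X].
apply/eqP; rewrite -subr_eq0 opprK -[X in _ == X]E.
rewrite [X in _ == X](@big_cat_nat _ _ _ d) //= 1?ltnW // (big_ltn dn) big_mkord.
have cd : c d = 1 by rewrite /c divff.
rewrite cd rmorph1 mul1r.
under eq_bigr do rewrite rmorphN mulNr.
by rewrite sumrN opprK addrAC addrC addrA.
Qed.

(** The residual relation rewrites every power of [x] as a combination of the
    first [d] ones, so that powers of [x] have finitely many residues. *)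
Lemma residual_power x : (0 <= vb x)%E -> exists d, forall N, exists b : nat -> F,
  (forall k, 0 <= vF (b k))%E /\
  (0 < vb (x ^+ N - \sum_(k < d) i (b k) * x ^+ k)%R)%E.
Proof.
move=> x0; have [d [r [r0 rx]]] := residual_relation x0.
exists d; elim=> [|N [b [b0 bx]]].
  case: d {rx} (rx) => [|d] rx; first by exists r.
  exists (fun k => (k == 0)%N%:R); split=> [k|].
    by case: eqP; rewrite ?val1 ?val0 ?leey.
  rewrite big_ord_recl big1 => [|k _]; last by rewrite rmorph0 mul0r.
  by rewrite rmorph1 mul1r addr0 subrr val0 ltry.
case: d rx bx => [|d] rx bx.
  exists b; split=> //; move: bx; rewrite !big_ord0 !subr0 exprS => bx.
  exact: val_gt0Mr.
exists (fun k => (if k is k'.+1 then b k' else 0) + b d * r k); split=> [k|].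
  apply: val_ge_add; last exact: val_ge0M.
  by case: k => [|k]; rewrite ?val0 ?leey.
rewrite -[_ - _](_ : x * (x ^+ N - \sum_(k < d.+1) i (b k) * x ^+ k) +
    i (b d) * (x ^+ d.+1 - \sum_(k < d.+1) i (r k) * x ^+ k) = _).
  apply: val_gt_add; first exact: val_gt0Mr.
  by apply: val_gt0Mr; rewrite ?i_val.
rewrite !mulrBr -exprS.
have -> : \sum_(k < d.+1) i ((if k : nat is k'.+1 then b k' else 0) + b d * r k)
    * x ^+ k = \sum_(k < d) i (b k) * x ^+ k.+1 +
    i (b d) * \sum_(k < d.+1) i (r k) * x ^+ k.
  rewrite mulr_sumr.
  under eq_bigr do rewrite rmorphD mulrDl rmorphM -mulrA.
  rewrite big_split /=; congr (_ + _).
  by rewrite big_ord_recl /= rmorph0 mul0r add0r.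
rewrite [\sum_(k < d.+1) i (b k) * _]big_ord_recr /= mulrDr mulr_sumr.
rewrite (eq_bigr (fun k : 'I_d => i (b k) * x ^+ k.+1)); last first.
  by move=> k _; rewrite exprS mulrCA.
have -> : x * (i (b d) * x ^+ d) = i (b d) * x ^+ d.+1 by rewrite exprS mulrCA.
ring.
Qed.

Lemma bar_pchar : [pchar Fbar].-nat q.
Proof.
have [[n n0 ->] _] := local_residue F_local; rewrite pnatX pnatE.
  by rewrite (fmorph_pchar i) (lf_char F_local).
exact: pcharf_prime (lf_char F_local).
Qed.

(** By pigeonhole two powers [x ^+ (q ^ a)] and [x ^+ (q ^ b)] are congruent,
    and the Frobenius is injective on residues. *)
Lemma residual_frob x : (0 <= vb x)%E ->
  exists2 n, (0 < n)%N & (0 < vb (x ^+ (q ^ n) - x)%R)%E.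
Proof.
move=> x0; have [d /boolp.choice[B HB]] := residual_power x0.
have [f [g fK gK]] := lf_residue F_local.
pose code N : {ffun 'I_d -> 'I_q} := [ffun k : 'I_d => g (res vF (B N k))].
have code_eq N M : code N = code M -> (0 < vb (x ^+ N - x ^+ M)%R)%E.
  move=> /ffunP NM; have [[BN Nx] [BM Mx]] := (HB N, HB M).
  rewrite -[_ - _](_ : (x ^+ N - \sum_(k < d) i (B N k) * x ^+ k)
    - (x ^+ M - \sum_(k < d) i (B M k) * x ^+ k)
    + (\sum_(k < d) i (B N k - B M k) * x ^+ k) = _); last first.
    have -> : \sum_(k < d) i (B N k - B M k) * x ^+ k =
        \sum_(k < d) i (B N k) * x ^+ k - \sum_(k < d) i (B M k) * x ^+ k.
      by rewrite -sumrB; apply: eq_bigr => k _; rewrite rmorphB mulrBl.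
    ring.
  apply: val_gt_add; first exact: val_gt_sub.
  elim/big_ind: _ => [|y z|k _]; first by rewrite val0 ltry.
    exact: val_gt_add.
  apply: val_gt0Ml; last exact: val_ge0X.
  rewrite i_val; have := NM k; rewrite !ffunE => /(can_inj gK)/eqP.
  by rewrite /res residue_eqE !insubdK // integral_eltsE.
have q0 : (0 < q)%N by apply: ltnW; exact: (local_q_gt1 F_local).
suff H a b : (a < b)%N -> code (q ^ a)%N = code (q ^ b)%N ->
    exists2 n, (0 < n)%N & (0 < vb (x ^+ (q ^ n) - x)%R)%E.
  pose S := {ffun 'I_d -> 'I_q}.
  have /injectivePn[a [b ab cab]] :
      ~~ injectiveb (fun a : 'I_(#|{: S}|.+1) => code (q ^ a)%N).
    apply/negP => /injectiveP/leq_card; rewrite card_ord ltnn //.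
  have := ab; rewrite -val_eqE /= neq_ltn => /orP[/H|/H]; first exact.
  by apply; rewrite cab.
move=> ab /code_eq h; exists (b - a)%N; first by rewrite subn_gt0.
apply: (@val_Xgt0 _ _ _ _ (q ^ a)%N).
rewrite frobB ?pnatX ?bar_pchar // -exprM -expnD subnK 1?ltnW //.
by rewrite valB.
Qed.

(** Over an algebraically closed field [X ^+ N - X] is a product of factors
    [X - t]; one of them has positive valuation at [x]. *)
Lemma residual_root (L : closedFieldType) (vL : valuation R L) (x : L) N :
  (1 < N)%N -> (0 < vL (x ^+ N - x)%R)%E ->
  exists2 t, t ^+ N = t & (0 < vL (x - t)%R)%E.
Proof.
move=> N1 h; pose P : {poly L} := 'X^N - 'X.
have Pm : lead_coef P = 1.
  by rewrite lead_coefDl ?lead_coefXn // size_polyN size_polyX size_polyXn ltnS.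
have [s Ps] := closed_field_poly_normal P.
move: Ps; rewrite Pm scale1r => Ps.
have Px y : P.[y] = y ^+ N - y by rewrite !hornerE.
move: h; rewrite -Px Ps horner_prod => /val_prod_gt0[t ts].
rewrite !hornerE => h; exists t => //.
by apply/eqP; rewrite -subr_eq0 -Px Ps; rewrite -rootE root_prod_XsubC.
Qed.

(** The digits of the expansion of an element of [F[t]] in powers of [pi] are
    polynomials in [t] over the Teichmueller representatives, hence roots of
    [X^N - X]: they vanish or are units. So the valuation is the rank of the
    first nonzero digit. *)
Lemma root_unramified t N : (1 < N)%N -> (exists n, N = q ^ n)%N -> t ^+ N = t ->
  forall g : {poly F}, (map_poly i g).[t] != 0 ->
  exists n : int, vb (map_poly i g).[t] = (n%:~R)%:E.
Proof.
move=> N1 [e Nq] tN.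
have NK : [pchar Fbar].-nat N by rewrite Nq pnatX bar_pchar.
have root_unit s : s ^+ N = s -> s != 0 -> vb s = 0%E.
  move=> sN s0; have [r vs] := val_fin vb s0.
  have := valX_fin N vs; rewrite sN vs => -[] /eqP.
  case: N N1 {tN Nq NK sN} => [|[|N]] // _; rewrite mulrS -subr_eq0 opprD addNKr.
  by rewrite oppr_eq0 mulrn_eq0 => /eqP ->.
have vpi : vF pi = 1%E := lf_uniformizer F_local.
have pi0 : pi != 0 by exact: val_fin_neq0 vpi.
have digit (g : {poly F}) : (forall k, 0 <= vF g`_k)%E ->
    exists s (g' : {poly F}), [/\ s ^+ N = s, forall k, (0 <= vF g'`_k)%E &
      (map_poly i g).[t] = s + i pi * (map_poly i g').[t]].
  move=> g0; have /boolp.choice[T HT] : forall k, exists a, a ^+ q = a /\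
      (0 < vF (g`_k - a)%R)%E.
    by move=> k; have [a aq ha] := teichmueller F_local (g0 k); exists a.
  have TN k : T k ^+ N = T k.
    rewrite Nq; elim: (e) => [|e' IH]; first by rewrite expn0 expr1.
    by rewrite expnS exprM (HT k).1.
  exists (\sum_(k < size g) i (T k) * t ^+ k).
  exists (\poly_(k < size g) ((g`_k - T k) / pi)); split=> [|k|].
  - rewrite (frob_sum NK); apply: eq_bigr => k _.
    by rewrite exprMn -rmorphXn TN exprAC tN.
  - rewrite coef_poly; case: ifP => _; last by rewrite val0 leey.
    have := val_ge_mul (local_ge1 F_local (HT k).2) (val_ge_fin (valV_fin vpi)).
    by rewrite subrr.
  have -> : map_poly i (\poly_(k < size g) ((g`_k - T k) / pi)) =
      \poly_(k < size g) i ((g`_k - T k) / pi).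
    apply/polyP => k; rewrite coef_map /= !coef_poly; case: ifP => // _.
    exact: rmorph0.
  rewrite horner_poly mulr_sumr -big_split /= horner_coef size_map_poly.
  apply: eq_bigr => k _; rewrite coef_map /= [i pi * _]mulrA -rmorphM.
  by rewrite [pi * _]mulrC divfK // rmorphB mulrBl addrC subrK.
have integral M : forall g : {poly F}, (forall k, 0 <= vF g`_k)%E ->
    (map_poly i g).[t] != 0 -> (vb (map_poly i g).[t] < M%:R%:E)%E ->
    exists n : int, vb (map_poly i g).[t] = (n%:~R)%:E.
  have t0 : (0 <= vb t)%E.
    have [->|/(root_unit _ tN)->//] := eqVneq t 0; by rewrite val0 leey.
  have ge0 (g : {poly F}) : (forall k, 0 <= vF g`_k)%E ->
      (0 <= vb (map_poly i g).[t])%E.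
    move=> g0; rewrite horner_coef; apply: val_ge_sum => k _.
    by apply: val_ge0M; [rewrite coef_map i_val|apply: val_ge0X].
  elim: M => [|M IH] g g0; first by move=> _; rewrite ltNge ge0.
  have [s [g' [sN g'0 E]]] := digit g g0.
  have vpit : (0 < vb (i pi * (map_poly i g').[t])%R)%E.
    by apply: val_gt0Ml; [rewrite i_val vpi lte_fin|apply: ge0].
  have [s0|s0] := eqVneq s 0; last first.
    by move=> _ _; exists 0; rewrite E valDl root_unit.
  rewrite E s0 add0r mulf_eq0 => /norP[_ nz].
  have [r vr] := val_fin vb nz; have := IH g' g'0 nz.
  rewrite val_M i_val vpi vr -EFinD !lte_fin -natr1 addrC ltrD2r => IH' /IH'[n [->]].
  by exists (n + 1); rewrite rmorphD.
move=> g gt.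
have [K gK] : exists K : nat, forall k, (0 <= vF (pi ^+ K *: g)`_k)%E.
  have [K HK] : exists K : nat, forall k, (k < size g)%N -> (0 <= vF (pi ^+ K * g`_k)%R)%E.
    elim: (size g) => [|m [K IH]]; first by exists 0%N.
    have [s vs] := val_lb vF g`_m.
    exists (K + Num.bound `|s|)%N => k; rewrite exprD -mulrA mulrCA ltnS leq_eqVlt.
    move=> /orP[/eqP->|km].
      rewrite mulrCA; apply: val_ge0M; first by apply: val_ge0X; rewrite vpi lee_fin.
      have := val_ge_mul (valX_ge (Num.bound `|s|) (val_ge_fin vpi)) vs.
      apply: le_trans; rewrite lee_fin -lerBlDr sub0r.
      apply: le_trans (ltW (archi_boundP (normr_ge0 s))).
      by rewrite -normrN ler_norm.
    apply: val_ge0M; last exact: IH.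
    by apply: val_ge0X; rewrite vpi lee_fin.
  exists K => k; rewrite coefZ; have [/HK//|kg] := ltnP k (size g).
  by rewrite nth_default // mulr0 val0 leey.
have E : (map_poly i (pi ^+ K *: g)).[t] = i (pi ^+ K) * (map_poly i g).[t].
  by rewrite map_polyZ hornerZ.
have nz : (map_poly i (pi ^+ K *: g)).[t] != 0.
  by rewrite E mulf_eq0 fmorph_eq0 expf_eq0 (negPf pi0) andbF.
have [r vr] := val_fin vb nz; have [r' vr'] := val_fin vb gt.
have [] := integral (Num.bound `|r|) _ gK nz.
  rewrite vr lte_fin; apply: le_lt_trans (ler_norm r) _.
  exact: archi_boundP.
move=> n; rewrite E val_M i_val (valX_fin K vpi) vr' -EFinD => -[] h.
by exists (n - K%:Z); rewrite rmorphB /= -h addrAC subrr add0r.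
Qed.

End Closure.

(** * Inertia preserves valuations and residues *)

Section Inertia.
Variables (R : realType) (F : fieldType) (vF : valuation R F).
Variables (p q : nat) (piF : F).
Hypothesis F_local : local_field vF p q piF.
Variables (Fbar : closedFieldType) (C : fieldType) (v : valuation R C).
Variables (i : {rmorphism F -> Fbar}) (j : {rmorphism Fbar -> C}).
Hypothesis C_completion : completed_closure vF v i j.
Variable sigma : inertia v i j.

Lemma completion_pchar : [pchar C].-nat q.
Proof.
have [[n n0 ->] _] := local_residue F_local; rewrite pnatX pnatE.
  by rewrite (fmorph_pchar j) (fmorph_pchar i) (lf_char F_local).
exact: pcharf_prime (lf_char F_local).
Qed.

Lemma val_uniformizer : v (j (i piF)) = 1%E.
Proof. by rewrite (cc_extends C_completion) (lf_uniformizer F_local). Qed.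

Lemma inertia_base a : sigma (j (i a)) = j (i a).
Proof.
apply: inertia_fix => g; rewrite horner_map /= fmorph_eq0 => ga.
by rewrite (cc_extends C_completion); exact: (lf_discrete F_local ga).
Qed.

(** Positive valuation means that the powers tend to 0, which a continuous
    automorphism respects. *)
Lemma inertia_gt0 x : (0 < v x -> 0 < v (sigma x))%E.
Proof.
have [->|/(val_fin v)[r vx]] := eqVneq x 0; first by rewrite rmorph0.
rewrite vx lte_fin => r0; have [N hN] := inertia_continuous sigma 0 1.
have [n hn] : exists n : nat, N <= r *+ n.
  exists (Num.bound (`|N| / r)); rewrite -mulr_natl -ler_pdivrMr //.
  apply: ltW; apply: le_lt_trans (archi_boundP _); last first.
    by rewrite divr_ge0 // ltW.
  by rewrite ler_pM2r ?invr_gt0 // ler_norm.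
have := hN (x ^+ n); rewrite subr0 rmorph0 subr0 (valX_fin n vx) lee_fin hn.
move=> /(_ isT) h; apply: (@val_Xgt0 _ _ _ _ n); rewrite -rmorphXn.
by apply: lt_le_trans h; rewrite lte_fin.
Qed.

(** The sign of the valuation is preserved; applied to [x ^+ n / pi ^ m] this
    compares [v x] and [v (sigma x)] with every rational number. *)
Lemma inertia_val x : v (sigma x) = v x.
Proof.
have [->|x0] := eqVneq x 0; first by rewrite rmorph0.
have [r vx] := val_fin v x0.
have [s vsx] : exists s : R, v (sigma x) = s%:E.
  by apply: val_fin; rewrite fmorph_eq0.
pose pi := j (i piF); have vpi : v pi = 1%E := val_uniformizer.
have pi0 : pi != 0 by exact: val_fin_neq0 vpi.
have vz (m : int) : v (pi ^ m) = (m%:~R)%:E.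
  by case: m => m; rewrite /= ?(valV_fin (valX_fin _ vpi)) ?(valX_fin _ vpi).
have lt0 y : (v y < 0)%E -> (v (sigma y) < 0)%E.
  move=> y0; have y_neq0 : y != 0 by apply: contraTneq y0 => ->; rewrite val0.
  have [a va] := val_fin v y_neq0.
  have [b vb] : exists b : R, v (sigma y) = b%:E.
    by apply: val_fin; rewrite fmorph_eq0.
  have := @inertia_gt0 y^-1; rewrite fmorphV (valV_fin va) (valV_fin vb).
  by rewrite !lte_fin !oppr_gt0 vb lte_fin; apply; rewrite -lte_fin -va.
have vy n (m : int) : v (x ^+ n / pi ^ m) = (r *+ n - m%:~R)%:E.
  exact: valM_fin (valX_fin _ vx) (valV_fin (vz m)).
have vsy n (m : int) : v (sigma (x ^+ n / pi ^ m)) = (s *+ n - m%:~R)%:E.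
  rewrite rmorphM fmorphV rmorphXn.
  rewrite (_ : sigma (pi ^ m) = pi ^ m); last first.
    by rewrite (fmorphXz sigma) /pi inertia_base.
  exact: valM_fin (valX_fin _ vsx) (valV_fin (vz m)).
have between (a b : R) : a < b -> exists n (m : int), a *+ n < m%:~R < b *+ n.
  move=> ab; pose n := Num.bound (`|1| / (b - a)).
  exists n, (Num.floor (a *+ n) + 1).
  rewrite floorD1_gt /=; apply: (@le_lt_trans _ _ (a *+ n + 1)).
    by rewrite rmorphD lerD2r ge_floor.
  rewrite -ltrBrDl -mulrnBl -mulr_natl -ltr_pdivrMr ?subr_gt0 //.
  rewrite -[X in X / _]normr1; apply: archi_boundP.
  by rewrite divr_ge0 // subr_ge0 ltW.
rewrite vx vsx; congr EFin; apply/eqP; rewrite eq_le !leNgt.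
apply/andP; split; apply/negP => /between[n [m /andP[h1 h2]]].
  have := lt0 (x ^+ n / pi ^ m); rewrite vy vsy !lte_fin !subr_lt0 => /(_ h1).
  by rewrite ltNge (ltW h2).
have := @inertia_gt0 (x ^+ n / pi ^ m); rewrite vy vsy !lte_fin !subr_gt0.
by move=> /(_ h2); rewrite ltNge (ltW h1).
Qed.

(** Every nonzero residue class contains a root of unity of [Fbar] that generates
    an unramified extension, hence is fixed by [sigma]. *)
Lemma inertia_residue x : (0 <= v x -> 0 < v (sigma x - x)%R)%E.
Proof.
move=> x0; have [a xa1] := cc_dense C_completion x 1.
have xa : (0 < v (x - j a)%R)%E by apply: lt_le_trans xa1; rewrite lte_fin.
pose vb := val_comp v j.
have a0 : (0 <= vb a)%E.
  by rewrite val_compE -[j a](subKr x); apply: val_ge_sub => //; exact: ltW.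
have i_val b : vb (i b) = vF b by rewrite val_compE (cc_extends C_completion).
have [n n0 an] := residual_frob F_local (cc_algebraic C_completion) i_val a0.
have q1 := local_q_gt1 F_local.
have N1 : (1 < q ^ n)%N by rewrite -(expn0 q) ltn_exp2l.
have [t tN at0] := residual_root N1 an.
have t_fix : sigma (j t) = j t.
  apply: inertia_fix; apply: (root_unramified F_local i_val N1) tN.
  by exists n.
have xt : (0 < v (x - j t)%R)%E.
  rewrite -(subrKA (j a)); apply: val_gt_add => //; rewrite -rmorphB; exact: at0.
rewrite -(subrKA (j t)); apply: val_gt_add; last by rewrite valB.
by rewrite -{1}t_fix -rmorphB inertia_val.
Qed.

End Inertia.

(** * The system of the rescaled coordinates *)

(** Exponents of [alpha] in the system satisfied by the rescaled coordinates:
    [exp_uy] is the excess of the valuation of [u Y_2 ^ q] over that of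
    [Y_2 ^ (q ^ 2)], and similarly for the other terms of [X_1], [Y_1] and the
    equation of [u]; [exp_g] and [exp_d] compare monomials of [mu_2] with
    [X_2 ^ q Y_1]. In units of the valuation of [alpha], the numbers [q ^ 3 * (q - 1)],
    [2 * q ^ 3 * (q - 1)], [q ^ 3], [q], [q ^ 2], [1] and [2 * q ^ 2] are the
    valuations of [u], [pi], [X_1], [X_2], [Y_1], [Y_2] and [pi_2]. *)
Definition exp_uy q := (q ^ 3 * (q - 1) + q - q ^ 2)%N.
Definition exp_py q := (2 * q ^ 3 * (q - 1) + 1 - q ^ 2)%N.
Definition exp_ux q := (q ^ 3 * (q - 1) + q ^ 2 - q ^ 3)%N.
Definition exp_px q := (2 * q ^ 3 * (q - 1) + q - q ^ 3)%N.
Definition exp_pu q := (2 * q ^ 3 * (q - 1) + q ^ 2 - q ^ 4)%N.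
Definition exp_g q := (q * (q - 1) ^ 2)%N.
Definition exp_d q := (q ^ 4 + 1 - 2 * q ^ 2)%N.

Section Exponents.
Variable q : nat.
Hypothesis q_gt1 : (1 < q)%N.

Let m := (q - 1)%N.

Let qE : q = m.+1.
Proof. by rewrite /m subn1 prednK // ltnW. Qed.

Let subn_eq a b c : (a = b + c)%N -> (a - b = c)%N.
Proof. by move=> ->; rewrite addKn. Qed.

Let exp_uy_m : exp_uy q = (m.+1 * m ^ 2 * m.+2)%N.
Proof. by rewrite /exp_uy -/m; apply: subn_eq; rewrite qE; ring. Qed.

Let exp_py_m : exp_py q = (2 * m ^ 4 + 6 * m ^ 3 + 5 * m ^ 2)%N.
Proof. by rewrite /exp_py -/m; apply: subn_eq; rewrite qE; ring. Qed.

Let exp_ux_m : exp_ux q = (m.+1 ^ 2 * m ^ 2)%N.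
Proof. by rewrite /exp_ux -/m; apply: subn_eq; rewrite qE; ring. Qed.

Let exp_px_m : exp_px q = (2 * m ^ 4 + 5 * m ^ 3 + 3 * m ^ 2)%N.
Proof. by rewrite /exp_px -/m; apply: subn_eq; rewrite qE; ring. Qed.

Let exp_pu_m : exp_pu q = (m.+1 ^ 2 * m ^ 2)%N.
Proof. by rewrite /exp_pu -/m; apply: subn_eq; rewrite qE; ring. Qed.

Let exp_g_m : exp_g q = (m.+1 * m ^ 2)%N.
Proof. by rewrite /exp_g -/m qE. Qed.

Let exp_d_m : exp_d q = (m ^ 2 * m.+2 ^ 2)%N.
Proof. by rewrite /exp_d; apply: subn_eq; rewrite qE; ring. Qed.

Let exp_m := (exp_uy_m, exp_py_m, exp_ux_m, exp_px_m, exp_pu_m, exp_g_m, exp_d_m).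

Lemma exp_eqs :
  [/\ (q ^ 2 + exp_uy q = q ^ 3 * (q - 1) + q)%N,
      (q ^ 2 + exp_py q = 2 * q ^ 3 * (q - 1) + 1)%N,
      (q ^ 3 + exp_ux q = q ^ 3 * (q - 1) + q ^ 2)%N,
      (q ^ 3 + exp_px q = 2 * q ^ 3 * (q - 1) + q)%N &
   [/\ (q ^ 4 + exp_pu q = 2 * q ^ 3 * (q - 1) + q ^ 2)%N,
      (2 * q ^ 2 + exp_g q = q ^ 3 + q)%N &
      (2 * q ^ 2 + exp_d q = q ^ 4 + 1)%N]].
Proof. by rewrite !exp_m -/m qE; do ![split]; ring. Qed.

Let m_gt0 : (0 < m)%N. Proof. by rewrite subn_gt0. Qed.

Lemma exp_gt0 :
  [/\ (0 < exp_uy q)%N, (0 < exp_py q)%N, (0 < exp_ux q)%N, (0 < exp_px q)%N &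
   [/\ (0 < exp_pu q)%N, (0 < exp_g q)%N & (0 < exp_d q)%N]].
Proof.
by rewrite !exp_m; case: m m_gt0 => // n _; do ![split]; nia.
Qed.

(** The valuation of [gamma * gamma_1] is [exp_g q + (q - 1) ^ 2]: terms beyond
    it do not contribute to the relation between [y] and [Z_1]. *)
Lemma exp_bounds :
  [/\ (exp_g q + (q - 1) ^ 2 + 1 <= exp_uy q)%N,
      (exp_g q + (q - 1) ^ 2 + 1 <= exp_py q)%N,
      ((q - 1) ^ 2 + 1 <= exp_ux q)%N, ((q - 1) ^ 2 + 1 <= exp_px q)%N &
      (exp_g q + (q - 1) ^ 2 + 1 <= exp_d q)%N].
Proof.
by rewrite !exp_m -/m; case: m m_gt0 => // n _; split; nia.
Qed.

End Exponents.

(** The system of equations satisfied by the units [u], [X_1], [X_2], [Y_1],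
    [Y_2] rescaled by powers of [a = alpha], and [rho = pi / a ^ v(pi)]. *)
Record normal_system (K : fieldType) (q : nat) (a rho u x1 x y1 y : K) : Prop :=
  NormalSystem {
  ns_y1 : y1 = y ^+ (q ^ 2) + a ^+ exp_uy q * u * y ^+ q + rho * a ^+ exp_py q * y;
  ns_x1 : x1 = x ^+ (q ^ 2) + a ^+ exp_ux q * u * x ^+ q + rho * a ^+ exp_px q * x;
  ns_u : y1 ^+ (q ^ 2) + u * y1 ^+ q + rho * a ^+ exp_pu q * y1 = 0;
  ns_mu : a ^+ exp_g q * (x1 * y ^+ q + x * y1 ^+ q) - a ^+ exp_d q * x1 ^+ q * y
    - x ^+ q * y1 = 1
}.

Section Relation.
Variables (R : realType) (K : fieldType) (v : valuation R K).
Variables (q : nat).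
Hypothesis q_gt1 : (1 < q)%N.
Hypothesis q_pchar : [pchar K].-nat q.
Variables (a : K) (e : R).
Hypotheses (va : v a = e%:E) (e_gt0 : 0 < e).
Variables (g1 g2 : K).
Hypothesis g1E : g1 ^+ q = a ^+ exp_g q.
Hypothesis g2E : g2 ^+ q = g1.

Let q_gt0 : (0 < q)%N. Proof. exact: ltnW. Qed.
Let a0 : a != 0. Proof. exact: val_fin_neq0 va. Qed.

Lemma val_g1 : v g1 = (e *+ (q - 1) ^ 2)%:E.
Proof.
by apply: (@val_Xfin _ _ _ q) => //; rewrite g1E (valX_fin _ va) /exp_g mulnC mulrnA.
Qed.

Lemma val_g2 : v g2 = (e *+ (q - 1) ^ 2 / q%:R)%:E.
Proof.
apply: (@val_Xfin _ _ _ q) => //; rewrite g2E val_g1 -[(_ / _) *+ q]mulr_natr divfK //.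
by rewrite pnatr_eq0 -lt0n.
Qed.

Lemma expa_ge n k : (k <= n)%N -> ((e *+ k)%:E <= v (a ^+ n)%R)%E.
Proof. by move=> kn; rewrite (valX_fin _ va) lee_fin ler_pMn2l. Qed.

Variables (rho u x1 x y1 y : K).
Hypothesis ns : normal_system q a rho u x1 x y1 y.
Hypotheses (vrho : v rho = 0%E) (vu : v u = 0%E) (vx1 : v x1 = 0%E).
Hypotheses (vx : v x = 0%E) (vy1 : v y1 = 0%E) (vy : v y = 0%E).

Let D := (q ^ 2 - 1)%N.
Let w := y^-1.
Let Z := (1 + x * y ^+ q) / g1.
Let Z1 := (Z + (y ^+ D)^-1 + y ^+ D) / (g2 * y ^+ D).

(** The relation is found at the second order. Modulo errors beyond
    [gamma * gamma_1], the equation [mu_2 = pi_2] reads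
    [(1 + x y^q)^q = gamma (x^(q^2) y^q + x y^(q^3))]. Dividing by [gamma] gives
    [Z^q]; replacing [x] by [(gamma_1 Z - 1) / y^q] turns this into
    [(Z + y^-D + y^D)^q = gamma_1 y^(q D) Z] up to higher terms, and the left-hand
    side is [gamma_1 y^(q D) Z_1^q] by definition of [Z_1]. So [Z_1^q] is
    congruent to [Z], and [Z] to [- (y^-D + y^D)]. *)
Lemma normal_relation : (0 <= v Z1)%E /\
  ((e / q%:R)%:E <= v (Z1 ^+ q + w ^+ D + y ^+ D)%R)%E.
Proof.
have y0 := val_unit_neq0 vy.
have g10 : g1 != 0 := val_fin_neq0 val_g1.
have g20 : g2 != 0 := val_fin_neq0 val_g2.
have vw : v w = 0%E := val_unitV vy.
have [b_uy b_py b_ux b_px b_d] := exp_bounds q_gt1.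
set M := ((q - 1) ^ 2)%N in b_uy b_py b_ux b_px b_d.
have qq : [pchar K].-nat (q ^ 2)%N by rewrite pnatX q_pchar.
have Dq : (D * q + q = q ^ 3)%N.
  by rewrite /D -mulSnr subn1 prednK ?expn_gt0 ?q_gt0 // -expnSr.
(* [eta] is divided by [gamma], so that the same bound applies to both errors *)
pose eta := a ^+ (exp_uy q - exp_g q) * u * y ^+ q +
  rho * a ^+ (exp_py q - exp_g q) * y.
pose xi := a ^+ exp_ux q * u * x ^+ q + rho * a ^+ exp_px q * x.
have split_g n : (exp_g q + M + 1 <= n)%N -> a ^+ n = a ^+ exp_g q * a ^+ (n - exp_g q).
  by move=> h; rewrite -exprD subnKC // (leq_trans _ h) // -addnA leq_addr.
have sub_ge n : (exp_g q + M + 1 <= n)%N -> (M + 1 <= n - exp_g q)%N.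
  by move=> h; rewrite -(leq_add2l (exp_g q)) addnA subnKC // (leq_trans _ h) //
    -addnA leq_addr.
have y1E : y1 = y ^+ (q ^ 2) + a ^+ exp_g q * eta.
  by rewrite (ns_y1 ns) /eta (split_g _ b_uy) (split_g _ b_py); ring.
have x1E : x1 = x ^+ (q ^ 2) + xi by rewrite (ns_x1 ns) /xi addrA.
have veta : ((e *+ (M + 1))%:E <= v eta)%E.
  apply: val_ge_add.
    rewrite -mulrA; apply: val_ge_mul0; first exact/expa_ge/sub_ge.
    by rewrite val_unit_ge0 // val_unitM ?val_unitX.
  rewrite mulrAC mulrC; apply: val_ge_mul0; first exact/expa_ge/sub_ge.
  by rewrite val_unit_ge0 // val_unitM ?val_unitX.
have vxi : ((e *+ (M + 1))%:E <= v xi)%E.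
  apply: val_ge_add.
    rewrite -mulrA; apply: val_ge_mul0; first exact: expa_ge.
    by rewrite val_unit_ge0 // val_unitM ?val_unitX.
  rewrite mulrAC mulrC; apply: val_ge_mul0; first exact: expa_ge.
  by rewrite val_unit_ge0 // val_unitM ?val_unitX.
have eM0 : 0 <= e *+ (M + 1) by rewrite mulrn_wge0 // ltW.
pose R1 := xi * y ^+ q + x * (a ^+ exp_g q * eta) ^+ q -
  a ^+ (exp_d q - exp_g q) * x1 ^+ q * y - x ^+ q * eta.
have vR1 : ((e *+ (M + 1))%:E <= v R1)%E.
  do 2?apply: val_ge_sub; first apply: val_ge_add.
  - by apply: val_ge_mul0 => //; rewrite val_unit_ge0 // val_unitX.
  - apply: val_ge_mul0r; first by rewrite val_unit_ge0.
    have : ((e *+ (M + 1))%:E <= v (a ^+ exp_g q * eta)%R)%E.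
      apply: val_ge_mul0r => //; apply: val_ge0X; rewrite va lee_fin; exact: ltW.
    move=> h; apply: val_ge_trans (valX_ge q h).
    by rewrite -[X in _ <= X]mulr_natl ler_peMl // ler1n.
  - rewrite -mulrA; apply: val_ge_mul0; first exact/expa_ge/sub_ge.
    by rewrite val_unit_ge0 // val_unitM ?val_unitX.
  - by apply: val_ge_mul0r => //; rewrite val_unit_ge0 // val_unitX.
have Zq : Z ^+ q = x ^+ (q ^ 2) * y ^+ q + x * y ^+ (q ^ 3) + R1.
  apply: (mulIf (expf_neq0 q g10)); rewrite -exprMn /Z divfK // frobD // expr1n g1E.
  rewrite exprMn -exprM mulnn.
  have y1q : y1 ^+ q = y ^+ (q ^ 3) + (a ^+ exp_g q * eta) ^+ q.
    by rewrite {1}y1E frobD // -exprM -expnSr.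
  have := ns_mu ns; rewrite y1q (split_g _ b_d) [in x ^+ q * y1]y1E /R1 {1}x1E.
  move=> <-; ring.

move: R1 vR1 Zq => R1 vR1 Zq.
have vZ : (0 <= v Z)%E.
  apply: (@val_Xge _ _ _ q) => //; rewrite mul0rn Zq.
  apply: val_ge_add; last exact: (val_ge_trans eM0 vR1).
  by apply: val_ge_add; rewrite val_unit_ge0 // val_unitM ?val_unitX.
have wy n : w ^+ n * y ^+ n = 1 by rewrite -exprMn mulVf ?expr1n.
have xE : x = (g1 * Z - 1) * w ^+ q.
  by rewrite /Z [g1 * _]mulrC divfK // addrC addKr -mulrA [_ * w ^+ q]mulrC wy mulr1.
have xqE : x ^+ (q ^ 2) = (g1 ^+ (q ^ 2) * Z ^+ (q ^ 2) - 1) * w ^+ (q ^ 3).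
  by rewrite {1}xE exprMn frobB // expr1n exprMn -exprM -expnS.
have Z1E : g2 * y ^+ D * Z1 = Z + w ^+ D + y ^+ D.
  rewrite /Z1 [LHS]mulrC divfK ?mulf_neq0 ?expf_neq0 //.
  by rewrite /w exprVn.
(* the remainder of Z_1^q = Z, from the equation of Zq divided by g1 y^(q D) *)
pose R2 := (g1 ^+ (q ^ 2) * Z ^+ (q ^ 2) * w ^+ (D * q) + R1) * w ^+ (D * q) / g1.
have Z1q : Z1 ^+ q = Z + R2.
  have gy0 : g1 * y ^+ (D * q) != 0 by rewrite mulf_neq0 ?expf_neq0.
  apply: (mulfI gy0); have -> : g1 * y ^+ (D * q) * Z1 ^+ q = (g2 * y ^+ D * Z1) ^+ q.
    by rewrite !exprMn g2E -exprM.
  rewrite Z1E !frobD // -!exprM Zq xqE {1}xE -Dq !exprD /R2.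
  set W := w ^+ (D * q); set Y := y ^+ (D * q).
  have WY : W * Y = 1 by exact: wy.
  have wyq := wy q.
  transitivity ((g1 ^+ (q ^ 2) * Z ^+ (q ^ 2) - 1) * W * (w ^+ q * y ^+ q) +
     (g1 * Z - 1) * Y * (w ^+ q * y ^+ q) + R1 + W + Y); first by ring.
  rewrite wyq.
  transitivity (g1 * Y * Z + (W * Y) * (g1 ^+ (q ^ 2) * Z ^+ (q ^ 2) * W + R1)).
    by rewrite WY; ring.
  by field.
have vR2 : (e%:E <= v R2)%E.
  rewrite /R2 mulrAC; apply: val_ge_mul0; last by rewrite val_unit_ge0 // val_unitX.
  have -> : e = e *+ (M + 1) + - (e *+ M) by rewrite addn1 mulrS addrK.
  apply: val_ge_mul; last by rewrite (valV_fin val_g1).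
  apply: val_ge_add => //; apply: val_ge_mul0; last by rewrite val_unit_ge0 // val_unitX.
  apply: val_ge_mul0; last exact: val_ge0X.
  rewrite (valX_fin _ val_g1) -/M lee_fin -mulrnA ler_pMn2l //.
  have : (0 < M)%N by rewrite expn_gt0 subn_gt0 q_gt1.
  move=> M0; apply: (@leq_trans (M * 2)); first by rewrite muln2 -addnn leq_add2l.
  by rewrite leq_mul2l (leq_trans q_gt1) ?orbT // -[X in (X <= _)%N]expn1 leq_exp2l.
have eq_le : e / q%:R <= e by rewrite ler_pdivrMr ?ltr0n // ler_peMr ?ler1n // ltW.
have eq0 : 0 <= e / q%:R by rewrite divr_ge0 // ltW.
have vZ1 : (0 <= v Z1)%E.
  apply: (@val_Xge _ _ _ q) => //; rewrite mul0rn Z1q; apply: val_ge_add => //.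
  exact: (val_ge_trans (ltW e_gt0) vR2).
split=> //; rewrite Z1q.
rewrite (_ : _ + _ = g2 * y ^+ D * Z1 + R2); last by rewrite Z1E; ring.
apply: val_ge_add; last exact: (val_ge_trans eq_le vR2).
apply: val_ge_mul0 => //; apply: val_ge_mul0; last by rewrite val_unit_ge0 // val_unitX.
rewrite val_g2 lee_fin ler_pM2r ?invr_gt0 ?ltr0n //.
by rewrite -mulr_natl ler_peMl ?ler1n ?expn_gt0 ?subn_gt0 ?q_gt1 // ltW.
Qed.

End Relation.

(** * Independence on the reduced curve *)

Section CurveIndependence.
Variables (k : fieldType) (q : nat).
Hypothesis q_gt1 : (1 < q)%N.
Hypothesis q_pchar : [pchar k].-nat q.

Let D := (q ^ 2 - 1)%N.

Let q_gt0 : (0 < q)%N. Proof. exact: ltnW. Qed.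

(** The orders at 0 of the summands of the [q]-th power of an equation
    [\sum_(i < q) p_i z^i] are distinct, as they are modulo [q]. *)
Lemma curve_orders_inj (n1 n2 i1 i2 : nat) : (i1 < q)%N -> (i2 < q)%N ->
  (q * n1 + D * (q.-1 - i1) = q * n2 + D * (q.-1 - i2))%N -> i1 = i2.
Proof.
move=> i1q i2q E.
have D1 : D.+1 = (q * q)%N by rewrite /D subn1 prednK ?expn_gt0 ?q_gt0 // -mulnn.
have F n i : (q * n + D * (q.-1 - i) + (q.-1 - i) = q * (n + q * (q.-1 - i)))%N.
  by rewrite -addnA -mulSnr D1 mulnDr mulnA.
have i1q' : (q.-1 - i1 < q)%N by rewrite (leq_ltn_trans (leq_subr _ _)) // prednK.
have i2q' : (q.-1 - i2 < q)%N by rewrite (leq_ltn_trans (leq_subr _ _)) // prednK.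
have : (q.-1 - i1 = q.-1 - i2 %[mod q])%N.
  apply/eqP; rewrite -(eqn_modDl (q * n1 + D * (q.-1 - i1))) F.
  by rewrite E F !modnMr.
rewrite !modn_small // => H.
have : (i1 <= q.-1)%N by rewrite -ltnS prednK.
have : (i2 <= q.-1)%N by rewrite -ltnS prednK.
lia.
Qed.

Lemma polyX_order (r : {poly k}) : r != 0 ->
  exists n (s : {poly k}), s`_0 != 0 /\ r = 'X^n * s.
Proof.
move=> r0; have [n [s]] := multiplicity_XsubC r 0.
rewrite r0 /= subr0 => s0 ->; exists n, s; rewrite mulrC; split=> //.
by rewrite -horner_coef0.
Qed.

(** On the curve [z^q = - (y^-D + y^D)], the functions [1, z, .., z^(q-1)] are
    independent over the rational functions of [y]. There is a single [z] above
    each [y], so the [q]-th power of an equation [p(y, z) = 0] becomes a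
    polynomial identity in [y] alone, in which no two summands can cancel their
    terms of lowest order. *)
Lemma curve_independence (p : {poly {poly k}}) :
  (forall g : {poly k}, g != 0 -> exists2 y, y != 0 & g.[y] != 0) ->
  (size p <= q)%N ->
  (forall y, y != 0 -> exists2 z, z ^+ q = - ((y ^+ D)^-1 + y ^+ D) &
    p.[z%:P].[y] = 0) ->
  p = 0.
Proof.
move=> k_inf sp pcurve.
(* [y ^+ (D * q.-1)] clears the denominators of the q-th power *)
pose T (i : 'I_q) : {poly k} := p`_i ^+ q * 'X^(D * (q.-1 - i)) *
  (- (1 + 'X^(2 * D))) ^+ i.
have H0 : \sum_i T i = 0.
  apply/eqP; apply/negPn/negP => /k_inf[y y0 /negP]; apply; apply/eqP.
  have [z zq pz] := pcurve y y0; rewrite horner_sum.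
  have yD0 : y ^+ D != 0 by rewrite expf_neq0.
  have E i : (T i).[y] = (y ^+ D) ^+ q.-1 * ((p`_i).[y] * z ^+ i) ^+ q.
    have iq : (i <= q.-1)%N by rewrite -ltnS prednK.
    rewrite /T !hornerE exprMn [z ^+ i ^+ q]exprAC zq.
    rewrite -{2}(subnK iq) exprD -exprM.
    rewrite (_ : - (1 + y ^+ (2 * D)) = y ^+ D * - ((y ^+ D)^-1 + y ^+ D)).
      by rewrite exprMn; ring.
    by rewrite mulrN mulrDr divff // -expr2 -exprM mulnC.
  under eq_bigr do rewrite E.
  rewrite -mulr_sumr -(frob_sum q_pchar).
  suff -> : \sum_(i < q) (p`_i).[y] * z ^+ i = 0 by rewrite expr0n eqn0Ngt q_gt0 mulr0.
  rewrite -[RHS]pz (horner_coef_wide _ sp) horner_sum.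
  by apply: eq_bigr => i _; rewrite !hornerE.
apply/eqP; apply/negPn/negP => p0.
have lp0 : p`_(size p).-1 != 0 by rewrite -lead_coefE lead_coef_eq0.
have szp : ((size p).-1 < q)%N.
  by apply: leq_trans sp; rewrite prednK // size_poly_gt0.
have /boolp.choice[n0 /boolp.choice[s0 Hs]] : forall i : 'I_q, exists n (s : {poly k}),
    p`_i != 0 -> s`_0 != 0 /\ p`_i = 'X^n * s.
  move=> i; have [->|/polyX_order[n [s Hs]]] := eqVneq p`_i 0.
    by exists 0%N, 0.
  by exists n, s.
pose o (i : 'I_q) := (q * n0 i + D * (q.-1 - i))%N.
case: (arg_minnP (P := fun i : 'I_q => p`_i != 0) (i0 := Ordinal szp) o lp0).
move=> i pi0 imin.
have TE (l : 'I_q) : p`_l != 0 -> T l = 'X^(o l) * (s0 l ^+ q * (- (1 + 'X^(2 * D))) ^+ l).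
  by move=> pl; rewrite /T {1}(Hs l pl).2 exprMn -exprM mulnC /o exprD; ring.
have : (\sum_l T l)`_(o i) = 0 by rewrite H0 coef0.
rewrite (bigD1 i) //= coefD coef_sum big1 => [|l li].
  rewrite addr0 TE // coefXnM ltnn subnn => /eqP.
  rewrite -horner_coef0 !hornerE /= horner_coef0.
  rewrite mulf_eq0 !expf_eq0 (negPf (Hs i pi0).1) andbF /=.
  have -> : (0 : k) ^+ (2 * D) = 0.
    rewrite expr0n; case: eqP => // /eqP; rewrite muln_eq0 /= /D subn_eq0.
    by rewrite leqNgt -[X in (X < _)%N](expn0 q) ltn_exp2l.
  by rewrite addr0 oppr_eq0 oner_eq0 andbF.
have [pl|pl] := eqVneq p`_l 0.
  by rewrite /T pl expr0n eqn0Ngt q_gt0 !mul0r coef0.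
rewrite TE // coefXnM; case: ltnP => // oli; case/eqP: li; apply/val_inj.
apply: (@curve_orders_inj (n0 l) (n0 i)); rewrite ?ltn_ord //.
by apply/eqP; rewrite eqn_leq -/(o l) -/(o i) oli imin.
Qed.

End CurveIndependence.

(** * Torsion points and valuations *)

Section Torsion.
Variables (K : fieldType) (q : nat).
Hypothesis q_pchar : [pchar K].-nat q.
Variables (pi pi2 : K).
Hypothesis pi2_gen : LT2_generator q pi pi2.

(** The pairing [mu2] is a Moore determinant: it intertwines [pi_mul] and
    [pi_LT]. When only [Y_2] is known to be a torsion point, applying [pi_LT]
    twice to [mu2 P = pi2] still yields a binomial equation for the defect
    [X0] of [X_2]. *)
Lemma mu2_defect (P : point K) (X0 := pi_mul q pi (pt_u P) (pt_X1 q pi P)) :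
  pi_mul q pi (pt_u P) (pt_Y1 q pi P) = 0 -> mu2 q pi P = pi2 ->
  X0 ^+ q * pt_Y2 P ^+ (q ^ 2) =
    X0 * (pi * pt_Y2 P ^+ q + pt_Y1 q pi P ^+ q).
Proof.
have [LT2 _] := pi2_gen; case: P @X0 => u X2 Y2; rewrite /mu2 /=.
set X1 := pt_X1 _ _ _; set Y1 := pt_Y1 _ _ _; set X0 := pi_mul q pi u X1.
move=> Y10 muE.
have X2qq : (X2 ^+ q) ^+ q = X1 - u * X2 ^+ q - pi * X2.
  by rewrite -exprM mulnn /X1 /pt_X1 /pi_mul /=; ring.
have Y2qq : (Y2 ^+ q) ^+ q = Y1 - u * Y2 ^+ q - pi * Y2.
  by rewrite -exprM mulnn /Y1 /pt_Y1 /pi_mul /=; ring.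
have X1qq : (X1 ^+ q) ^+ q = X0 - u * X1 ^+ q - pi * X1.
  by rewrite -exprM mulnn /X0 /pi_mul /=; ring.
have Y1qq : (Y1 ^+ q) ^+ q = - u * Y1 ^+ q - pi * Y1.
  by rewrite -exprM mulnn -[RHS]add0r -Y10 /pi_mul; ring.
clearbody X0; clear Y10; clearbody X1 Y1.
pose d := X1 * Y1 ^+ q - X1 ^+ q * Y1.
have pi1E : pi_LT q pi pi2 = d + X0 * Y2 ^+ q.
  rewrite /pi_LT -muE !(frobD q_pchar, frobN q_pchar) !exprMn.
  by rewrite X2qq Y2qq X1qq Y1qq /d; ring.
have dq : d ^+ q = pi * d - X0 * Y1 ^+ q.
  by rewrite /d frobB // !exprMn X1qq Y1qq; ring.
move: LT2; rewrite pi1E /pi_LT frobD // exprMn dq -[(Y2 ^+ q) ^+ q]exprM mulnn => E.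
by apply/eqP; rewrite -subr_eq0; apply/eqP; rewrite -oppr0 -E; ring.
Qed.

End Torsion.

Section LubinTateValuations.
Variables (R : realType) (K : fieldType) (v : valuation R K) (q : nat).
Hypothesis q_gt1 : (1 < q)%N.
Variables (pi pi2 alpha : K).
Hypothesis vpi : v pi = 1%E.
Hypothesis pi2_gen : LT2_generator q pi pi2.
Hypothesis alphaE : alpha ^+ (2 * q ^ 2) = pi2.

Let q_gt0 : (0 < q)%N. Proof. exact: ltnW. Qed.

(** [pi_LT pi2] is a [(q-1)]-st root of [pi]; as it is [pi * pi2 - pi2 ^+ q], the
    term [pi2 ^+ q] must dominate. *)
Lemma val_pi2 : v pi2 = ((q * (q - 1))%N%:R^-1)%:E.
Proof.
have [LT2 pi1_neq0] := pi2_gen; set pi1 := pi_LT q pi pi2 in LT2 pi1_neq0.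
have m0 : (0 < q - 1)%N by rewrite subn_gt0.
have mR : (0 : R) < (q - 1)%:R by rewrite ltr0n.
have vpi1 : v pi1 = (((q - 1)%:R)^-1)%:E.
  apply: (@val_Xfin _ _ _ (q - 1)) => //.
  have -> : pi1 ^+ (q - 1) = pi.
    apply: (mulIf pi1_neq0); rewrite -exprSr subn1 prednK //.
    by apply/esym/eqP; rewrite -subr_eq0; apply/eqP.
  by rewrite vpi -[_^-1 *+ _]mulr_natr mulVf // gt_eqF.
have pi2_neq0 : pi2 != 0.
  apply: contraNneq pi1_neq0 => p0; rewrite /pi1 p0 /pi_LT mulr0 expr0n.
  by rewrite eqn0Ngt q_gt0 subr0.
have [r vr] := val_fin v pi2_neq0.
have qE : q%:R = (q - 1)%:R + 1 :> R by rewrite natr1 subn1 prednK.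
have vpp := valM_fin vpi vr; have vpq := valX_fin q vr.
rewrite -[r *+ q]mulr_natl qE in vpq.
have [mr|mr] := ltP (r * (q - 1)%:R) 1.
  have : v pi1 = v (- pi2 ^+ q).
    by rewrite /pi1 /pi_LT addrC valDl // valN vpp vpq lte_fin; lra.
  rewrite valN vpi1 vpq => -[E]; rewrite vr natrM invfM E qE; congr EFin.
  by rewrite mulKf // gt_eqF //; lra.
have : ((1 + r)%:E <= v pi1)%E.
  by apply: val_ge_sub; rewrite ?vpp ?vpq // lee_fin; lra.
rewrite vpi1 lee_fin.
have : (q - 1)%:R^-1 <= r by rewrite -[X in X <= _]mul1r ler_pdivrMr.
move=> h1 h2; have := le_trans h2 h1; rewrite gerDr ler10 //.
Qed.

Definition val_alpha_num : R := ((2 * q ^ 3 * (q - 1))%N%:R)^-1.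
Local Notation e := val_alpha_num.

Lemma val_alpha_gt0 : 0 < e.
Proof. by rewrite invr_gt0 ltr0n !muln_gt0 ?expn_gt0 ?q_gt0 subn_gt0 q_gt1. Qed.

Lemma val_alphaMn a b : (a * b = 2 * q ^ 3 * (q - 1))%N -> b%:R^-1 = e *+ a.
Proof.
move=> ab; have : (0 < a * b)%N.
  by rewrite ab !muln_gt0 ?expn_gt0 ?q_gt0 subn_gt0 q_gt1.
rewrite muln_gt0 => /andP[a0 b0]; rewrite /val_alpha_num -ab natrM invfM -[_ *+ a]mulr_natr mulrAC.
by rewrite mulVf ?mul1r // pnatr_eq0 -lt0n.
Qed.

Lemma val_alpha : v alpha = e%:E.
Proof.
apply: (@val_Xfin _ _ _ (2 * q ^ 2)); first by rewrite !muln_gt0 ?expn_gt0 ?q_gt0.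
by rewrite alphaE val_pi2 (@val_alphaMn (2 * q ^ 2)) //; ring.
Qed.

Lemma alpha_neq0 : alpha != 0. Proof. exact: val_fin_neq0 val_alpha. Qed.

Definition rho := pi / alpha ^+ (2 * q ^ 3 * (q - 1)).

Lemma val_rho : v rho = 0%E.
Proof.
rewrite (valM_fin vpi (valV_fin (valX_fin _ val_alpha))).
by rewrite -(@val_alphaMn (2 * q ^ 3 * (q - 1)) 1) ?muln1 // invr1 subrr.
Qed.

Definition norm_u (P : point K) := pt_u P / alpha ^+ (q ^ 3 * (q - 1)).
Definition norm_X1 (P : point K) := pt_X1 q pi P / alpha ^+ (q ^ 3).
Definition norm_X2 (P : point K) := pt_X2 P / alpha ^+ q.
Definition norm_Y1 (P : point K) := pt_Y1 q pi P / alpha ^+ (q ^ 2).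
Definition norm_Y2 (P : point K) := pt_Y2 P / alpha.

Let cancel_alpha (x : K) n : x = x / alpha ^+ n * alpha ^+ n.
Proof. by rewrite divfK // expf_neq0 // alpha_neq0. Qed.

Let expa (m n k l : nat) : (m + n = k + l)%N ->
  alpha ^+ m * alpha ^+ n = alpha ^+ k * alpha ^+ l.
Proof. by move=> h; rewrite -!exprD h. Qed.

(** The next four identities divide the equations of the level curve by their
    leading power of [alpha]. *)
Lemma norm_Y1E P : norm_Y1 P = norm_Y2 P ^+ (q ^ 2) +
  alpha ^+ exp_uy q * norm_u P * norm_Y2 P ^+ q +
  rho * alpha ^+ exp_py q * norm_Y2 P.
Proof.
have [E1 E2 _ _ _] := exp_eqs q_gt1.
apply: (mulIf (expf_neq0 (q ^ 2) alpha_neq0)); rewrite -cancel_alpha /pt_Y1 /pi_mul.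
rewrite {1}(cancel_alpha (pt_u P) (q ^ 3 * (q - 1))) -/(norm_u P).
rewrite {1}(cancel_alpha pi (2 * q ^ 3 * (q - 1))) -/rho.
rewrite [pt_Y2 P](cancel_alpha _ 1) expr1 -/(norm_Y2 P).
move: (norm_u P) (norm_Y2 P) => u y; rewrite !exprMn.
have H1 := expa (esym E1); have H2 := expa (esym E2); rewrite expr1 in H2.
transitivity (y ^+ (q ^ 2) * alpha ^+ (q ^ 2) +
  u * y ^+ q * (alpha ^+ (q ^ 3 * (q - 1)) * alpha ^+ q) +
  rho * y * (alpha ^+ (2 * q ^ 3 * (q - 1)) * alpha)); first by ring.
by rewrite H1 H2; ring.
Qed.

Lemma norm_X1E P : norm_X1 P = norm_X2 P ^+ (q ^ 2) +
  alpha ^+ exp_ux q * norm_u P * norm_X2 P ^+ q +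
  rho * alpha ^+ exp_px q * norm_X2 P.
Proof.
have [_ _ E1 E2 _] := exp_eqs q_gt1.
apply: (mulIf (expf_neq0 (q ^ 3) alpha_neq0)); rewrite -cancel_alpha /pt_X1 /pi_mul.
rewrite {1}(cancel_alpha (pt_u P) (q ^ 3 * (q - 1))) -/(norm_u P).
rewrite {1}(cancel_alpha pi (2 * q ^ 3 * (q - 1))) -/rho.
rewrite [pt_X2 P](cancel_alpha _ q) -/(norm_X2 P).
move: (norm_u P) (norm_X2 P) => u x; rewrite !exprMn -!exprM mulnn -expnS.
have H1 := expa (esym E1); have H2 := expa (esym E2).
transitivity (x ^+ (q ^ 2) * alpha ^+ (q ^ 3) +
  u * x ^+ q * (alpha ^+ (q ^ 3 * (q - 1)) * alpha ^+ (q ^ 2)) +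
  rho * x * (alpha ^+ (2 * q ^ 3 * (q - 1)) * alpha ^+ q)); first by ring.
by rewrite H1 H2; ring.
Qed.

Lemma norm_pi_Y1 P : pi_mul q pi (pt_u P) (pt_Y1 q pi P) = alpha ^+ (q ^ 4) *
  (norm_Y1 P ^+ (q ^ 2) + norm_u P * norm_Y1 P ^+ q +
   rho * alpha ^+ exp_pu q * norm_Y1 P).
Proof.
have [_ _ _ _ [E1 _ _]] := exp_eqs q_gt1; rewrite /pi_mul.
rewrite [pt_Y1 q pi P](cancel_alpha _ (q ^ 2)) -/(norm_Y1 P).
rewrite {1}(cancel_alpha (pt_u P) (q ^ 3 * (q - 1))) -/(norm_u P).
move: (norm_u P) (norm_Y1 P) => u y.
rewrite {1}(cancel_alpha pi (2 * q ^ 3 * (q - 1))) -/rho; rewrite !exprMn -!exprM -expnD -expnSr.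
have E2 : (q ^ 3 * (q - 1) + q ^ 3 = q ^ 4 + 0)%N.
  by rewrite -mulnSr subn1 prednK // -expnSr addn0.
have H1 := expa (esym E1); have H2 := expa E2; rewrite expr0 mulr1 in H2.
transitivity (y ^+ (q ^ 2) * alpha ^+ (q ^ 4) +
  u * y ^+ q * (alpha ^+ (q ^ 3 * (q - 1)) * alpha ^+ (q ^ 3)) +
  rho * y * (alpha ^+ (2 * q ^ 3 * (q - 1)) * alpha ^+ (q ^ 2))); first by ring.
by rewrite H1 H2; ring.
Qed.

Lemma norm_mu2 P : mu2 q pi P = alpha ^+ (2 * q ^ 2) *
  (alpha ^+ exp_g q * (norm_X1 P * norm_Y2 P ^+ q + norm_X2 P * norm_Y1 P ^+ q)
   - alpha ^+ exp_d q * norm_X1 P ^+ q * norm_Y2 P - norm_X2 P ^+ q * norm_Y1 P).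
Proof.
have [_ _ _ _ [_ E1 E2]] := exp_eqs q_gt1; rewrite /mu2.
rewrite [pt_Y2 P](cancel_alpha _ 1) expr1 -/(norm_Y2 P).
rewrite [pt_Y1 q pi P](cancel_alpha _ (q ^ 2)) -/(norm_Y1 P).
rewrite [pt_X1 q pi P](cancel_alpha _ (q ^ 3)) -/(norm_X1 P).
rewrite [pt_X2 P](cancel_alpha _ q) -/(norm_X2 P).
move: (norm_X1 P) (norm_X2 P) (norm_Y1 P) (norm_Y2 P) => x1 x y1 y.
rewrite !exprMn -!exprM mulnn -!expnSr.
have H1 := expa (esym E1); have H2 := expa (esym E2); rewrite expr1 in H2.
have H3 : alpha ^+ (q ^ 2) * alpha ^+ (q ^ 2) = alpha ^+ (2 * q ^ 2).
  by rewrite -exprD addnn mul2n.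
transitivity ((x1 * y ^+ q + x * y1 ^+ q) * (alpha ^+ (q ^ 3) * alpha ^+ q)
  - x1 ^+ q * y * (alpha ^+ (q ^ 4) * alpha) -
  x ^+ q * y1 * (alpha ^+ (q ^ 2) * alpha ^+ (q ^ 2))); first by ring.
by rewrite H1 H2 H3; ring.
Qed.

End LubinTateValuations.

(** * Existence of points *)

Section NormalPoints.
Variables (R : realType) (L : closedFieldType) (v : valuation R L) (q : nat).
Hypothesis q_gt1 : (1 < q)%N.
Hypothesis q_pchar : [pchar L].-nat q.
Variables (a rh : L).
Hypotheses (a_gt0 : (0 < v a)%E) (vrho : v rh = 0%E).

Let q_gt0 : (0 < q)%N. Proof. exact: ltnW. Qed.

Let exp_a_gt0 n : (0 < n)%N -> (0 < v (a ^+ n)%R)%E.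
Proof. by case: n => // n _; exact: val_gt0X. Qed.

(** Given [y], the equation for [u], in which [y1] is affine in [u], and then the
    one for [x] are integral polynomial equations whose constant term and one
    further coefficient are units. *)
Lemma normal_points y : v y = 0%E -> exists u x1 x y1,
  [/\ normal_system q a rh u x1 x y1 y, v u = 0%E & v x = 0%E].
Proof.
move=> vy; have [uy0 py0 ux0 px0 [pu0 g0 d0]] := exp_gt0 q_gt1.
have q2 : [pchar L].-nat (q ^ 2)%N by rewrite pnatX q_pchar.
have q2_neq1 : (1 == q ^ 2)%N = false.
  by rewrite ltn_eqF // -[X in (X < _)%N](expn0 q) ltn_exp2l.
have q1_neq0 : (0 == q ^ 2)%N = false by rewrite ltn_eqF // expn_gt0 q_gt0.
pose A := y ^+ (q ^ 2) + rh * a ^+ exp_py q * y.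
pose B := a ^+ exp_uy q * y ^+ q.
have vA : v A = 0%E.
  apply: val_unitD; first exact: val_unitX.
  apply: val_gt0Ml; last by rewrite vy.
  by apply: val_gt0Mr; [rewrite vrho|apply: exp_a_gt0].
have vB : (0 < v B)%E.
  by apply: val_gt0Ml; [apply: exp_a_gt0|rewrite val_unit_ge0 ?val_unitX].
have vra n : (0 < n)%N -> (0 < v (rh * a ^+ n)%R)%E.
  by move=> n0; apply: val_gt0Mr; [rewrite vrho|apply: exp_a_gt0].
pose P : {poly L} := (A ^+ (q ^ 2) + rh * a ^+ exp_pu q * A)%:P +
  (A ^+ q + rh * a ^+ exp_pu q * B)%:P * 'X +
  (B ^+ q)%:P * 'X^(q.+1) + (B ^+ (q ^ 2))%:P * 'X^(q ^ 2).
have Pint k : (0 <= v P`_k)%E.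
  have va n : (0 <= v (a ^+ n)%R)%E by apply/val_ge0X/ltW.
  have vA0 : (0 <= v A)%E by rewrite vA.
  have vB0 : (0 <= v B)%E by apply: ltW.
  have vr0 : (0 <= v rh)%E by rewrite vrho.
  have vnat (b : bool) : (0 <= v (b%:R)%R)%E by case: b; rewrite ?val1 ?val0 ?leey.
  rewrite !coefD !coefCM coefC coefX !coefXn.
  do !apply: val_ge_add; try (apply: val_ge0M => //).
  - case: ifP => _; last by rewrite val0 leey.
    apply: val_ge_add; first exact: val_ge0X.
    by apply: val_ge0M => //; apply: val_ge0M.
  - apply: val_ge_add; first exact: val_ge0X.
    by apply: val_ge0M => //; apply: val_ge0M.
  - exact: val_ge0X.
  - exact: val_ge0X.
have P0 : v P`_0 = 0%E.
  rewrite !coefD !coefCM coefC coefX !coefXn /= q1_neq0 !mulr0 !addr0.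
  apply: val_unitD; first exact: val_unitX.
  by apply: val_gt0Ml; [apply: vra|rewrite vA].
have P1 : v P`_1 = 0%E.
  rewrite !coefD !coefCM coefC coefX !coefXn /= q2_neq1 eqSS.
  rewrite [(0 == q)%N]ltn_eqF // !mulr0 !addr0 mulr1 add0r.
  apply: val_unitD; first exact: val_unitX.
  by apply: val_gt0Mr; [apply/ltW/vra|].
have [u /eqP Pu vu] := unit_root Pint P0 (n := 1) isT P1.
pose y1 := A + B * u.
have y1E : y1 = y ^+ (q ^ 2) + a ^+ exp_uy q * u * y ^+ q + rh * a ^+ exp_py q * y.
  by rewrite /y1 /A /B; ring.
clearbody A B.
have vy1 : v y1 = 0%E.
  by apply: val_unitD => //; apply: val_gt0Ml => //; rewrite vu.
have uE : y1 ^+ (q ^ 2) + u * y1 ^+ q + rh * a ^+ exp_pu q * y1 = 0.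
  rewrite -Pu /P !hornerE /y1 !frobD // !exprMn.
  by rewrite exprS; ring.
pose c1 := a ^+ exp_ux q * u; pose c2 := rh * a ^+ exp_px q.
have vc1 : (0 < v c1)%E by apply: val_gt0Ml; rewrite ?vu ?exp_a_gt0.
have vc2 : (0 < v c2)%E by apply: vra.
pose g := a ^+ exp_g q; pose d := a ^+ exp_d q.
have vg : (0 < v g)%E by apply: exp_a_gt0.
have vd : (0 < v d)%E by apply: exp_a_gt0.
pose Q : {poly L} := (-1)%:P +
  (g * y1 ^+ q + g * y ^+ q * c2)%:P * 'X +
  (g * y ^+ q * c1 - d * y * c2 ^+ q - y1)%:P * 'X^q +
  (g * y ^+ q - d * y * c1 ^+ q)%:P * 'X^(q ^ 2) +
  (- (d * y))%:P * 'X^(q ^ 3).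
have vyq n : (0 <= v (y ^+ n)%R)%E by rewrite val_unit_ge0 ?val_unitX.
have vy1q n : (0 <= v (y1 ^+ n)%R)%E by rewrite val_unit_ge0 ?val_unitX.
have vy0 : (0 <= v y)%E by rewrite vy.
have vy10 : (0 <= v y1)%E by rewrite vy1.
have Qint k : (0 <= v Q`_k)%E.
  have [vg0 vd0 vc10 vc20] : [/\ 0 <= v g, 0 <= v d, 0 <= v c1 & 0 <= v c2]%E.
    by split; apply: ltW.
  have vnat (b : bool) : (0 <= v (b%:R)%R)%E by case: b; rewrite ?val1 ?val0 ?leey.
  rewrite !coefD !coefCM coefC coefX !coefXn.
  do !apply: val_ge_add; try (apply: val_ge0M => //).
  - by case: ifP => _; rewrite ?valN ?val1 ?val0 ?leey.
  - by apply: val_ge_add; do ?[apply: val_ge0M => //].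
  - by do 2?apply: val_ge_sub => //; do ?[exact: val_ge0X|apply: val_ge0M => //].
  - by apply: val_ge_sub; do ?[exact: val_ge0X|apply: val_ge0M => //].
  - by rewrite valN; apply: val_ge0M.
have Q0 : v Q`_0 = 0%E.
  rewrite !coefD !coefCM coefC coefX !coefXn /= q1_neq0.
  rewrite [(0 == q)%N]ltn_eqF // [(0 == q ^ 3)%N]ltn_eqF ?expn_gt0 ?q_gt0 //.
  by rewrite !mulr0 !addr0 valN val1.
have Qq : v Q`_q = 0%E.
  rewrite !coefD !coefCM coefC coefX !coefXn eqxx [(q == 0)%N]gtn_eqF //.
  rewrite [(q == 1)%N]gtn_eqF // -[X in (X == q ^ 2)%N]expn1 -[X in (X == q ^ 3)%N]expn1.
  rewrite !eqn_exp2l // !mulr0 !addr0 !add0r mulr1 addrC.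
  apply: val_unitD; first by rewrite valN.
  apply: val_gt_sub; first by apply: val_gt0Mr => //; apply: val_ge0M => //; exact: ltW.
  apply: val_gt0Ml; last by apply/val_ge0X/ltW.
  exact: val_gt0Ml.
have [x /eqP Qx vx] := unit_root Qint Q0 q_gt0 Qq.
rewrite /Q in Qx; clear Q Qint Q0 Qq; clearbody y1.
exists u, (x ^+ (q ^ 2) + c1 * x ^+ q + c2 * x), x, y1; split=> //; split=> //.
apply/eqP; rewrite -subr_eq0; apply/eqP.
rewrite -/g -/d; clearbody g d c1 c2; rewrite -[RHS]Qx !hornerE.
rewrite !frobD // !exprMn -!exprM mulnn -expnSr.
by ring.
Qed.

End NormalPoints.

Lemma normal_system_map (K L : fieldType) (f : {rmorphism K -> L}) q
    (a rh u x1 x y1 y : K) :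
  normal_system q a rh u x1 x y1 y ->
  normal_system q (f a) (f rh) (f u) (f x1) (f x) (f y1) (f y).
Proof.
case=> E1 E2 E3 E4; split.
- by rewrite {1}E1 !(rmorphD, rmorphM, rmorphXn).
- by rewrite {1}E2 !(rmorphD, rmorphM, rmorphXn).
- by have := congr1 f E3; rewrite !(rmorphD, rmorphM, rmorphXn) rmorph0.
- have := congr1 f E4.
  by rewrite !(rmorphD, rmorphM, rmorphXn, rmorphN) rmorph1.
Qed.

Lemma defect_arith (R : realType) (b c d f s : R) :
  f + s + b = s + c -> d <= s -> 0 <= b -> c < d -> s <= f -> False.
Proof. by lra. Qed.

Section CurvePoints.
Variables (R : realType) (K : fieldType) (v : valuation R K) (q : nat).
Hypothesis q_gt1 : (1 < q)%N.
Hypothesis q_pchar : [pchar K].-nat q.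
Variables (pi pi2 alpha : K).
Hypothesis vpi : v pi = 1%E.
Hypothesis pi2_gen : LT2_generator q pi pi2.
Hypothesis alphaE : alpha ^+ (2 * q ^ 2) = pi2.

Let q_gt0 : (0 < q)%N. Proof. exact: ltnW. Qed.
Let e : R := val_alpha_num R q.
Let va : v alpha = e%:E := val_alpha q_gt1 vpi pi2_gen alphaE.
Let e_gt0 : 0 < e := val_alpha_gt0 R q_gt1.
Let vr : v (rho q pi alpha) = 0%E := val_rho q_gt1 vpi pi2_gen alphaE.
Let pi2_neq0 : pi2 != 0 := val_fin_neq0 (val_pi2 q_gt1 vpi pi2_gen).

Local Notation nu := (norm_u q alpha).
Local Notation nX1 := (norm_X1 q pi alpha).
Local Notation nX2 := (norm_X2 q alpha).
Local Notation nY1 := (norm_Y1 q pi alpha).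
Local Notation nY2 := (norm_Y2 alpha).

Let val_norm n (x : K) a : (a * n = 2 * q ^ 3 * (q - 1))%N ->
  (v (x / alpha ^+ a) == 0%E) = (v x == (n%:R^-1)%:E).
Proof.
move=> an; rewrite (val_alphaMn R q_gt1 an) -/e.
have [->|x0] := eqVneq x 0; first by rewrite mul0r val0.
have [r vx] := val_fin v x0.
rewrite (valM_fin vx (valV_fin (valX_fin _ va))) vx.
by rewrite eqe subr_eq0 eqe.
Qed.

Definition normal_units (P : point K) : Prop :=
  [/\ v (nu P) = 0%E, v (nX1 P) = 0%E, v (nX2 P) = 0%E, v (nY1 P) = 0%E &
      v (nY2 P) = 0%E].

Lemma normal_unitsP P : normal_units P <->
  [/\ v (pt_u P) = (2%:R^-1)%:E,
      v (pt_X1 q pi P) = ((2 * (q - 1))%N%:R^-1)%:E,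
      v (pt_X2 P) = ((2 * q ^ 2 * (q - 1))%N%:R^-1)%:E,
      v (pt_Y1 q pi P) = ((2 * q * (q - 1))%N%:R^-1)%:E
    & v (pt_Y2 P) = ((2 * q ^ 3 * (q - 1))%N%:R^-1)%:E].
Proof.
have Y2E : nY2 P = pt_Y2 P / alpha ^+ 1 by rewrite expr1.
have H (x : K) a n : (a * n = 2 * q ^ 3 * (q - 1))%N ->
    v (x / alpha ^+ a) = 0%E <-> v x = (n%:R^-1)%:E.
  by move=> /(val_norm x) E; split=> /eqP h; apply/eqP; [rewrite -E|rewrite E].
have [Eu E1 E2 E3 E4] : [/\ (q ^ 3 * (q - 1) * 2 = 2 * q ^ 3 * (q - 1))%N,
    (q ^ 3 * (2 * (q - 1)) = 2 * q ^ 3 * (q - 1))%N,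
    (q * (2 * q ^ 2 * (q - 1)) = 2 * q ^ 3 * (q - 1))%N,
    (q ^ 2 * (2 * q * (q - 1)) = 2 * q ^ 3 * (q - 1))%N &
    (1 * (2 * q ^ 3 * (q - 1)) = 2 * q ^ 3 * (q - 1))%N].
  by split; ring.
have Hu := H (pt_u P) _ _ Eu; have H1 := H (pt_X1 q pi P) _ _ E1.
have H2 := H (pt_X2 P) _ _ E2; have H3 := H (pt_Y1 q pi P) _ _ E3.
have H4 := H (pt_Y2 P) _ _ E4; rewrite /normal_units Y2E.
split=> -[h1 h2 h3 h4 h5].
  by split; [exact/Hu|exact/H1|exact/H2|exact/H3|exact/H4].
by split; [exact/Hu|exact/H1|exact/H2|exact/H3|exact/H4].
Qed.

Lemma Z11e1_normal P : Z11e1 v q pi pi2 P -> normal_units P /\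
  normal_system q alpha (rho q pi alpha) (nu P) (nX1 P) (nX2 P) (nY1 P) (nY2 P).
Proof.
case=> [[_ _ Y10 muE]] /normal_unitsP[vu vX1 vX2 vY1 vY2]; split=> //; split.
- exact: (norm_Y1E q_gt1 vpi pi2_gen alphaE).
- exact: (norm_X1E q_gt1 vpi pi2_gen alphaE).
- apply: (mulfI (expf_neq0 (q ^ 4) (alpha_neq0 q_gt1 vpi pi2_gen alphaE))).
  by rewrite mulr0 -(norm_pi_Y1 q_gt1 vpi pi2_gen alphaE).
- have a0 : alpha ^+ (2 * q ^ 2) != 0 by rewrite alphaE.
  by apply: (mulfI a0); rewrite mulr1 -(norm_mu2 q_gt1 vpi pi2_gen alphaE) alphaE muE.
Qed.

(** That [X_2] is a torsion point follows from the other equations: a nonzero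
    defect [X0] would have the valuation prescribed by [mu2_defect], which is
    smaller than the one that [pt_X1] and [pt_u] impose. *)
Lemma normal_Z11e1 P : v (nu P) = 0%E -> v (nX2 P) = 0%E -> v (nY2 P) = 0%E ->
  normal_system q alpha (rho q pi alpha) (nu P) (nX1 P) (nX2 P) (nY1 P) (nY2 P) ->
  Z11e1 v q pi pi2 P.
Proof.
move=> vu vx vy ns.
have [uy0 py0 ux0 px0 _] := exp_gt0 q_gt1.
have va_gt0 n : (0 < n)%N -> (0 < v (alpha ^+ n)%R)%E.
  by move=> n0; rewrite (valX_fin n va) lte_fin pmulrn_lgt0.
have small n m (s t : K) : (0 < n)%N -> (0 < m)%N -> v s = 0%E ->
    v (t ^+ (q ^ 2) + alpha ^+ n * nu P * s + rho q pi alpha * alpha ^+ m * t) = 0%E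
    \/ v t != 0%E.
  move=> n0 m0 vs; have [vt|] := eqVneq (v t) 0%E; [left|by right].
  apply: val_unitD; first apply: val_unitD.
  - exact: val_unitX.
  - by do !apply: val_gt0Ml; rewrite ?vu ?vs ?va_gt0.
  - by apply: val_gt0Ml; rewrite ?vt //; apply: val_gt0Mr; rewrite ?vr ?va_gt0.
have vy1 : v (nY1 P) = 0%E.
  rewrite (ns_y1 ns); case: (small (exp_uy q) (exp_py q) (nY2 P ^+ q) (nY2 P)) => //.
    exact: val_unitX.
  by rewrite vy eqxx.
have vx1 : v (nX1 P) = 0%E.
  rewrite (ns_x1 ns); case: (small (exp_ux q) (exp_px q) (nX2 P ^+ q) (nX2 P)) => //.
    exact: val_unitX.
  by rewrite vx eqxx.
have /normal_unitsP[vuP vX1 vX2 vY1 vY2] : normal_units P by split.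
split; last by split.
have Y10 : pi_mul q pi (pt_u P) (pt_Y1 q pi P) = 0.
  by rewrite (norm_pi_Y1 q_gt1 vpi pi2_gen alphaE) (ns_u ns) mulr0.
have muE : mu2 q pi P = pi2.
  by rewrite (norm_mu2 q_gt1 vpi pi2_gen alphaE) (ns_mu ns) mulr1.
have m0 : (0 < q - 1)%N by rewrite subn_gt0.
split=> //; first by rewrite vuP lte_fin invr_gt0.
have := mu2_defect q_pchar pi2_gen Y10 muE.
set X0 := pi_mul q pi (pt_u P) (pt_X1 q pi P).
have [->//|X0_neq0] := eqVneq X0 0 => E; exfalso.
have vpiE : v pi = (e *+ (2 * q ^ 3 * (q - 1)))%:E.
  by rewrite vpi -(@val_alphaMn R q q_gt1 _ 1) ?muln1 // invr1.
have vuE : v (pt_u P) = (e *+ (q ^ 3 * (q - 1)))%:E.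
  by rewrite vuP; rewrite (@val_alphaMn R q q_gt1 (q ^ 3 * (q - 1))) //; ring.
have vX1E : v (pt_X1 q pi P) = (e *+ q ^ 3)%:E.
  by rewrite vX1; rewrite (@val_alphaMn R q q_gt1 (q ^ 3)) //; ring.
have vY1E : v (pt_Y1 q pi P) = (e *+ q ^ 2)%:E.
  by rewrite vY1; rewrite (@val_alphaMn R q q_gt1 (q ^ 2)) //; ring.
have vY2E : v (pt_Y2 P) = e%:E by rewrite vY2 (@val_alphaMn R q q_gt1 1) ?mul1n.
have [s vs] := val_fin v X0_neq0.
have q4 : (q ^ 4 = q ^ 3 * (q - 1) + q ^ 3)%N.
  by rewrite -mulnSr subn1 prednK // -expnSr.
have sge : e *+ (q ^ 4) <= s.
  rewrite -lee_fin -vs /X0 /pi_mul; do 2?apply: val_ge_add.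
  - rewrite (valX_fin _ vX1E) lee_fin -mulrnA ler_pMn2l // -expnD leq_exp2l //.
  - rewrite (valM_fin vuE (valX_fin _ vX1E)) lee_fin -mulrnA -mulrnDr ler_pMn2l //.
    by rewrite -expnSr leq_addl.
  - rewrite (valM_fin vpiE vX1E) lee_fin -mulrnDr ler_pMn2l // q4 leq_add2r.
    by rewrite -mulnA leq_pmull.
have vE : v (pi * pt_Y2 P ^+ q + pt_Y1 q pi P ^+ q) = (e *+ q ^ 3)%:E.
  rewrite addrC; have vY1q := valX_fin q vY1E; rewrite -mulrnA -expnSr in vY1q.
  rewrite valDl // vY1q (valM_fin vpiE (valX_fin _ vY2E)) lte_fin -mulrnDr ltr_pMn2l //.
  apply: (@leq_ltn_trans (2 * q ^ 3 * (q - 1))).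
    by rewrite mulnAC leq_pmull // muln_gt0.
  by rewrite -[X in (X < _)%N]addn0 ltn_add2l.
have := congr1 v E.
rewrite (valM_fin (valX_fin q vs) (valX_fin _ vY2E)) (valM_fin vs vE) => -[] E'.
have q1E : s *+ q = s *+ (q - 1) + s by rewrite -mulrSr subn1 prednK.
have s0 : 0 <= s by apply: le_trans sge; rewrite mulrn_wge0 // ltW.
have : s <= s *+ (q - 1) by rewrite -mulr_natl ler_peMl // ler1n.
have : e *+ q ^ 3 < e *+ q ^ 4 by rewrite ltr_pMn2l // ltn_exp2l.
have : 0 <= e *+ q ^ 2 by rewrite mulrn_wge0 // ltW.
by rewrite q1E in E'; exact: (defect_arith E' sge).
Qed.

End CurvePoints.

Section Residues.
Variables (R : realType) (K : fieldType) (v : valuation R K).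
Implicit Types x y : K.

Lemma res_eq x y : (0 <= v x)%E -> (0 <= v y)%E ->
  (res v x == res v y) = (0 < v (x - y)%R)%E.
Proof. by move=> x0 y0; rewrite /res residue_eqE !insubdK ?integral_eltsE. Qed.

Lemma res_eq0 x : (0 <= v x)%E -> (res v x == 0) = (0 < v x)%E.
Proof. by move=> x0; rewrite /res residue_eq0E insubdK ?integral_eltsE. Qed.

Lemma res0 : res v 0 = 0.
Proof. by apply/eqP; rewrite res_eq0 val0 ?leey ?ltry. Qed.

Lemma res_neq0 x : v x = 0%E -> res v x != 0.
Proof. by move=> vx; rewrite res_eq0 vx ?ltxx. Qed.

Lemma res_unit x : (0 <= v x)%E -> res v x != 0 -> v x = 0%E.
Proof.
move=> x0; rewrite res_eq0 // -leNgt => x0'.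
by apply/eqP; rewrite eq_le x0 x0'.
Qed.

Lemma resN x : (0 <= v x)%E -> res v (- x) = - res v x.
Proof. by move=> x0; rewrite -sub0r resB ?val0 ?leey // res0 sub0r. Qed.

Lemma resD x y : (0 <= v x)%E -> (0 <= v y)%E -> res v (x + y) = res v x + res v y.
Proof. by move=> x0 y0; rewrite -[y]opprK resB ?valN // resN ?valN // !opprK. Qed.

Lemma resX x n : (0 <= v x)%E -> res v (x ^+ n) = res v x ^+ n.
Proof.
move=> x0; elim: n => [|n IH]; first by rewrite !expr0 res1.
by rewrite !exprS resM ?IH // val_ge0X.
Qed.

Lemma resV x : v x = 0%E -> res v x^-1 = (res v x)^-1.
Proof.
move=> vx; apply: (mulfI (res_neq0 vx)); rewrite divff ?res_neq0 //.
by rewrite -resM ?val_unit_ge0 ?val_unitV // divff ?res1 // (val_unit_neq0 vx).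
Qed.

Lemma res_sum (I : Type) (s : seq I) (P : pred I) (G : I -> K) :
  (forall i, P i -> 0 <= v (G i))%E ->
  res v (\sum_(i <- s | P i) G i) = \sum_(i <- s | P i) res v (G i).
Proof.
move=> G0; elim: s => [|i s IH]; first by rewrite !big_nil res0.
rewrite !big_cons; case: ifP => // Pi; rewrite resD ?IH ?G0 //.
exact: val_ge_sum.
Qed.

Lemma res_surj c : exists2 x, (0 <= v x)%E & res v x = c.
Proof.
pose a : val_ring v := repr c; exists (val a).
  by rewrite -integral_eltsE; exact: valP a.
by rewrite /res valKd reprK.
Qed.

End Residues.

(** A polynomial over [Fbar] already splits there. *)
Lemma alg_image (Fbar : closedFieldType) (C : fieldType)
    (j : {rmorphism Fbar -> C}) (P : {poly Fbar}) (c : C) :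
  P != 0 -> root (map_poly j P) c -> exists a, c = j a.
Proof.
move=> P0; have [s {1}->] := closed_field_poly_normal P.
rewrite map_polyZ rootZ ?fmorph_eq0 ?lead_coef_eq0 //.
rewrite rmorph_prod /= (eq_bigr (fun z => 'X - (j z)%:P)); last first.
  by move=> z _; rewrite rmorphB /= map_polyX map_polyC.
rewrite -(big_map j xpredT (fun z => 'X - z%:P)) root_prod_XsubC.
by case/mapP => a _ ->; exists a.
Qed.

Section PointExistence.
Variables (R : realType) (F : fieldType) (vF : valuation R F).
Variables (p q : nat) (piF : F).
Hypothesis F_local : local_field vF p q piF.
Variables (Fbar : closedFieldType) (C : fieldType) (v : valuation R C).
Variables (i : {rmorphism F -> Fbar}) (j : {rmorphism Fbar -> C}).
Hypothesis C_completion : completed_closure vF v i j.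

Lemma residue_lift (c : residue_field v) :
  exists2 t : Fbar, (0 <= v (j t))%E & res v (j t) = c.
Proof.
have [x x0 <-] := res_surj c; have [t xt] := cc_dense C_completion x 1.
have xt0 : (0 < v (x - j t)%R)%E by apply: lt_le_trans xt; rewrite lte_fin.
have t0 : (0 <= v (j t))%E.
  by rewrite -[j t](subKr x); apply: val_ge_sub => //; exact: ltW.
by exists t => //; apply/esym/eqP; rewrite res_eq.
Qed.

(** If [g] vanished at all nonzero points, [1 + X g] would have no root, but a
    lift of it has a root of valuation 0. *)
Lemma residue_field_infinite (g : {poly residue_field v}) :
  g != 0 -> exists2 y, y != 0 & g.[y] != 0.
Proof.
move=> g0; apply: contrapT => gy.
have {}gy y : y != 0 -> g.[y] = 0.
  by move=> y0; apply/eqP/negPn/negP => h; apply: gy; exists y.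
pose H := 1 + 'X * g.
have H0 : H`_0 = 1 by rewrite coefD coef1 coefXM addr0.
have Xg0 : 'X * g != 0 by rewrite mulf_eq0 polyX_eq0 (negPf g0).
have sH : size H = (size g).+1.
  rewrite /H addrC mulrC size_polyDl size_mulX // size_poly1 ltnS.
  by rewrite size_poly_gt0.
have /boolp.choice[T HT] : forall k, exists t, (0 <= v (j t))%E /\ res v (j t) = H`_k.
  by move=> k; have [t t0 tk] := residue_lift H`_k; exists t.
pose P := \poly_(k < size H) T k.
pose vb := val_comp v j.
have vbE a : vb a = v (j a) by [].
have Pk k : (0 <= vb P`_k)%E /\ res v (j P`_k) = H`_k.
  rewrite vbE coef_poly; case: ltnP => kH; first exact: HT.
  by rewrite rmorph0 res0 val0 leey nth_default.
have Punit k : H`_k != 0 -> vb P`_k = 0%E.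
  by move=> Hk; rewrite vbE; apply: res_unit; [exact: (Pk k).1|rewrite (Pk k).2].
have P0 : vb P`_0 = 0%E by apply: Punit; rewrite H0 oner_eq0.
have Pn : vb P`_(size g) = 0%E.
  apply: Punit; rewrite -[X in H`_X]/((size g).+1.-1) -sH -lead_coefE lead_coef_eq0.
  by rewrite -size_poly_eq0 sH.
have [|z /eqP Pz vz] := unit_root (fun k => (Pk k).1) P0 _ Pn.
  by rewrite size_poly_gt0.
have vz0 : (0 <= v (j z))%E by rewrite -vbE vz.
have : res v (j P.[z]) = H.[res v (j z)].
  rewrite (@horner_coef_wide _ (size H)) ?size_poly // horner_coef rmorph_sum.
  rewrite res_sum => [|k _]; last first.
    by rewrite rmorphM rmorphXn; apply: val_ge0M; [apply: (Pk k).1|apply: val_ge0X].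
  apply: eq_bigr => k _; rewrite rmorphM rmorphXn resM ?resX ?(Pk k).2 //.
    exact: (Pk k).1.
  exact: val_ge0X.
rewrite Pz rmorph0 res0 /H !hornerE gy ?mulr0 ?addr0; last exact: res_neq0.
by move/esym/eqP; rewrite oner_eq0.
Qed.

Variables (pi2 alpha : C).
Let pi := j (i piF).
Hypothesis pi2_gen : LT2_generator q pi pi2.
Hypothesis alphaE : alpha ^+ (2 * q ^ 2) = pi2.

Let q_gt1 : (1 < q)%N := local_q_gt1 F_local.
Let q_gt0 : (0 < q)%N := ltnW q_gt1.
Let vpi : v pi = 1%E := val_uniformizer F_local C_completion.
Let C_pchar : [pchar C].-nat q := completion_pchar F_local i j.

Lemma alpha_algebraic : exists a : Fbar, alpha = j a.
Proof.
have piF0 : i piF != 0.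
  by rewrite fmorph_eq0 (val_fin_neq0 (lf_uniformizer F_local)).
have q2_1 : (1 == q ^ 2)%N = false.
  by rewrite ltn_eqF // -[X in (X < _)%N](expn0 q) ltn_exp2l.
have [b pi2E] : exists b : Fbar, pi2 = j b.
  pose c := i piF.
  pose P : {poly Fbar} := c ^+ 2 *: 'X - (c + c ^+ q) *: 'X^q + 'X^(q ^ 2).
  have P0 : P != 0.
    apply/eqP => /(congr1 (fun r : {poly Fbar} => r`_1)); rewrite coef0 !coefD coefN !coefZ.
    rewrite coefX !coefXn q2_1 [(1 == q)%N]ltn_eqF // mulr0 subr0 addr0 mulr1.
    by move/eqP; rewrite expf_eq0 (negPf piF0).
  apply: (alg_image (j := j) P0); have [LT2 _] := pi2_gen.
  rewrite /root -[X in _ == X]LT2 /P rmorphD rmorphB /= !map_polyZ !map_polyXn.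
  rewrite map_polyX !hornerE /pi_LT frobB // exprMn -!exprM mulnn.
  by rewrite rmorphD !rmorphXn -/pi; apply/eqP; ring.
apply: (alg_image (j := j) (P := 'X^(2 * q ^ 2) - b%:P)).
  by rewrite -size_poly_eq0 size_XnsubC // muln_gt0 expn_gt0 q_gt0.
by rewrite rmorphB /= map_polyXn map_polyC /root hornerD hornerN hornerXn hornerC alphaE pi2E subrr.
Qed.

(** For [Y_2 / alpha] in [Fbar], the equations for [u] and [x] have their
    coefficients in [Fbar] and are solved there, as [alpha] is algebraic. *)
Lemma point_exists (t : Fbar) : v (j t) = 0%E ->
  exists2 P, Z11e1 v q pi pi2 P & norm_Y2 alpha P = j t.
Proof.
move=> vt; have [a aE] := alpha_algebraic.
have va := val_alpha q_gt1 vpi pi2_gen alphaE.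
have a0 := alpha_neq0 q_gt1 vpi pi2_gen alphaE.
pose vb := val_comp v j.
pose rh := i piF / a ^+ (2 * q ^ 3 * (q - 1)).
have rhE : j rh = rho q pi alpha by rewrite /rh rmorphM fmorphV rmorphXn /= -aE.
have vrh : vb rh = 0%E.
  by rewrite val_compE rhE (val_rho q_gt1 vpi pi2_gen alphaE).
have va0 : (0 < vb a)%E by rewrite val_compE -aE va lte_fin val_alpha_gt0.
have bar_q : [pchar Fbar].-nat q := bar_pchar F_local i.
have [u [x1 [x [y1 [ns vu vx]]]]] := normal_points q_gt1 bar_q va0 vrh (vt : vb t = 0%E).
have := normal_system_map j ns; rewrite -aE rhE => nsj.
pose P := Point (j u * alpha ^+ (q ^ 3 * (q - 1))) (j x * alpha ^+ q) (j t * alpha).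
have uE : norm_u q alpha P = j u by rewrite /norm_u /= mulfK // expf_neq0.
have xE : norm_X2 q alpha P = j x by rewrite /norm_X2 /= mulfK // expf_neq0.
have yE : norm_Y2 alpha P = j t by rewrite /norm_Y2 /= mulfK.
exists P => //; apply: (normal_Z11e1 q_gt1 C_pchar vpi pi2_gen alphaE).
- by rewrite uE.
- by rewrite xE.
- by rewrite yE.
rewrite (norm_X1E q_gt1 vpi pi2_gen alphaE) (norm_Y1E q_gt1 vpi pi2_gen alphaE).
by rewrite uE xE yE -(ns_x1 nsj) -(ns_y1 nsj).
Qed.

End PointExistence.

(** * Expansions of the coordinates *)

Section Approximation.
Variables (R : realType) (K : fieldType) (v : valuation R K) (T : Type).
Variables (alpha : K) (e : R).
Hypotheses (va : v alpha = e%:E) (e_gt0 : 0 < e).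
Variables (x y w : T -> K).
Hypotheses (vx : forall P, v (x P) = 0%E) (vy : forall P, v (y P) = 0%E).
Hypothesis yw : forall P, y P * w P = 1.
Implicit Types (f g h s : T -> K).

Let vw P : v (w P) = 0%E.
Proof.
have -> : w P = (y P)^-1 by apply: (mulfI (val_unit_neq0 (vy P))); rewrite yw divff ?(val_unit_neq0 (vy P)).
exact: val_unitV.
Qed.

Let va0 : (0 <= v alpha)%E. Proof. by rewrite va lee_fin ltW. Qed.

(** Coefficients are integral, so that approximations of two functions multiply
    to an approximation of the product with the same precision. *)
Inductive gen : (T -> K) -> Prop :=
| gen_cst c : (0 <= v c)%E -> gen (fun=> c)
| gen_x : gen x
| gen_y : gen y
| gen_w : gen w
| gen_add f g : gen f -> gen g -> gen (fun P => f P + g P)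
| gen_mul f g : gen f -> gen g -> gen (fun P => f P * g P).

Lemma gen_ge0 f : gen f -> forall P, (0 <= v (f P))%E.
Proof.
elim=> [c c0 P|P|P|P|{}f g _ Hf _ Hg P|{}f g _ Hf _ Hg P] //; rewrite ?vx ?vy ?vw //.
- exact: val_ge_add.
- exact: val_ge0M.
Qed.

(** Precision is counted in multiples of the valuation [e] of [alpha]; each
    substitution into the system of equations gains one unit. *)
Definition gen_approx n f :=
  exists2 h, gen h & forall P, ((e *+ n)%:E <= v (f P - h P)%R)%E.

Let en0 n : (0 <= (e *+ n)%:E)%E.
Proof. by rewrite lee_fin mulrn_wge0 // ltW. Qed.

Lemma gen_approx_ge0 n f : gen_approx n f -> forall P, (0 <= v (f P))%E.
Proof.
move=> [h hg fh] P; rewrite -[f P](subrK (h P)); apply: val_ge_add.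
  exact: le_trans (en0 n) (fh P).
exact: gen_ge0.
Qed.

Lemma gen_approx_gen n f : gen f -> gen_approx n f.
Proof. by move=> fg; exists f => // P; rewrite subrr val0 leey. Qed.

Lemma gen_approx_ext n f g : f =1 g -> gen_approx n f -> gen_approx n g.
Proof. by move=> fg [h hg fh]; exists h => // P; rewrite -fg. Qed.

Lemma gen_approxW n m f : (n <= m)%N -> gen_approx m f -> gen_approx n f.
Proof.
move=> nm [h hg fh]; exists h => // P; apply: le_trans (fh P).
by rewrite lee_fin ler_pMn2l.
Qed.

Lemma gen_approx_cst n c : (0 <= v c)%E -> gen_approx n (fun=> c).
Proof. by move=> c0; apply: gen_approx_gen; exact: gen_cst. Qed.

Lemma gen_approxD n f g : gen_approx n f -> gen_approx n g ->
  gen_approx n (fun P => f P + g P).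
Proof.
move=> [h hg fh] [h' hg' fh']; exists (fun P => h P + h' P); first exact: gen_add.
by move=> P; rewrite opprD addrACA; apply: val_ge_add.
Qed.

Lemma gen_approxM n f g : gen_approx n f -> gen_approx n g ->
  gen_approx n (fun P => f P * g P).
Proof.
move=> fa [h' hg' gh']; have f0 := gen_approx_ge0 fa; case: fa => h hg fh.
exists (fun P => h P * h' P); first exact: gen_mul.
move=> P; have -> : f P * g P - h P * h' P =
  f P * (g P - h' P) + (f P - h P) * h' P by ring.
apply: val_ge_add; first exact: val_ge_mul0r.
by apply: val_ge_mul0 => //; exact: gen_ge0.
Qed.

Lemma gen_approxN n f : gen_approx n f -> gen_approx n (fun P => - f P).
Proof.
move=> fa; apply: (@gen_approx_ext _ (fun P => -1 * f P)) => [P|].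
  by rewrite mulN1r.
by apply: gen_approxM => //; apply: gen_approx_cst; rewrite valN val1.
Qed.

Lemma gen_approxX n m f : gen_approx n f -> gen_approx n (fun P => f P ^+ m).
Proof.
move=> fa; elim: m => [|m IH].
  by apply: (@gen_approx_ext _ (fun=> 1)) => //; apply: gen_approx_cst; rewrite val1.
apply: (@gen_approx_ext _ (fun P => f P * f P ^+ m)) => [P|]; first by rewrite exprS.
exact: gen_approxM.
Qed.

Lemma gen_approx_alpha n f : gen_approx n f -> gen_approx n.+1 (fun P => alpha * f P).
Proof.
move=> [h hg fh]; exists (fun P => alpha * h P); first exact/gen_mul/hg/gen_cst.
move=> P; rewrite -mulrBr mulrS; apply: val_ge_mul => //.
by rewrite va.
Qed.

Lemma one_plus_unit s P : (forall P, 0 <= v (s P))%E -> v (1 + alpha * s P) = 0%E.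
Proof.
move=> s0; apply: val_unitD; first exact: val1.
by apply: val_gt0Ml => //; rewrite va lte_fin.
Qed.

(** The geometric series is truncated where its remainder acquires the factor
    [alpha ^+ n.+1]. *)
Lemma gen_approx_inv n s : gen_approx n s ->
  gen_approx n.+1 (fun P => (1 + alpha * s P)^-1).
Proof.
move=> sa; have s0 := gen_approx_ge0 sa.
have asa : gen_approx n.+1 (fun P => - (alpha * s P)).
  by apply: gen_approxN; exact: gen_approx_alpha.
have geom m : gen_approx n.+1 (fun P => \sum_(k < m) (- (alpha * s P)) ^+ k).
  elim: m => [|m IH].
    apply: (@gen_approx_ext _ (fun=> 0)) => [P|]; first by rewrite big_ord0.
    by apply: gen_approx_cst; rewrite val0 leey.
  apply: (@gen_approx_ext _ (fun P => \sum_(k < m) (- (alpha * s P)) ^+ k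
      + (- (alpha * s P)) ^+ m)) => [P|]; first by rewrite big_ord_recr.
  by apply: gen_approxD => //; exact: gen_approxX.
have [h hg sh] := geom n.+1; exists h => // P.
set r := - (alpha * s P); have vu := one_plus_unit P s0.
have u0 := val_unit_neq0 vu.
rewrite -(subrKA (\sum_(k < n.+1) r ^+ k)); apply: val_ge_add; last exact: sh.
have -> : (1 + alpha * s P)^-1 - \sum_(k < n.+1) r ^+ k =
    r ^+ n.+1 * (1 + alpha * s P)^-1.
  apply: (mulIf u0); rewrite mulrBl mulVf // divfK //.
  have -> : 1 + alpha * s P = 1 - r by rewrite /r opprK.
  have := subrX1 r n.+1; set S := \sum_(_ < _) _; rewrite -[r - 1]opprB mulNr => E.
  by rewrite [S * _]mulrC -[(1 - r) * S]opprK -E; ring.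
apply: val_ge_mul0; last by rewrite val_unit_ge0 // val_unitV.
by apply: valX_ge; rewrite valN; apply: val_ge_mul0 => //; rewrite va.
Qed.

Definition gen_closure f := forall n, gen_approx n f.

Lemma gen_closure_inv s : gen_closure s -> gen_closure (fun P => (1 + alpha * s P)^-1).
Proof. by move=> sc n; apply: (gen_approxW (leqnSn n)); exact: gen_approx_inv. Qed.

End Approximation.

Section SystemClosure.
Variables (R : realType) (K : fieldType) (v : valuation R K) (T : Type).
Variables (alpha : K) (e : R).
Hypotheses (va : v alpha = e%:E) (e_gt0 : 0 < e).
Variables (q : nat) (rh : K).
Hypothesis q_gt1 : (1 < q)%N.
Hypothesis vrh : v rh = 0%E.
Variables (u x1 x y1 y w : T -> K).
Hypothesis ns : forall P, normal_system q alpha rh (u P) (x1 P) (x P) (y1 P) (y P).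
Hypotheses (vu : forall P, v (u P) = 0%E) (vx1 : forall P, v (x1 P) = 0%E).
Hypotheses (vx : forall P, v (x P) = 0%E) (vy1 : forall P, v (y1 P) = 0%E).
Hypotheses (vy : forall P, v (y P) = 0%E) (yw : forall P, y P * w P = 1).
Implicit Types (f g h s : T -> K).

Local Notation appr := (gen_approx v e x y w).
Local Notation clos := (gen_closure v e x y w).

Let q_gt0 : (0 < q)%N. Proof. exact: ltnW. Qed.
Let va0 : (0 <= v alpha)%E. Proof. by rewrite va lee_fin ltW. Qed.
Let vrh0 : (0 <= v rh)%E. Proof. by rewrite vrh. Qed.
Let apprD := gen_approxD (v := v) (e := e) (x := x) (y := y) (w := w).
Let apprM := gen_approxM e_gt0 vx vy yw.
Let apprN := gen_approxN e_gt0 vx vy yw.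
Let apprX := gen_approxX e_gt0 vx vy yw.
Let apprA := gen_approx_alpha va e_gt0 (x := x) (y := y) (w := w).
Let apprI := gen_approx_inv va e_gt0 vx vy yw.

Let appr_gen n f : gen v x y w f -> appr n f.
Proof. exact: gen_approx_gen. Qed.

Let appr_cst n c : (0 <= v c)%E -> appr n (fun=> c).
Proof. exact: gen_approx_cst. Qed.

Definition y1_defect P := w P ^+ (q ^ 2) * (alpha ^+ (exp_uy q).-1 * u P * y P ^+ q
  + rh * alpha ^+ (exp_py q).-1 * y P).

Let wy n P : y P ^+ n * w P ^+ n = 1.
Proof. by rewrite -exprMn yw expr1n. Qed.

Lemma y1_defectE P : y1 P = y P ^+ (q ^ 2) * (1 + alpha * y1_defect P).
Proof.
have [uy0 py0 _ _ _] := exp_gt0 q_gt1.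
rewrite (ns_y1 (ns P)) /y1_defect mulrDr mulr1.
have -> : y P ^+ (q ^ 2) * (alpha * (w P ^+ (q ^ 2) *
    (alpha ^+ (exp_uy q).-1 * u P * y P ^+ q + rh * alpha ^+ (exp_py q).-1 * y P))) =
  y P ^+ (q ^ 2) * w P ^+ (q ^ 2) * (alpha * alpha ^+ (exp_uy q).-1 * u P * y P ^+ q
  + rh * (alpha * alpha ^+ (exp_py q).-1) * y P) by ring.
by rewrite wy mul1r -!exprS !prednK // addrA.
Qed.

Lemma y1_invE P : (y1 P)^-1 = w P ^+ (q ^ 2) * (1 + alpha * y1_defect P)^-1.
Proof.
rewrite y1_defectE invfM; congr (_ * _).
have yn0 : y P ^+ (q ^ 2) != 0 by rewrite expf_neq0 // (val_unit_neq0 (vy P)).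
by apply: (mulfI yn0); rewrite wy divff.
Qed.

Lemma appr_y1_defect n : appr n u -> appr n y1_defect.
Proof.
move=> ua; apply: apprM; first by apply/apprX/appr_gen/gen_w.
apply: apprD.
  apply: apprM; last by apply/apprX/appr_gen/gen_y.
  by apply: apprM => //; apply: appr_cst; exact: val_ge0X.
apply: apprM; last by apply/appr_gen/gen_y.
by apply: appr_cst; apply: val_ge0M => //; exact: val_ge0X.
Qed.

Lemma appr_y1 n : appr n u -> appr n.+1 y1.
Proof.
move=> ua; apply: gen_approx_ext (fun P => esym (y1_defectE P)) _.
apply: apprM; first by apply/apprX/appr_gen/gen_y.
apply: apprD; first by apply: appr_cst; rewrite val1.
by apply: apprA; exact: appr_y1_defect.
Qed.

Lemma appr_y1_inv n : appr n u -> appr n.+1 (fun P => (y1 P)^-1).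
Proof.
move=> ua; apply: gen_approx_ext (fun P => esym (y1_invE P)) _.
apply: apprM; first by apply/apprX/appr_gen/gen_w.
by apply: apprI; exact: appr_y1_defect.
Qed.

(** The equation expressing [u] through [y1] and the one expressing [y1]
    through [u] form a contraction, since [u] occurs in [y1] with a coefficient
    divisible by [alpha]. *)
Lemma appr_u n : appr n u.
Proof.
elim: n => [|n IH].
  exists (fun=> 0); first by apply: gen_cst; rewrite val0 leey.
  by move=> P; rewrite subr0 mulr0n vu.
have uE P : - ((y1 P ^+ (q ^ 2) + rh * alpha ^+ exp_pu q * y1 P) * (y1 P)^-1 ^+ q) = u P.
  have y10 := val_unit_neq0 (vy1 P).
  apply: (mulIf (expf_neq0 q y10)); rewrite mulNr -[_ * _ * y1 P ^+ q]mulrA -exprMn mulVf // expr1n mulr1.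
  by have := ns_u (ns P); rewrite addrAC => /eqP; rewrite addrC addr_eq0 => /eqP ->.
apply: gen_approx_ext uE _; apply: apprN; apply: apprM.
  apply: apprD; first by apply: apprX; exact: appr_y1.
  apply: apprM; last exact: appr_y1.
  by apply: appr_cst; apply: val_ge0M => //; exact: val_ge0X.
by apply: apprX; exact: appr_y1_inv.
Qed.

Let closM f g : clos f -> clos g -> clos (fun P => f P * g P).
Proof. by move=> fc gc n; apply: apprM. Qed.

Let closD f g : clos f -> clos g -> clos (fun P => f P + g P).
Proof. by move=> fc gc n; apply: apprD. Qed.

Let closN f : clos f -> clos (fun P => - f P).
Proof. by move=> fc n; apply: apprN. Qed.

Let closX f m : clos f -> clos (fun P => f P ^+ m).
Proof. by move=> fc n; apply: apprX. Qed.

Let clos_cst c : (0 <= v c)%E -> clos (fun=> c).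
Proof. by move=> c0 n; apply: appr_cst. Qed.

Let clos_inv s : clos s -> clos (fun P => (1 + alpha * s P)^-1).
Proof. exact: gen_closure_inv. Qed.

Let clos_alphaX m : clos (fun=> alpha ^+ m).
Proof. by apply: clos_cst; exact: val_ge0X. Qed.

Lemma clos_x : clos x. Proof. by move=> n; apply/appr_gen/gen_x. Qed.
Lemma clos_y : clos y. Proof. by move=> n; apply/appr_gen/gen_y. Qed.
Lemma clos_w : clos w. Proof. by move=> n; apply/appr_gen/gen_w. Qed.
Lemma clos_u : clos u. Proof. exact: appr_u. Qed.

Lemma clos_y1 : clos y1.
Proof. by move=> n; apply: (gen_approxW e_gt0 (leqnSn n)); apply/appr_y1/appr_u. Qed.

Lemma clos_y1V : clos (fun P => (y1 P)^-1).
Proof. by move=> n; apply: (gen_approxW e_gt0 (leqnSn n)); apply/appr_y1_inv/appr_u. Qed.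

Lemma clos_y1_defect : clos y1_defect.
Proof. by move=> n; apply/appr_y1_defect/appr_u. Qed.

Lemma clos_x1 : clos x1.
Proof.
move=> n; apply: gen_approx_ext (fun P => esym (ns_x1 (ns P))) _; move: n.
apply: closD; first apply: closD.
- exact/closX/clos_x.
- by do !apply: closM => //; [exact: clos_u|exact/closX/clos_x].
- apply: closM; last exact: clos_x.
  by apply: closM => //; exact: clos_cst.
Qed.

Definition x_defect P := alpha ^+ (exp_g q).-1 * (x1 P * y P ^+ q + x P * y1 P ^+ q)
  - alpha ^+ (exp_d q).-1 * x1 P ^+ q * y P.

Lemma x_defectE P : x P ^+ q * y1 P = - (1 - alpha * x_defect P).
Proof.
have [_ _ _ _ [_ g0 d0]] := exp_gt0 q_gt1.
rewrite -[1](ns_mu (ns P)) /x_defect -{1}(prednK g0) -{1}(prednK d0) !exprS.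
by ring.
Qed.

Lemma clos_x_defect : clos x_defect.
Proof.
apply: closD; last apply: closN.
  apply: closM => //; apply: closD; apply: closM; try exact: clos_x1.
  - exact/closX/clos_y.
  - exact: clos_x.
  - exact/closX/clos_y1.
apply: closM; last exact: clos_y.
by apply: closM => //; exact/closX/clos_x1.
Qed.

(** Modulo [alpha], the equation for [x] is [x ^+ q * y ^+ (q ^ 2) = -1]: higher
    powers of [x] can be eliminated at the cost of a smaller error. *)
Lemma clos_xq : exists2 E, clos E & forall P,
  x P ^+ q = - w P ^+ (q ^ 2) + alpha * E P.
Proof.
exists (fun P => (y1 P)^-1 * x_defect P +
  w P ^+ (q ^ 2) * (y1_defect P * (1 + alpha * y1_defect P)^-1)).
  apply: closD; first by apply: closM; [exact: clos_y1V|exact: clos_x_defect].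
  apply: closM; first exact/closX/clos_w.
  by apply: closM; [exact: clos_y1_defect|exact/clos_inv/clos_y1_defect].
move=> P; have y10 := val_unit_neq0 (vy1 P).
have -> : x P ^+ q = - (1 - alpha * x_defect P) * (y1 P)^-1.
  by rewrite -x_defectE mulfK.
have d0 : 1 + alpha * y1_defect P != 0.
  apply: contraNneq y10 => E; by rewrite y1_defectE E mulr0.
by rewrite y1_invE; field.
Qed.

Let clos_invM s (t : T -> K) f : clos s -> clos t ->
  (forall P, f P * t P = 1 + alpha * s P) -> (forall P, v (f P) = 0%E) ->
  clos (fun P => (f P)^-1).
Proof.
move=> sc tc fE vf; have := closM tc (clos_inv sc).
move=> h n; apply: gen_approx_ext (h n) => P.
have f0 := val_unit_neq0 (vf P); have s0 Q : (0 <= v (s Q))%E.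
  exact: (gen_approx_ge0 e_gt0 vx vy yw (sc 0%N)).
have u0 : 1 + alpha * s P != 0.
  by apply: val_unit_neq0 (one_plus_unit va e_gt0 P s0).
by apply: (mulfI f0); rewrite mulrA fE !divff.
Qed.

Lemma clos_xV : clos (fun P => (x P)^-1).
Proof.
apply: (clos_invM (s := fun P => - x_defect P) (t := fun P => - (x P ^+ q.-1 * y1 P))).
- exact/closN/clos_x_defect.
- apply/closN/closM; [exact/closX/clos_x|exact: clos_y1].
- by move=> P; rewrite mulrN mulrA -exprS prednK // x_defectE opprK mulrN.
- exact: vx.
Qed.

Let inv_cancel f n P : v (f P) = 0%E -> f P ^+ n * (f P)^-1 ^+ n = 1.
Proof. by move=> vf; rewrite -exprMn divff ?expr1n // (val_unit_neq0 vf). Qed.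

Lemma clos_x1V : clos (fun P => (x1 P)^-1).
Proof.
have [_ _ ux0 px0 _] := exp_gt0 q_gt1.
apply: (clos_invM (s := fun P => (x P)^-1 ^+ (q ^ 2) *
   (alpha ^+ (exp_ux q).-1 * u P * x P ^+ q + rh * alpha ^+ (exp_px q).-1 * x P))
   (t := fun P => (x P)^-1 ^+ (q ^ 2))).
- apply: closM; first exact/closX/clos_xV.
  apply: closD; last by apply: closM; [apply: closM => //; exact: clos_cst|exact: clos_x].
  by do !apply: closM => //; [exact: clos_u|exact/closX/clos_x].
- exact/closX/clos_xV.
- move=> P; rewrite (ns_x1 (ns P)) -(prednK ux0) -(prednK px0) !exprS /=.
  by rewrite !mulrDl inv_cancel //; ring.
- exact: vx1.
Qed.

Lemma clos_uV : clos (fun P => (u P)^-1).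
Proof.
have [_ _ _ _ [pu0 _ _]] := exp_gt0 q_gt1.
apply: (clos_invM (s := fun P => rh * alpha ^+ (exp_pu q).-1 * y1 P * (y1 P)^-1 ^+ (q ^ 2))
   (t := fun P => - (y1 P ^+ q * (y1 P)^-1 ^+ (q ^ 2)))).
- apply: closM; last exact/closX/clos_y1V.
  by apply: closM; [apply: closM => //; exact: clos_cst|exact: clos_y1].
- by apply/closN/closM; [exact/closX/clos_y1|exact/closX/clos_y1V].
- move=> P; have := ns_u (ns P); rewrite -(prednK pu0) exprS => E.
  have -> : u P * - (y1 P ^+ q * (y1 P)^-1 ^+ (q ^ 2)) =
    - (u P * y1 P ^+ q) * (y1 P)^-1 ^+ (q ^ 2) by ring.
  have -> : - (u P * y1 P ^+ q) = y1 P ^+ (q ^ 2) + rh * (alpha * alpha ^+ (exp_pu q).-1) * y1 P.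
    by apply/eqP; rewrite -subr_eq0 -oppr_eq0 -E; apply/eqP; ring.
  by rewrite mulrDl inv_cancel //; ring.
- exact: vu.
Qed.

End SystemClosure.

(** * Normal forms of affinoid functions *)

Section NormalForms.
Variables (R : realType) (K : fieldType) (v : valuation R K) (T : Type).
Variables (alpha : K) (e : R).
Hypotheses (va : v alpha = e%:E) (e_gt0 : 0 < e).
Variable q : nat.
Hypothesis q_gt1 : (1 < q)%N.
Variables (x y w : T -> K).
Hypotheses (vx : forall P, v (x P) = 0%E) (vy : forall P, v (y P) = 0%E).
Hypothesis yw : forall P, y P * w P = 1.
Implicit Types (f g h s : T -> K).

Local Notation clos := (gen_closure v e x y w).

Variable E : T -> K.
Hypothesis closE : clos E.
Hypothesis xqE : forall P, x P ^+ q = - w P ^+ (q ^ 2) + alpha * E P.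

Let q_gt0 : (0 < q)%N. Proof. exact: ltnW. Qed.
Let va0 : (0 <= v alpha)%E. Proof. by rewrite va lee_fin ltW. Qed.

Definition monomial c i j l P := c * x P ^+ i * y P ^+ j * w P ^+ l.

(** Degrees less than [q] in [x] suffice; after passing from [x] to [Z_1], such
    monomials are independent on the reduction. *)
Inductive normal_form : (T -> K) -> Prop :=
| nf0 : normal_form (fun=> 0)
| nf_add c i j l f : (0 <= v c)%E -> (i < q)%N -> normal_form f ->
    normal_form (fun P => f P + monomial c i j l P).

Let closM f g : clos f -> clos g -> clos (fun P => f P * g P).
Proof. by move=> fc gc n; apply: gen_approxM. Qed.

Let closD f g : clos f -> clos g -> clos (fun P => f P + g P).
Proof. by move=> fc gc n; apply: gen_approxD. Qed.

Let closX f m : clos f -> clos (fun P => f P ^+ m).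
Proof. by move=> fc n; apply: gen_approxX. Qed.

Let clos_cst c : (0 <= v c)%E -> clos (fun=> c).
Proof. by move=> c0 n; apply: gen_approx_cst. Qed.

Lemma clos_monomial c i j l : (0 <= v c)%E -> clos (monomial c i j l).
Proof.
move=> c0; do !apply: closM; first exact: clos_cst.
- by apply: closX => n; exact/gen_approx_gen/gen_x.
- by apply: closX => n; exact/gen_approx_gen/gen_y.
- by apply: closX => n; exact/gen_approx_gen/gen_w.
Qed.

Lemma clos_normal_form f : normal_form f -> clos f.
Proof.
elim=> [|c i j l {}f c0 _ _ IH]; first by apply: clos_cst; rewrite val0 leey.
by apply: closD => //; exact: clos_monomial.
Qed.

Lemma normal_formD f g : normal_form f -> normal_form g ->
  exists2 h, normal_form h & forall P, h P = f P + g P.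
Proof.
move=> fn; elim=> [|c i j l {}g c0 iq _ [h hn hE]].
  by exists f => // P; rewrite addr0.
exists (fun P => h P + monomial c i j l P); first exact: nf_add.
by move=> P; rewrite hE addrA.
Qed.

Lemma normal_formZ a f : (0 <= v a)%E -> normal_form f ->
  exists2 h, normal_form h & forall P, h P = a * f P.
Proof.
move=> a0; elim=> [|c i j l {}f c0 iq _ [h hn hE]].
  by exists (fun=> 0); [exact: nf0|move=> P; rewrite mulr0].
exists (fun P => h P + monomial (a * c) i j l P).
  by apply: nf_add => //; exact: val_ge0M.
by move=> P; rewrite hE mulrDr /monomial !mulrA.
Qed.

(** One step of the division by [x ^+ q + w ^+ (q ^ 2)], whose remainder is
    only known up to a multiple of [alpha]. *)
Definition reducible f := exists n b, [/\ normal_form n, clos b &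
  forall P, f P = n P + alpha * b P].

Let reducible_ext f g : f =1 g -> reducible f -> reducible g.
Proof. by move=> fg [n [b [nn bc fE]]]; exists n, b; split=> // P; rewrite -fg. Qed.

Lemma reducible_normal_form f : normal_form f -> reducible f.
Proof.
exists f, (fun=> 0); split=> //; first by apply: clos_cst; rewrite val0 leey.
by move=> P; rewrite mulr0 addr0.
Qed.

Lemma reducible_alpha f : clos f -> reducible (fun P => alpha * f P).
Proof. by exists (fun=> 0), f; split=> [|//|P]; [exact: nf0|rewrite add0r]. Qed.

Lemma reducibleD f g : reducible f -> reducible g -> reducible (fun P => f P + g P).
Proof.
move=> [n [b [nn bc fE]]] [n' [b' [nn' bc' gE]]].
have [h hn hE] := normal_formD nn nn'.
exists h, (fun P => b P + b' P); split=> //; first exact: closD.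
by move=> P; rewrite hE fE gE; ring.
Qed.

Lemma reducible_monomial c i j l : (0 <= v c)%E -> (i < q + q)%N ->
  reducible (monomial c i j l).
Proof.
have low c' i' j' l' : (0 <= v c')%E -> (i' < q)%N -> reducible (monomial c' i' j' l').
  move=> c0 iq; apply: (@reducible_ext (fun P => 0 + monomial c' i' j' l' P)).
    by move=> P; rewrite add0r.
  by apply: reducible_normal_form; apply: nf_add => //; exact: nf0.
move=> c0; have [iq _|qi iqq] := ltnP i q; first exact: low.
apply: (@reducible_ext (fun P => monomial (- c) (i - q) j (l + q ^ 2) P +
    alpha * (E P * monomial c (i - q) j l P))).
  move=> P; rewrite /monomial -{3}(subnK qi) !exprD xqE; ring.
apply: reducibleD; last by apply: reducible_alpha; apply: closM => //; exact: clos_monomial.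
by apply: low; rewrite ?valN // ltn_subLR.
Qed.

Lemma reducible_mul_normal f g : normal_form f -> normal_form g ->
  reducible (fun P => f P * g P).
Proof.
move=> fn; elim=> [|c' i' j' l' {}g c'0 i'q gn IH].
  apply: (@reducible_ext (fun=> 0)) => [P|]; first by rewrite mulr0.
  exact/reducible_normal_form/nf0.
apply: (@reducible_ext (fun P => f P * g P + f P * monomial c' i' j' l' P)).
  by move=> P; rewrite mulrDr.
apply: reducibleD => // {IH gn}.
elim: fn => [|c i j l {}f c0 iq fn IH].
  apply: (@reducible_ext (fun=> 0)) => [P|]; first by rewrite mul0r.
  exact/reducible_normal_form/nf0.
apply: (@reducible_ext (fun P => f P * monomial c' i' j' l' P +
    monomial (c * c') (i + i') (j + j') (l + l') P)).
  by move=> P; rewrite /monomial !exprD; ring.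
apply: reducibleD => //; apply: reducible_monomial; first exact: val_ge0M.
by rewrite -addSn leq_add // ltnW.
Qed.

Lemma reducibleM f g : reducible f -> reducible g -> reducible (fun P => f P * g P).
Proof.
move=> [n [b [nn bc fE]]] [n' [b' [nn' bc' gE]]].
apply: (@reducible_ext (fun P => n P * n' P +
    alpha * (n P * b' P + b P * n' P + alpha * (b P * b' P)))).
  by move=> P; rewrite fE gE; ring.
apply: reducibleD; first exact: reducible_mul_normal.
apply: reducible_alpha; have nc := clos_normal_form nn; have nc' := clos_normal_form nn'.
by do ?apply: closD; do ?apply: closM => //; exact: clos_cst.
Qed.

Lemma gen_reducible f : gen v x y w f -> reducible f.
Proof.
have mono c i j l g : (0 <= v c)%E -> (i < q)%N ->
    (forall P, monomial c i j l P = g P) -> reducible g.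
  move=> c0 iq gE; apply: reducible_ext gE _; apply: reducible_monomial => //.
  exact: ltn_addl.
have v1 : (0 <= v 1%R)%E by rewrite val1.
elim=> [c c0||||{}f g _ Hf _ Hg|{}f g _ Hf _ Hg].
- by apply: (mono c 0%N 0%N 0%N) => // P; rewrite /monomial !mulr1.
- by apply: (mono 1 1%N 0%N 0%N) => // P; rewrite /monomial mul1r !mulr1.
- by apply: (mono 1 0%N 1%N 0%N) => // P; rewrite /monomial !mul1r !mulr1.
- by apply: (mono 1 0%N 0%N 1%N) => // P; rewrite /monomial !mul1r.
- exact: reducibleD.
- exact: reducibleM.
Qed.

(** Reducing again the cofactor of [alpha] improves the precision. *)
Lemma gen_normal_approx k f : gen v x y w f ->
  exists2 n, normal_form n & forall P, ((e *+ k)%:E <= v (f P - n P)%R)%E.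
Proof.
elim: k f => [|k IH] f fg.
  exists (fun=> 0); first exact: nf0.
  by move=> P; rewrite subr0 mulr0n; apply: gen_ge0 yw _ fg P.
have [n [b [nn bc fE]]] := gen_reducible fg.
have [h hg bh] := bc k; have [n' nn' hn'] := IH h hg.
have [m mn mE] := normal_formZ va0 nn'; have [r rn rE] := normal_formD nn mn.
exists r => // P; rewrite rE mE fE.
have -> : n P + alpha * b P - (n P + alpha * n' P) =
  alpha * ((b P - h P) + (h P - n' P)) by ring.
by rewrite mulrS; apply: val_ge_mul; [rewrite va|apply: val_ge_add].
Qed.

Lemma clos_normal_approx M f : clos f ->
  exists2 n, normal_form n & forall P, (M%:E <= v (f P - n P)%R)%E.
Proof.
move=> fc; pose k := Num.bound (`|M| / e).
have Mk : M <= e *+ k.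
  rewrite -mulr_natl -ler_pdivrMr //; apply: ltW.
  apply: le_lt_trans (archi_boundP _); last by rewrite divr_ge0 // ltW.
  by rewrite ler_pM2r ?invr_gt0 // ler_norm.
have [h hg fh] := fc k; have [n nn hn] := gen_normal_approx k hg.
exists n => // P; rewrite -(subrKA (h P)); apply: (val_ge_trans Mk).
exact: val_ge_add.
Qed.

Section ChangeOfVariable.
Variables (z : T -> K) (A B : {poly K}) (M : nat).
Hypothesis xz : forall P, x P = (A.[y P] * z P + B.[y P]) * w P ^+ M.

Definition z_form h := exists (p : {poly {poly K}}) N, (size p <= q)%N /\
  forall P, h P = p.[(z P)%:P].[y P] * w P ^+ N.

Lemma z_formD f g : z_form f -> z_form g -> z_form (fun P => f P + g P).
Proof.
move=> [p [N [sp fE]]] [r [N' [sr gE]]].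
exists ('X^N' *: p + 'X^N *: r), (N + N')%N; split=> [|P].
  rewrite (leq_trans (size_polyD _ _)) // geq_max.
  by rewrite !(leq_trans (size_scale_leq _ _)).
have ywn n : y P ^+ n * w P ^+ n = 1 by rewrite -exprMn yw expr1n.
rewrite !hornerE fE gE exprD.
rewrite -[w P ^+ N in LHS]mulr1 -[w P ^+ N' in LHS]mulr1 -{1}(ywn N') -(ywn N).
by ring.
Qed.

Lemma z_formZ c f : z_form f -> z_form (fun P => c * f P).
Proof.
move=> [p [N [sp fE]]]; exists (c%:P *: p), N; split=> [|P].
  by rewrite (leq_trans (size_scale_leq _ _)).
by rewrite !hornerE fE mulrA.
Qed.

(** Since [x] is affine in [z], monomials of degree less than [q] in [x] have
    degree less than [q] in [z]. *)
Lemma z_form_monomial c i j l : (i < q)%N -> z_form (monomial c i j l).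
Proof.
move=> iq; exists ((c *: 'X^j)%:P * (A%:P * 'X + B%:P) ^+ i), (M * i + l)%N; split=> [|P].
  have sC (a : {poly K}) : (size (a%:P : {poly {poly K}}) <= 1)%N.
    exact: size_polyC_leq1.
  set L := _ + B%:P; have s1 : (size L <= 2)%N.
    rewrite (leq_trans (size_polyD _ _)) // geq_max (leq_trans (sC B)) // andbT.
    rewrite (leq_trans (size_polyMleq _ _)) // size_polyX addn2 /= ltnS.
    exact: sC.
  have s2 : (size (L ^+ i) <= i.+1)%N.
    apply: leq_trans (size_poly_exp_leq _ _) _; rewrite ltnS -[X in (_ <= X)%N]mul1n.
    by rewrite leq_mul2r -subn1 leq_subLR s1 orbT.
  apply: leq_trans iq; rewrite (leq_trans (size_polyMleq _ _)) //.
  by rewrite -subn1 leq_subLR (leq_trans (leq_add (sC _) s2)).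
rewrite !hornerE /monomial xz exprMn -exprM exprD.
by ring.
Qed.

Lemma normal_form_z f : normal_form f -> z_form f.
Proof.
elim=> [|c i j l {}f c0 iq _ IH].
  by exists 0, 0%N; split=> [|P]; rewrite ?size_poly0 ?hornerE.
by apply: z_formD => //; exact: z_form_monomial.
Qed.

Definition z_approx f := forall N : R,
  exists2 h, z_form h & forall P, (N%:E <= v (f P - h P)%R)%E.

Lemma clos_z_approx f : clos f -> z_approx f.
Proof.
move=> fc N; have [n /normal_form_z nz fn] := clos_normal_approx N fc.
by exists n.
Qed.

Lemma z_approxD f g : z_approx f -> z_approx g -> z_approx (fun P => f P + g P).
Proof.
move=> fa ga N; have [[h hz fh] [h' hz' gh]] := (fa N, ga N).
exists (fun P => h P + h' P); first exact: z_formD.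
by move=> P; rewrite opprD addrACA; apply: val_ge_add.
Qed.

Lemma z_approxZ c f : z_approx f -> z_approx (fun P => c * f P).
Proof.
move=> fa N; have [r cr] := val_lb v c; have [h hz fh] := fa (N - r).
exists (fun P => c * h P); first exact: z_formZ.
by move=> P; rewrite -mulrBr -[N](subrK r) addrC; apply: val_ge_mul.
Qed.

(** The coordinates being integral, convergence for the Gauss norm is uniform
    on points; and monomials in the coordinates lie in the closure. *)
Lemma affinoid_z_approx n (t : 'I_n -> T -> K) f :
  (forall k, clos (t k)) -> affinoid_fun v t f -> z_approx f.
Proof.
move=> tc [G Gc Gf] N.
have t0 k P : (0 <= v (t k P))%E by exact: (gen_approx_ge0 e_gt0 vx vy yw (tc k 0%N)).
have [i Gi] := Gc N.
have prod_clos (m : 'X_{1..n}) : clos (fun P => \prod_(k < n) t k P ^+ m k).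
  rewrite (_ : (fun P => _) = (fun P => \prod_(k <- enum 'I_n) t k P ^+ m k)); last first.
    by apply: funext => P; rewrite big_enum.
  elim: (enum 'I_n) => [|k s IH].
    rewrite (_ : (fun P => _) = (fun=> 1)); last by apply: funext => P; rewrite big_nil.
    by apply: clos_cst; rewrite val1.
  rewrite (_ : (fun P => _) = (fun P => t k P ^+ m k * \prod_(k <- s) t k P ^+ m k)).
    by apply: closM => //; exact/closX/tc.
  by apply: funext => P; rewrite big_cons.
have Ga : z_approx (fun P => (G i).@[fun k => t k P]).
  rewrite (_ : (fun P => _) = (fun P => \sum_(m <- msupp (G i))
      (G i)@_m * \prod_(k < n) t k P ^+ m k)); last first.
    by apply: funext => P; rewrite mevalE.
  elim: (msupp (G i) : seq _) => [|m s IH].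
    rewrite (_ : (fun P => _) = (fun=> 0)); last by apply: funext => P; rewrite big_nil.
    by apply: clos_z_approx; apply: clos_cst; rewrite val0 leey.
  rewrite (_ : (fun P => _) = (fun P => (G i)@_m * \prod_(k < n) t k P ^+ m k +
      \sum_(m <- s) (G i)@_m * \prod_(k < n) t k P ^+ m k)).
    by apply: z_approxD => //; apply: z_approxZ; exact/clos_z_approx.
  by apply: funext => P; rewrite big_cons.
have [h hz Gh] := Ga N; exists h => // P.
rewrite -(subrKA (G i).@[fun k => t k P]); apply: val_ge_add; last exact: Gh.
have [i' fi'] := Gf P N; pose m := maxn i i'.
rewrite -(subrKA (G m).@[fun k => t k P]); apply: val_ge_add.
  by rewrite valB; apply: fi'; exact: leq_maxr.
rewrite -mevalB mevalE; apply: val_ge_sum => a _.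
apply: val_ge_mul0; first by apply: Gi; [exact: leq_maxl|exact: leqnn].
exact: (gen_approx_ge0 e_gt0 vx vy yw (prod_clos a 0%N)).
Qed.

End ChangeOfVariable.
End NormalForms.

(** * Evaluation in the reduction *)

Lemma mpoly_monomialM (k : comNzRingType) m (c d : k) (a b : 'X_{1..m}) :
  (c *: 'X_[a]) * (d *: 'X_[b]) = (c * d) *: 'X_[a + b] :> {mpoly k[m]}.
Proof. by rewrite -!mul_mpolyC mulrACA -mpolyCM -mpolyXD. Qed.

Section ReductionEvaluation.
Variables (R : realType) (K : fieldType) (v : valuation R K).
Variables (T : Type) (n : nat) (t : 'I_n -> T -> K).
Variables (m : nat) (h : 'I_m -> reduction v t).
Local Notation k := (residue_field v).
Implicit Types (G H : {mpoly k[m]}).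

Let mon (a : 'X_{1..m}) : reduction v t := \prod_(l < m) h l ^+ a l.

(** Sums over a common support make additivity visible. *)
Lemma red_eval_wide G (s : seq 'X_{1..m}) : uniq s -> {subset msupp G <= s} ->
  red_eval h G = \sum_(a <- s) red_cst t G@_a * mon a.
Proof.
move=> us Gs; rewrite (bigID (fun a => a \in msupp G)) /= [X in _ + X]big1 ?addr0.
  rewrite -big_filter; apply: perm_big; apply: uniq_perm.
  - exact: msupp_uniq.
  - exact: filter_uniq.
  - by move=> a; rewrite mem_filter andbC; have [/Gs ->|] := boolP (a \in msupp G); rewrite ?andbF.
by move=> a aG; rewrite memN_msupp_eq0 // rmorph0 mul0r.
Qed.

Lemma red_evalD G H : red_eval h (G + H) = red_eval h G + red_eval h H.
Proof.
pose s := undup (msupp G ++ msupp H).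
have us : uniq s by exact: undup_uniq.
have Gs : {subset msupp G <= s} by move=> a aG; rewrite mem_undup mem_cat aG.
have Hs : {subset msupp H <= s} by move=> a aH; rewrite mem_undup mem_cat aH orbT.
have GHs : {subset msupp (G + H) <= s} by move=> a /msuppD_le; rewrite mem_undup.
rewrite (red_eval_wide us Gs) (red_eval_wide us Hs) (red_eval_wide us GHs).
by rewrite -big_split; apply: eq_bigr => a _; rewrite mcoeffD rmorphD mulrDl.
Qed.

Lemma red_eval_term (c : k) (a : 'X_{1..m}) :
  red_eval h (c *: 'X_[a]) = red_cst t c * mon a.
Proof.
rewrite (@red_eval_wide _ [:: a]) => [|//|b].
  by rewrite big_seq1 mcoeffZ mcoeffX eqxx mulr1.
rewrite mcoeff_msupp mcoeffZ mcoeffX inE [b == a]eq_sym.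
by case: (a == b) => //; rewrite mulr0 eqxx.
Qed.

Lemma monD a b : mon (a + b) = mon a * mon b.
Proof. by rewrite -big_split; apply: eq_bigr => l _; rewrite mnmDE exprD. Qed.

Lemma red_eval0 : red_eval h 0 = 0.
Proof. by rewrite /red_eval msupp0 big_nil. Qed.

Lemma red_evalM G H : red_eval h (G * H) = red_eval h G * red_eval h H.
Proof.
elim/mpolyind: G => [|c a G _ _ IH]; first by rewrite mul0r red_eval0 mul0r.
rewrite mulrDl !red_evalD mulrDl IH; congr (_ + _) => {IH}.
elim/mpolyind: H => [|d b H _ _ IH']; first by rewrite mulr0 red_eval0 mulr0.
rewrite mulrDr !red_evalD mulrDr IH'; congr (_ + _).
have -> : c *: 'X_[a] * (d *: 'X_[b]) = (c * d) *: 'X_[a + b] :> {mpoly k[m]}.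
  exact: mpoly_monomialM.
rewrite (red_eval_term (c * d)) (red_eval_term c) (red_eval_term d) rmorphM monD.
exact: mulrACA.
Qed.

Lemma red_eval_zmod_morphism : zmod_morphism (red_eval h).
Proof.
by move=> G H; apply/eqP; rewrite eq_sym subr_eq -red_evalD subrK.
Qed.

Lemma red_evalC (c : k) : red_eval h c%:MP = red_cst t c.
Proof.
rewrite -[c%:MP]mulr1 mul_mpolyC -mpolyX0 red_eval_term /mon big1 ?mulr1 // => l _.
by rewrite mnm0E expr0.
Qed.

Lemma red_eval_monoid_morphism : monoid_morphism (red_eval h).
Proof. by split; [rewrite -mpolyC1 red_evalC rmorph1|exact: red_evalM]. Qed.

HB.instance Definition _ :=
  GRing.isZmodMorphism.Build {mpoly k[m]} (reduction v t) (red_eval h) red_eval_zmod_morphism.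
HB.instance Definition _ :=
  GRing.isMonoidMorphism.Build {mpoly k[m]} (reduction v t) (red_eval h) red_eval_monoid_morphism.

Lemma red_evalX l : red_eval h 'X_l = h l.
Proof.
rewrite -[X in red_eval h X]scale1r red_eval_term rmorph1 mul1r /mon (bigD1 l) //=.
rewrite big1 => [|l' /negPf ll']; first by rewrite mnm1E eqxx expr1 mulr1.
by rewrite mnm1E eq_sym ll' expr0.
Qed.

Lemma red_pt_cst P (c : k) : red_pt P (red_cst t c) = c.
Proof.
by rewrite /red_cst red_ptE /res /= valKd reprK.
Qed.

Lemma red_pt_eval P G : red_pt P (red_eval h G) = G.@[fun l => red_pt P (h l)].
Proof.
rewrite mevalE rmorph_sum; apply: eq_bigr => a _.
rewrite rmorphM /= red_pt_cst rmorph_prod; congr (_ * _).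
by apply: eq_bigr => l _; rewrite rmorphXn.
Qed.

End ReductionEvaluation.

(** * The ideal of the reduced curve *)

Section CurveIdeal.
Variables (k : fieldType) (q D : nat).
Hypothesis q_gt0 : (0 < q)%N.
Local Notation Y := ('X_(@Ordinal 3 0 isT) : {mpoly k[3]}).
Local Notation W := ('X_(@Ordinal 3 1 isT) : {mpoly k[3]}).
Local Notation Z := ('X_(@Ordinal 3 2 isT) : {mpoly k[3]}).
Implicit Types (G H : {mpoly k[3]}) (p : {poly {poly k}}).

Definition curve_ideal G := exists A B,
  G = A * (Y * W - 1) + B * (Z ^+ q + W ^+ D + Y ^+ D).

Lemma curve_idealD G H : curve_ideal G -> curve_ideal H -> curve_ideal (G + H).
Proof. by move=> [A [B ->]] [A' [B' ->]]; exists (A + A'), (B + B'); ring. Qed.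

Lemma curve_idealM H G : curve_ideal G -> curve_ideal (H * G).
Proof. by move=> [A [B ->]]; exists (H * A), (H * B); ring. Qed.

Lemma curve_ideal0 : curve_ideal 0.
Proof. by exists 0, 0; rewrite !mul0r addr0. Qed.

Lemma curve_ideal_YW : curve_ideal (Y * W - 1).
Proof. by exists 1, 0; rewrite mul1r mul0r addr0. Qed.

Lemma curve_ideal_YWX n : curve_ideal (Y ^+ n * W ^+ n - 1).
Proof.
by rewrite -exprMn subrX1 mulrC; apply: curve_idealM; exact: curve_ideal_YW.
Qed.

(** The equation of the curve multiplied by [Y ^+ D], free of [W]. *)
Lemma curve_ideal_rel : curve_ideal (Y ^+ D * Z ^+ q + 1 + Y ^+ D * Y ^+ D).
Proof.
have -> : Y ^+ D * Z ^+ q + 1 + Y ^+ D * Y ^+ D =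
  Y ^+ D * (Z ^+ q + W ^+ D + Y ^+ D) + (-1) * (Y ^+ D * W ^+ D - 1) by ring.
apply: curve_idealD; last by apply: curve_idealM; exact: curve_ideal_YWX.
by apply: curve_idealM; exists 0, 1; rewrite mul0r mul1r add0r.
Qed.

Lemma curve_ideal_cancel n G : curve_ideal (Y ^+ n * G) -> curve_ideal G.
Proof.
move=> IG; have -> : G = W ^+ n * (Y ^+ n * G) + (- G) * (Y ^+ n * W ^+ n - 1) by ring.
by apply: curve_idealD; apply: curve_idealM => //; exact: curve_ideal_YWX.
Qed.

Definition poly_y (r : {poly k}) : {mpoly k[3]} :=
  (horner_eval Y \o map_poly (@mpolyC 3 k)) r.

Definition poly_yz p : {mpoly k[3]} :=
  (map_poly (horner_eval Y \o map_poly (@mpolyC 3 k)) p).[Z].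

Lemma poly_yM r s : poly_y (r * s) = poly_y r * poly_y s.
Proof. exact: rmorphM. Qed.

Lemma poly_yX n : poly_y 'X^n = Y ^+ n.
Proof. by rewrite /poly_y /= map_polyXn horner_evalE hornerXn. Qed.

Lemma poly_yD r s : poly_y (r + s) = poly_y r + poly_y s.
Proof. exact: rmorphD. Qed.

Lemma poly_yC c : poly_y c%:P = c%:MP.
Proof. by rewrite /poly_y /= map_polyC horner_evalE hornerC. Qed.

Lemma poly_yzD p r : poly_yz (p + r) = poly_yz p + poly_yz r.
Proof. by rewrite /poly_yz rmorphD hornerD. Qed.

Lemma poly_yzN p : poly_yz (- p) = - poly_yz p.
Proof. by rewrite /poly_yz rmorphN hornerN. Qed.

Lemma poly_yzM p r : poly_yz (p * r) = poly_yz p * poly_yz r.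
Proof. by rewrite /poly_yz rmorphM hornerM. Qed.

Lemma poly_yzC r : poly_yz r%:P = poly_y r.
Proof. by rewrite /poly_yz map_polyC hornerC. Qed.

Lemma poly_yzX n : poly_yz 'X^n = Z ^+ n.
Proof. by rewrite /poly_yz map_polyXn hornerXn. Qed.

Lemma curve_ideal_null_form n G : curve_ideal (Y ^+ n * G - poly_yz 0) -> curve_ideal G.
Proof. by rewrite /poly_yz rmorph0 horner0 subr0; exact: curve_ideal_cancel. Qed.

Lemma poly_yz_eval p (g : 'I_3 -> k) :
  (poly_yz p).@[g] = p.[(g (@Ordinal 3 2 isT))%:P].[g (@Ordinal 3 0 isT)].
Proof.
have yE r : (poly_y r).@[g] = r.[g (@Ordinal 3 0 isT)].
  elim/poly_ind: r => [|r c IH].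
    by rewrite -[0]/(0%:P : {poly k}) poly_yC mevalC hornerC.
  rewrite poly_yD poly_yM -['X]expr1 poly_yX poly_yC mevalD mevalM IH mevalC.
  by rewrite !expr1 mevalXU !hornerE.
elim/poly_ind: p => [|p r IH].
  by rewrite -[0]/(0%:P%:P : {poly {poly k}}) poly_yzC poly_yC mevalC !hornerC.
rewrite poly_yzD poly_yzM -['X]expr1 poly_yzX poly_yzC mevalD mevalM IH yE.
by rewrite !expr1 mevalXU !hornerE.
Qed.

(** Normal forms modulo the ideal: a power of [Y] clears the denominators, so
    that one may compute in [k[Y][Z]]. *)
Definition curve_reducible G := exists N p,
  (size p <= q)%N /\ curve_ideal (Y ^+ N * G - poly_yz p).

Lemma curve_reducible0 : curve_reducible 0.
Proof.
exists 0%N, 0; rewrite size_poly0; split=> //.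
rewrite mulr0 /poly_yz rmorph0 horner0 subr0; exact: curve_ideal0.
Qed.

Lemma curve_reducibleD G H : curve_reducible G -> curve_reducible H ->
  curve_reducible (G + H).
Proof.
move=> [N [p [sp Ip]]] [M [r [sr Ir]]].
exists (N + M)%N, ('X^M%:P * p + 'X^N%:P * r); split.
  rewrite (leq_trans (size_polyD _ _)) // geq_max !mul_polyC.
  by rewrite !(leq_trans (size_scale_leq _ _)).
rewrite poly_yzD !poly_yzM !poly_yzC !poly_yX exprD.
have -> : Y ^+ N * Y ^+ M * (G + H) - (Y ^+ M * poly_yz p + Y ^+ N * poly_yz r) =
  Y ^+ M * (Y ^+ N * G - poly_yz p) + Y ^+ N * (Y ^+ M * H - poly_yz r) by ring.
by apply: curve_idealD; exact: curve_idealM.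
Qed.

Lemma curve_reducibleC c G : curve_reducible G -> curve_reducible (c%:MP * G).
Proof.
move=> [N [p [sp Ip]]]; exists N, (c%:P%:P * p); split.
  by rewrite mul_polyC (leq_trans (size_scale_leq _ _)).
rewrite poly_yzM poly_yzC poly_yC.
have -> : Y ^+ N * (c%:MP * G) - c%:MP * poly_yz p =
  c%:MP * (Y ^+ N * G - poly_yz p) by ring.
exact: curve_idealM.
Qed.

Lemma curve_reducibleY G : curve_reducible G -> curve_reducible (Y * G).
Proof.
move=> [N [p [sp Ip]]]; exists N, ('X^1%:P * p); split.
  by rewrite mul_polyC (leq_trans (size_scale_leq _ _)).
rewrite poly_yzM poly_yzC poly_yX expr1.
have -> : Y ^+ N * (Y * G) - Y * poly_yz p = Y * (Y ^+ N * G - poly_yz p) by ring.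
exact: curve_idealM.
Qed.

Lemma curve_reducibleW G : curve_reducible G -> curve_reducible (W * G).
Proof.
move=> [N [p [sp Ip]]]; exists N.+1, p; split=> //.
have -> : Y ^+ N.+1 * (W * G) - poly_yz p =
  (Y ^+ N * G) * (Y * W - 1) + (Y ^+ N * G - poly_yz p) by rewrite exprS; ring.
by apply: curve_idealD => //; apply: curve_idealM; exact: curve_ideal_YW.
Qed.

(** The leading term [c Z ^+ q.-1] becomes [c Z ^+ q], which the equation of
    the curve, multiplied by [Y ^+ D], lowers to degree 0 in [Z]. *)
Lemma curve_reducibleZ G : curve_reducible G -> curve_reducible (Z * G).
Proof.
move=> [N [p [sp Ip]]].
pose p0 := \poly_(i < q.-1) p`_i; pose c := p`_q.-1.
have pE : p = p0 + c%:P * 'X^(q.-1).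
  apply/polyP => i; rewrite coefD coef_poly coefCM coefXn.
  have [iq|qi] := ltnP i q.-1; first by rewrite ltn_eqF // mulr0 addr0.
  have [->|iq] := eqVneq i q.-1; first by rewrite mulr1 add0r.
  rewrite mulr0 addr0 nth_default // (leq_trans sp) //.
  by rewrite -(prednK q_gt0) ltn_neqAle eq_sym iq.
exists (N + D)%N, ('X^D%:P * ('X^1 * p0) - (c * (1%:P + 'X^D * 'X^D))%:P); split.
  rewrite (leq_trans (size_polyD _ _)) // geq_max size_polyN; apply/andP; split.
    rewrite mul_polyC (leq_trans (size_scale_leq _ _)) //.
    rewrite (leq_trans (size_polyMleq _ _)) // expr1 size_polyX /=.
    by rewrite -[X in (_ <= X)%N](prednK q_gt0) ltnS size_poly.
  by rewrite (leq_trans (size_polyC_leq1 _)).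
rewrite poly_yzD poly_yzN !poly_yzM !poly_yzC poly_yM poly_yD poly_yM !poly_yX poly_yC.
rewrite poly_yzX expr1 mpolyC1.
have ZpE : poly_yz p = poly_yz p0 + poly_y c * Z ^+ q.-1.
  by rewrite {1}pE poly_yzD poly_yzM poly_yzC poly_yzX.
have Zq : Z * Z ^+ q.-1 = Z ^+ q by rewrite -exprS prednK.
have -> : Y ^+ (N + D) * (Z * G) - (Y ^+ D * (Z * poly_yz p0) -
     poly_y c * (1 + Y ^+ D * Y ^+ D)) =
  Y ^+ D * Z * (Y ^+ N * G - poly_yz p) +
  poly_y c * (Y ^+ D * Z ^+ q + 1 + Y ^+ D * Y ^+ D).
  by rewrite ZpE -Zq exprD; ring.
apply: curve_idealD; apply: curve_idealM => //; exact: curve_ideal_rel.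
Qed.

Lemma curve_reducible_all G : curve_reducible G.
Proof.
have red1 : curve_reducible 1.
  exists 0%N, 1; rewrite size_poly1; split=> //.
  rewrite expr0 mulr1 -[X in poly_yz X]/(1%:P) poly_yzC -[X in poly_y X]/(1%:P) poly_yC.
  by rewrite mpolyC1 subrr; exact: curve_ideal0.
have red_var (l : 'I_3) H : curve_reducible H -> curve_reducible ('X_l * H).
  have [->|->|->] : [\/ l = @Ordinal 3 0 isT, l = @Ordinal 3 1 isT | l = @Ordinal 3 2 isT].
    case: l => -[|[|[|//]]] l3.
    - by apply: Or31; exact: val_inj.
    - by apply: Or32; exact: val_inj.
    - by apply: Or33; exact: val_inj.
  - exact: curve_reducibleY.
  - exact: curve_reducibleW.
  - exact: curve_reducibleZ.
have redX (l : 'I_3) n H : curve_reducible H -> curve_reducible ('X_l ^+ n * H).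
  move=> HH; elim: n => [|n IH]; first by rewrite expr0 mul1r.
  by rewrite exprS -mulrA; exact: red_var.
elim/mpolyind: G => [|c m G _ _ IH]; first exact: curve_reducible0.
apply: curve_reducibleD => //; rewrite -mul_mpolyC; apply: curve_reducibleC.
by rewrite mpolyXE_id; elim/big_rec: _ => // l H _; exact: redX.
Qed.

End CurveIdeal.

(** * Presentation of the reduction *)

Lemma residue_pchar (R : realType) (K : fieldType) (v : valuation R K) q :
  [pchar K].-nat q -> [pchar residue_field v].-nat q.
Proof.
apply: sub_in_pnat => p _; rewrite !inE => /andP[-> /eqP p0] /=.
rewrite -(rmorph_nat (\pi_(residue_field v) : {rmorphism _ -> _})).
by rewrite residue_eq0E rmorph_nat p0 val0 ltry.
Qed.

Lemma horner2_wide (A : comNzRingType) (p : {poly {poly A}}) n N (y z : A) :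
  (size p <= n)%N -> (forall i, size (p`_i)%R <= N)%N ->
  p.[z%:P].[y] = \sum_(i < n) \sum_(j < N) p`_i`_j * y ^+ j * z ^+ i.
Proof.
move=> sp sN; rewrite (horner_coef_wide _ sp) horner_sum; apply: eq_bigr => i _.
rewrite hornerM horner_exp hornerC (horner_coef_wide _ (sN i)) mulr_suml.
by apply: eq_bigr.
Qed.

Lemma poly2_bound (A : nzRingType) (p : {poly {poly A}}) :
  exists N, forall i, (size (p`_i)%R <= N)%N.
Proof.
exists (\max_(i < size p) size (p`_i)%R) => i.
have [isp|spi] := ltnP i (size p); last by rewrite nth_default ?size_poly0.
exact: (leq_bigmax (F := fun i : 'I_(size p) => size (p`_i)%R) (Ordinal isp)).
Qed.

Section Presentation.
Variables (R : realType) (K : fieldType) (v : valuation R K).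
Variables (T : Type) (n : nat) (t : 'I_n -> T -> K) (q : nat).
Hypothesis q_gt1 : (1 < q)%N.
Local Notation k := (residue_field v).
Local Notation D := (q ^ 2 - 1)%N.
Hypothesis k_pchar : [pchar k].-nat q.
Hypothesis k_infinite :
  forall g : {poly k}, g != 0 -> exists2 c, c != 0 & g.[c] != 0.
Variables (y w z : pb_ring v t).
Hypothesis yw : forall P, y P * w P = 1.
Variable delta : R.
Hypothesis delta_gt0 : 0 < delta.
Hypothesis zrel : forall P, (delta%:E <= v (z P ^+ q + w P ^+ D + y P ^+ D)%R)%E.
Hypothesis y_dense : forall c : k, c != 0 -> exists P, res v (y P) = c.
Hypothesis z_dense : forall f, affinoid_fun v t f -> exists (p : {poly {poly K}}) (N : nat), (size p <= q)%N /\
  forall P, (1 <= v (f P - p.[(z P)%:P].[y P] * w P ^+ N)%R)%E.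

Let y0 P : (0 <= v (y P))%E := pb_ge0 y P.
Let w0 P : (0 <= v (w P))%E := pb_ge0 w P.
Let z0 P : (0 <= v (z P))%E := pb_ge0 z P.
Let q_gt0 : (0 < q)%N. Proof. exact: ltnW. Qed.

Let vyw P : v (y P) = 0%E /\ v (w P) = 0%E.
Proof.
have := congr1 v (yw P); rewrite val_M val1.
have yn0 : y P != 0 by have := oner_neq0 K; rewrite -(yw P) mulf_eq0 negb_or => /andP[].
have wn0 : w P != 0 by have := oner_neq0 K; rewrite -(yw P) mulf_eq0 negb_or => /andP[].
have [r vr] := val_fin v yn0; have [s vs] := val_fin v wn0.
have := y0 P; have := w0 P; rewrite vr vs !lee_fin => h1 h2 [] h3.
have -> : r = 0 by apply/eqP; rewrite eq_le h2 andbT -h3 lerDl.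
have -> // : s = 0 by apply/eqP; rewrite eq_le h1 andbT -h3 lerDr.
Qed.

Let res_rel P : res v (z P) ^+ q = - ((res v (y P) ^+ D)^-1 + res v (y P) ^+ D).
Proof.
have [vy vw] := vyw P.
have wE : res v (w P) = (res v (y P))^-1.
  by rewrite -resV //; congr (res v _); apply: (mulfI (val_unit_neq0 vy)); rewrite yw divff ?(val_unit_neq0 vy).
apply/eqP; rewrite -addr_eq0 -exprVn -wE addrA.
rewrite -!resX // -!resD ?val_ge_add ?val_ge0X // res_eq0 ?val_ge_add ?val_ge0X //.
by apply: lt_le_trans (zrel P); rewrite lte_fin.
Qed.

Lemma residual_independence (p : {poly {poly k}}) : (size p <= q)%N ->
  (forall P, p.[(res v (z P))%:P].[res v (y P)] = 0) -> p = 0.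
Proof.
move=> sp p0; apply: (curve_independence q_gt1 k_pchar k_infinite sp) => c c0.
have [P yP] := y_dense c0; exists (res v (z P)); first by rewrite res_rel yP.
by rewrite -yP p0.
Qed.

(** The supremum norm of such a function is the maximum of its coefficients:
    divide [p] by a coefficient of minimal valuation; if this valuation were
    negative, the residue polynomial would vanish at all points although one of
    its coefficients is 1. *)
Lemma integral_coefficients (p : {poly {poly K}}) : (size p <= q)%N ->
  (forall P, 0 <= v (p.[(z P)%:P].[y P])%R)%E -> forall i j, (0 <= v p`_i`_j)%E.
Proof.
move=> sp p0 i j; have [N sN] := poly2_bound p.
have [//|pij] := leP 0%E (v p`_i`_j); exfalso.
have out i' j' : ~~ ((i' < size p)%N && (j' < N)%N) -> p`_i'`_j' = 0.
  rewrite negb_and -!leqNgt => /orP[h|h]; first by rewrite (nth_default 0 h) coef0.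
  by rewrite nth_default // (leq_trans (sN i')).
have pij0 : p`_i`_j != 0 by apply: contraTneq pij => ->; rewrite val0.
have /andP[isp jN] : (i < size p)%N && (j < N)%N.
  by apply: contraNT pij0 => /out ->.
pose a (s : 'I_(size p) * 'I_N) := v p`_(s.1)`_(s.2).
case: (Order.TotalTheory.arg_minP (i0 := (Ordinal isp, Ordinal jN)) (P := predT) a isT).
move=> [i0 j0] _ amin; set c := p`_i0`_j0.
have c_lt0 : (v c < 0)%E by apply: le_lt_trans pij; exact: (amin (Ordinal isp, Ordinal jN)).
have c0 : c != 0 by apply: contraTneq c_lt0 => ->; rewrite val0.
have [r vc] := val_fin v c0; have r0 : r < 0 by rewrite -lte_fin -vc.
have pc i' j' : (0 <= v (p`_i'`_j' / c)%R)%E.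
  have [/andP[h1 h2]|/out->] := boolP ((i' < size p)%N && (j' < N)%N); last first.
    by rewrite mul0r val0 leey.
  have := amin (Ordinal h1, Ordinal h2) isT; rewrite /a /= -/c vc => h.
  have := val_ge_mul h (val_ge_fin (valV_fin vc)).
  by rewrite subrr.
pose pb := \poly_(i' < size p) \poly_(j' < N) res v (p`_i'`_j' / c).
have pbE i' j' : pb`_i'`_j' = res v (p`_i'`_j' / c).
  rewrite coef_poly; case: ifP => hi; last by rewrite coef0 out ?hi // mul0r res0.
  by rewrite coef_poly; case: ifP => hj //; rewrite out ?hi ?hj // mul0r res0.
have spb : (size pb <= size p)%N by exact: size_poly.
have sNpb i' : (size (pb`_i')%R <= N)%N.
  by rewrite coef_poly; case: ifP => _; rewrite ?size_poly0 // size_poly.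
have termE i' j' P : p`_i'`_j' * y P ^+ j' * z P ^+ i' / c =
    p`_i'`_j' / c * y P ^+ j' * z P ^+ i' by ring.
have term0 i' j' P : (0 <= v (p`_i'`_j' * y P ^+ j' * z P ^+ i' / c)%R)%E.
  by rewrite termE; do 2?apply: val_ge0M; rewrite ?val_ge0X.
have pb0 : pb = 0.
  apply: residual_independence => [|P]; first exact: leq_trans spb sp.
  rewrite (horner2_wide _ _ spb sNpb).
  transitivity (res v (p.[(z P)%:P].[y P] / c)).
    rewrite (horner2_wide _ _ (leqnn _) sN) mulr_suml res_sum => [|i' _]; last first.
      by rewrite mulr_suml; apply: val_ge_sum => j' _.
    apply: eq_bigr => i' _; rewrite mulr_suml res_sum => [|j' _] //.
    apply: eq_bigr => j' _; rewrite pbE termE.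
    rewrite [RHS]resM ?resX //; last 2 first.
    - by apply: val_ge0M => //; exact: val_ge0X.
    - exact: val_ge0X.
    congr (_ * _); rewrite [RHS]resM ?resX //; exact: val_ge0X.
  have vpc : (0 < v (p.[(z P)%:P].[y P] / c)%R)%E.
    apply: (@lt_le_trans _ _ (- r)%:E); first by rewrite lte_fin oppr_gt0.
    have := val_ge_mul (p0 P) (val_ge_fin (valV_fin vc)).
    by rewrite add0r.
  by apply/eqP; rewrite res_eq0 ?vpc // ltW.
have := pbE i0 j0; rewrite pb0 !coef0 -/c divff // res1 => /esym/eqP.
by rewrite oner_eq0.
Qed.

Local Notation ev := (red_eval (fun l : 'I_3 => [:: red y; red w; red z]`_l)).
Local Notation Y := ('X_(@Ordinal 3 0 isT) : {mpoly k[3]}).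
Local Notation W := ('X_(@Ordinal 3 1 isT) : {mpoly k[3]}).
Local Notation Z1 := ('X_(@Ordinal 3 2 isT) : {mpoly k[3]}).

Let pb_sum (I : Type) (s : seq I) (G : I -> pb_ring v t) P :
  (\sum_(i <- s) G i) P = \sum_(i <- s) G i P.
Proof. exact: (big_morph (fun f : pb_ring v t => f P)). Qed.

Let pb_exp (f : pb_ring v t) m P : (f ^+ m) P = f P ^+ m.
Proof. by elim: m => [|m IH] //; rewrite !exprS -IH. Qed.

(** An affinoid function differs by a topologically nilpotent one from some
    [p(y, z) / y^N], which is again bounded by 1, so that [p] is integral and
    can be reduced coefficientwise. *)
Lemma presentation_surjective a : exists G, ev G = a.
Proof.
have [f ->] : exists f, a = red f by exists (repr a); rewrite /red reprK.
have /pb_funsP[fa _] := valP f.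
have [p [N [sp fp]]] := z_dense fa.
have h0 P : (0 <= v (p.[(z P)%:P].[y P])%R)%E.
  have [vy vw] := vyw P.
  rewrite -[X in v X]mulr1 -[1](expr1n _ N) -(yw P) [y P * _]mulrC exprMn mulrA.
  apply: val_ge0M; last exact: val_ge0X.
  rewrite -[_ * _](subKr (f P)); apply: val_ge_sub; first exact: pb_ge0.
  by apply: le_trans (fp P); rewrite lee_fin.
have pint := integral_coefficients sp h0.
have [M sM] := poly2_bound p.
pose A i j : val_ring v := insubd (0 : val_ring v) p`_i`_j.
have AE i j : val (A i j) = p`_i`_j by rewrite insubdK // integral_eltsE pint.
pose G : {mpoly k[3]} := \sum_(i < q) \sum_(j < M)
  (\pi_(residue_field v) (A i j))%:MP * Y ^+ j * Z1 ^+ i * W ^+ N.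
pose g : pb_ring v t := \sum_(i < q) \sum_(j < M)
  PbRing (cst_pb t (A i j)) * y ^+ j * z ^+ i * w ^+ N.
exists G; transitivity (red g).
  rewrite /G /g !rmorph_sum; apply: eq_bigr => i _.
  rewrite !rmorph_sum; apply: eq_bigr => j _.
  by rewrite !rmorphM !rmorphXn /= red_evalC !red_evalX red_cstE.
apply/eqP; rewrite red_eqE; apply/tn_idealP/top_nilpotentP.
exists 1 => // P; rewrite -[X in v X]/(g P - f P) valB.
suff -> : g P = p.[(z P)%:P].[y P] * w P ^+ N by exact: fp.
rewrite (horner2_wide _ _ sp sM) mulr_suml /g pb_sum; apply: eq_bigr => i _.
rewrite pb_sum mulr_suml; apply: eq_bigr => j _.
by rewrite -[LHS]/(val (A i j) * (y ^+ j) P * (z ^+ i) P * (w ^+ N) P) AE !pb_exp.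
Qed.

(** Modulo the ideal, [G] is the quotient by a power of [Y] of some [p(Y, Z)]
    of degree less than [q] in [Z]; if [G] vanishes on the reduction, [p]
    vanishes at all points. *)
Lemma presentation_kernel G : ev G = 0 <-> curve_ideal q D G.
Proof.
have evI H : curve_ideal q D H -> ev H = 0.
  move=> [A [B ->]].
  have yw1 : red y * red w = 1.
    rewrite -rmorphM -(rmorph1 (red (v := v) (t := t))); congr red; apply: val_inj.
    by apply: funext => P; exact: yw.
  have rel0 : red z ^+ q + red w ^+ D + red y ^+ D = 0.
    rewrite -!rmorphXn -!rmorphD -(rmorph0 (red (v := v) (t := t))); apply/eqP.
    rewrite red_eqE subr0; apply/tn_idealP/top_nilpotentP; exists delta => // P.
    by rewrite -[X in v X]/((z ^+ q) P + (w ^+ D) P + (y ^+ D) P) !pb_exp.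
  rewrite rmorphD !rmorphM rmorphB !rmorphD rmorphM rmorph1 !rmorphXn /= !red_evalX /=.
  by rewrite yw1 rel0 subrr !mulr0 addr0.
split=> [evG|]; last exact: evI.
have [N [p [sp Ip]]] := curve_reducible_all D q_gt0 G.
suff p0 : p = 0.
  by rewrite p0 in Ip; exact: curve_ideal_null_form Ip.
apply: (residual_independence sp) => P.
have E : ev (poly_yz p) = 0.
  have := evI _ Ip; rewrite rmorphB rmorphM /= evG mulr0 sub0r => /eqP.
  by rewrite oppr_eq0 => /eqP.
have := red_pt_eval (fun l : 'I_3 => [:: red y; red w; red z]`_l) P (poly_yz p).
by rewrite E poly_yz_eval /= !red_ptE rmorph0.
Qed.

End Presentation.

(** * The coordinates of the reduction *)

Section AffinoidFunctions.
Variables (R : realType) (K : fieldType) (v : valuation R K).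
Variables (T : Type) (n : nat) (t : 'I_n -> T -> K).
Implicit Types f g : T -> K.

Lemma affinoid_fun_ext f g : f =1 g -> affinoid_fun v t f -> affinoid_fun v t g.
Proof. by move=> /funext ->. Qed.

Lemma affinoid_fun_coord k : affinoid_fun v t (t k).
Proof.
exists (fun=> 'X_k) => [M|P M]; exists 0%N => *.
  by move=> m; rewrite subrr mcoeff0 val0 leey.
by rewrite mevalXU subrr val0 leey.
Qed.

Lemma affinoid_funD f g : affinoid_fun v t f -> affinoid_fun v t g ->
  affinoid_fun v t (fun P => f P + g P).
Proof.
move=> fa ga; apply: (@affinoid_fun_ext (fun P => f P - (0 - g P))) => [P|].
  by rewrite sub0r opprK.
by apply: affinoid_funB => //; apply: affinoid_funB => //; exact: affinoid_fun_cst.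
Qed.

Lemma affinoid_funX f m : affinoid_fun v t f -> affinoid_fun v t (fun P => f P ^+ m).
Proof.
move=> fa; elim: m => [|m IH].
  by apply: (@affinoid_fun_ext (fun=> 1)) => //; exact: affinoid_fun_cst.
apply: (@affinoid_fun_ext (fun P => f P * f P ^+ m)) => [P|]; first by rewrite exprS.
exact: affinoid_funM.
Qed.

Lemma pb_funs_ge0 f : affinoid_fun v t f -> (forall P, (0 <= v (f P))%E) ->
  f \in pb_funs v t.
Proof. by move=> fa f0; apply/pb_funsP; split=> //; exact/power_boundedP. Qed.

End AffinoidFunctions.

Section LevelCurveReduction.
Variables (R : realType) (F : fieldType) (vF : valuation R F).
Variables (p q : nat) (piF : F).
Hypothesis F_local : local_field vF p q piF.
Variables (Fbar : closedFieldType) (C : fieldType) (v : valuation R C).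
Variables (i : {rmorphism F -> Fbar}) (j : {rmorphism Fbar -> C}).
Hypothesis C_completion : completed_closure vF v i j.
Variables (pi2 alpha gamma1 gamma2 : C).
Let pi := j (i piF).
Hypothesis pi2_gen : LT2_generator q pi pi2.
Hypothesis alphaE : alpha ^+ (2 * q ^ 2) = pi2.
Hypothesis gamma1E : gamma1 ^+ q = alpha ^+ (q * (q - 1) ^ 2).
Hypothesis gamma2E : gamma2 ^+ q = gamma1.

Let q_gt1 : (1 < q)%N := local_q_gt1 F_local.
Let q_gt0 : (0 < q)%N := ltnW q_gt1.
Let vpi : v pi = 1%E := val_uniformizer F_local C_completion.
Let C_pchar : [pchar C].-nat q := completion_pchar F_local i j.
Let e : R := val_alpha_num R q.
Let va : v alpha = e%:E := val_alpha q_gt1 vpi pi2_gen alphaE.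
Let e_gt0 : 0 < e := val_alpha_gt0 R q_gt1.
Let rh := rho q pi alpha.
Let vrh : v rh = 0%E := val_rho q_gt1 vpi pi2_gen alphaE.

Local Notation T := (Z11e1 v q pi pi2).
Local Notation t := (@Z_coord R C v q pi pi2 alpha).
Local Notation D := (q ^ 2 - 1)%N.

Let u (P : T) := norm_u q alpha (val P).
Let x1 (P : T) := norm_X1 q pi alpha (val P).
Let x (P : T) := norm_X2 q alpha (val P).
Let y1 (P : T) := norm_Y1 q pi alpha (val P).
Let y (P : T) := norm_Y2 alpha (val P).
Let w (P : T) := (y P)^-1.
Let z : T -> C := Z1_fun alpha gamma1 gamma2.

Let normal_at (P : T) :=
  Z11e1_normal q_gt1 vpi pi2_gen alphaE (set_valP P).

Let ns (P : T) : normal_system q alpha rh (u P) (x1 P) (x P) (y1 P) (y P).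
Proof. by have [_] := normal_at P. Qed.

Let vu P : v (u P) = 0%E. Proof. by have [[]] := normal_at P. Qed.
Let vx1 P : v (x1 P) = 0%E. Proof. by have [[]] := normal_at P. Qed.
Let vx P : v (x P) = 0%E. Proof. by have [[]] := normal_at P. Qed.
Let vy1 P : v (y1 P) = 0%E. Proof. by have [[]] := normal_at P. Qed.
Let vy P : v (y P) = 0%E. Proof. by have [[]] := normal_at P. Qed.
Let vw P : v (w P) = 0%E. Proof. exact: val_unitV. Qed.
Let yw P : y P * w P = 1. Proof. by rewrite divff // (val_unit_neq0 (vy P)). Qed.

Let g1 : gamma1 != 0 := val_fin_neq0 (val_g1 q_gt1 va gamma1E).
Let g2 : gamma2 != 0 := val_fin_neq0 (val_g2 q_gt1 va gamma1E gamma2E).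

Let z_rel P : (0 <= v (z P))%E /\
  ((e / q%:R)%:E <= v (z P ^+ q + w P ^+ D + y P ^+ D)%R)%E.
Proof.
exact: (normal_relation q_gt1 C_pchar va e_gt0 gamma1E gamma2E (ns P)).
Qed.

Let coord_clos k : gen_closure v e x y w (t k).
Proof.
have uc := clos_u va e_gt0 q_gt1 vrh ns vu vx vy1 vy yw.
have x1c := clos_x1 va e_gt0 q_gt1 vrh ns vu vx vy1 vy yw.
have xc := clos_x v e x y w.
have y1c := clos_y1 va e_gt0 q_gt1 vrh ns vu vx vy1 vy yw.
have yc := clos_y v e x y w.
have uVc := clos_uV va e_gt0 q_gt1 vrh ns vu vx vy1 vy yw.
have x1Vc := clos_x1V va e_gt0 q_gt1 vrh ns vu vx1 vx vy1 vy yw.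
have xVc := clos_xV va e_gt0 q_gt1 vrh ns vu vx vy1 vy yw.
have y1Vc := clos_y1V va e_gt0 q_gt1 vrh ns vu vx vy1 vy yw.
have wc := clos_w v e x y w.
by case: k => -[|[|[|[|[|[|[|[|[|[|//]]]]]]]]]] k10.
Qed.

Let x_affine P : x P = (((gamma1 * gamma2) *: 'X^(D + D)).[y P] * z P +
  (- (gamma1%:P + gamma1 *: 'X^(D + D) + 'X^D)).[y P]) * w P ^+ (q + D).
Proof.
have yD0 : y P ^+ D != 0 by rewrite expf_neq0 // (val_unit_neq0 (vy P)).
have yq0 : y P ^+ q != 0 by rewrite expf_neq0 // (val_unit_neq0 (vy P)).
have zE : z P = ((1 + x P * y P ^+ q) / gamma1 + (y P ^+ D)^-1 + y P ^+ D) /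
  (gamma2 * y P ^+ D) by [].
move: (z P) zE => zP zE; rewrite /w; move: (x P) (y P) zE yD0 yq0 => xP yP zE.
rewrite !hornerE !exprD !exprVn {}zE; move: (yP ^+ D) (yP ^+ q) => Y Q Y0 Q0.
by field; rewrite ?g1 ?g2 ?Y0 ?Q0.
Qed.

Lemma y_affinoid : affinoid_fun v t y.
Proof. exact: (affinoid_fun_coord v t (@Ordinal 10 4 isT)). Qed.

Lemma w_affinoid : affinoid_fun v t w.
Proof. exact: (affinoid_fun_coord v t (@Ordinal 10 9 isT)). Qed.

Lemma z_affinoid : affinoid_fun v t z.
Proof.
have xa : affinoid_fun v t x by exact: (affinoid_fun_coord v t (@Ordinal 10 2 isT)).
apply: (@affinoid_fun_ext _ _ _ _ _ _ (fun P => ((1 + x P * y P ^+ q) * gamma1^-1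
   + w P ^+ D + y P ^+ D) * (gamma2^-1 * w P ^+ D))) => [P|].
  by rewrite /z /Z1_fun /Z_fun /w !exprVn invfM.
have cst c : affinoid_fun v t (fun=> c) by exact: affinoid_fun_cst.
have ya := y_affinoid; have wa := w_affinoid.
have yX m := affinoid_funX m ya; have wX m := affinoid_funX m wa.
apply: affinoid_funM; last by apply: affinoid_funM.
apply: affinoid_funD => //; apply: affinoid_funD => //; apply: affinoid_funM => //.
by apply: affinoid_funD => //; apply: affinoid_funM.
Qed.

Definition y_pb : Z_pb v q pi pi2 alpha :=
  PbRing (pb_funs_ge0 y_affinoid (fun P => val_unit_ge0 (vy P))).
Definition w_pb : Z_pb v q pi pi2 alpha :=
  PbRing (pb_funs_ge0 w_affinoid (fun P => val_unit_ge0 (vw P))).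
Definition z_pb : Z_pb v q pi pi2 alpha :=
  PbRing (pb_funs_ge0 z_affinoid (fun P => (z_rel P).1)).

Let affinoid_dense f : affinoid_fun v t f ->
  exists (r : {poly {poly C}}) (N : nat), (size r <= q)%N /\
    forall P, (1 <= v (f P - r.[(z P)%:P].[y P] * w P ^+ N)%R)%E.
Proof.
move=> fa.
have [E Ec xqE] := clos_xq va e_gt0 q_gt1 vrh ns vu vx vy1 vy yw.
have [h [r [N [sr hE]]] fh] := affinoid_z_approx va e_gt0 q_gt1 vx vy yw Ec xqE x_affine
  coord_clos fa 1.
by exists r, N; split=> // P; rewrite -hE.
Qed.

Let y_dense (c : residue_field v) : c != 0 -> exists P : T, res v (y P) = c.
Proof.
move=> c0; have [s s0 sc] := residue_lift C_completion c.
have vs : v (j s) = 0%E by apply: res_unit; rewrite ?sc.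
have [P PZ yP] := point_exists F_local C_completion pi2_gen alphaE vs.
by exists (SigSub (mem_set PZ)); rewrite /y /= yP.
Qed.

Let eq_gt0 : 0 < e / q%:R. Proof. by rewrite divr_gt0 // ltr0n. Qed.

Lemma Z_presentation : Z_red_presented (red y_pb) (red w_pb) (red z_pb).
Proof.
have k_pchar := residue_pchar v C_pchar.
have k_inf := residue_field_infinite C_completion.
have zr P := (z_rel P).2.
split=> [a|G].
  exact: (@presentation_surjective _ _ _ _ _ _ _ q_gt1 k_pchar k_inf y_pb w_pb z_pb
    yw _ eq_gt0 zr y_dense affinoid_dense).
exact: (@presentation_kernel _ _ _ _ _ _ _ q_gt1 k_pchar k_inf y_pb w_pb z_pb
    yw _ eq_gt0 zr y_dense).
Qed.

End LevelCurveReduction.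

(** * The action of an automorphism *)

Section Twist.
Variables (R : realType) (C : fieldType) (v : valuation R C).
Variables (q : nat) (pi pi2 alpha : C).

Lemma map_pt_pi_mul (f : {rmorphism C -> C}) u X :
  f pi = pi -> f (pi_mul q pi u X) = pi_mul q pi (f u) (f X).
Proof. by move=> fpi; rewrite /pi_mul !rmorphD !rmorphM !rmorphXn fpi. Qed.

Lemma Z11e1_map (f : {rmorphism C -> C}) P :
  (forall x, v (f x) = v x) -> f pi = pi -> f pi2 = pi2 ->
  Z11e1 v q pi pi2 P -> Z11e1 v q pi pi2 (map_pt f P).
Proof.
move=> vf fpi fpi2 [[u0 X0 Y0 mu] [vu vX1 vX2 vY1 vY2]].
have X1E : pt_X1 q pi (map_pt f P) = f (pt_X1 q pi P) by rewrite /pt_X1 map_pt_pi_mul.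
have Y1E : pt_Y1 q pi (map_pt f P) = f (pt_Y1 q pi P) by rewrite /pt_Y1 map_pt_pi_mul.
split; last by rewrite X1E Y1E /= !vf.
split; rewrite /= ?vf //.
- by rewrite -!map_pt_pi_mul // X0 rmorph0.
- by rewrite -!map_pt_pi_mul // Y0 rmorph0.
- rewrite /mu2 X1E Y1E /= -[RHS]fpi2 -mu /mu2.
  by rewrite !(rmorphD, rmorphN, rmorphM, rmorphXn).
Qed.

Local Notation T := (Z11e1 v q pi pi2).
Local Notation t := (@Z_coord R C v q pi pi2 alpha).
Local Notation Zpb := (Z_pb v q pi pi2 alpha).
Local Notation Zred := (Z_red v q pi pi2 alpha).

Section TwistBy.
Variables f g : {rmorphism C -> C}.
Hypotheses (vf : forall x, v (f x) = v x) (vg : forall x, v (g x) = v x).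
Hypotheses (fg : cancel g f) (gpi : g pi = pi) (gpi2 : g pi2 = pi2).
Variable zeta : C.
Hypotheses (vzeta : v zeta = 0%E) (f_alpha : f alpha = zeta * alpha).

Definition move_point (P : T) : T :=
  SigSub (mem_set (Z11e1_map vg gpi gpi2 (set_valP P))).

Lemma move_pointE P : val (move_point P) = map_pt g (val P).
Proof. by []. Qed.

(** Conjugating a function by the action on points and on values gives again
    an affinoid function, which composition with the action on points alone
    does not, as that action is not [C]-linear. *)
Definition twist (h : T -> C) (P : T) : C := f (h (move_point P)).

(** The coordinates are fixed up to the powers of [zeta] that come from the
    powers of [alpha] in their denominators. *)
Lemma twist_coord : exists c : 'I_10 -> C, (forall k, v (c k) = 0%E) /\
  forall k P, twist (t k) P = c k * t k P.
Proof.
have z0 : zeta != 0 := val_unit_neq0 vzeta.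
have quo (x : C) a : f (g x / alpha ^+ a) = zeta^-1 ^+ a * (x / alpha ^+ a).
  by rewrite rmorphM fmorphV rmorphXn /= fg f_alpha exprMn invfM exprVn mulrCA.
have inv (x : C) a : f (g x / alpha ^+ a)^-1 = zeta ^+ a * (x / alpha ^+ a)^-1.
  by rewrite fmorphV quo invfM exprVn invrK.
have X1E P : pt_X1 q pi (map_pt g P) = g (pt_X1 q pi P) by rewrite /pt_X1 map_pt_pi_mul.
have Y1E P : pt_Y1 q pi (map_pt g P) = g (pt_Y1 q pi P) by rewrite /pt_Y1 map_pt_pi_mul.
pose s := [:: (q ^ 3 * (q - 1))%N; (q ^ 3)%N; q; (q ^ 2)%N; 1%N].
exists (fun k => ([seq zeta^-1 ^+ a | a <- s] ++ [seq zeta ^+ a | a <- s])`_k).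
split=> [k|k P].
  by case: k => -[|[|[|[|[|[|[|[|[|[|//]]]]]]]]]] k10 /=;
    rewrite val_unitX ?val_unitV.
rewrite /twist /Z_coord /Z_units move_pointE X1E Y1E.
have alpha1 : alpha = alpha ^+ 1 by [].
by case: k => -[|[|[|[|[|[|[|[|[|[|//]]]]]]]]]] k10 /=;
  rewrite ?quo ?inv // {1}alpha1 ?quo ?inv.
Qed.

(** Apply [f] to the coefficients of the approximating polynomials and absorb
    the units by which the coordinates are multiplied. *)
Lemma twist_affinoid h : affinoid_fun v t h -> affinoid_fun v t (twist h).
Proof.
move=> [G Gc Gh]; have [c [vc tc]] := twist_coord.
pose mon (m : 'X_{1..10}) := \prod_k c k ^+ m k.
have vmon m : v (mon m) = 0%E.
  by rewrite /mon; elim/big_ind: _ => [|a b va vb|k _];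
    [exact: val1|exact: val_unitM|exact: val_unitX].
pose H n := \sum_(m <- msupp (G n)) (f (G n)@_m * mon m) *: 'X_[m] : {mpoly C[10]}.
have HE n m : (H n)@_m = f (G n)@_m * mon m.
  rewrite /H raddf_sum /=.
  have [mG|mG] := boolP (m \in msupp (G n)).
    rewrite (big_rem m mG) /= mcoeffZ mcoeffX eqxx mulr1 big_seq big1 ?addr0 // => m'.
    rewrite mem_rem_uniq ?msupp_uniq // inE => /andP[/negPf mm' _].
    by rewrite mcoeffZ mcoeffX mm' mulr0.
  rewrite big_seq big1 => [|m' m'G]; first by rewrite memN_msupp_eq0 // rmorph0 mul0r.
  rewrite mcoeffZ mcoeffX; case: eqP => [mm'|]; last by rewrite mulr0.
  by rewrite -mm' m'G in mG.
have Heval n P : (H n).@[fun k => t k P] = f (G n).@[fun k => t k (move_point P)].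
  rewrite /H raddf_sum mevalE rmorph_sum; apply: eq_bigr => m _ /=.
  rewrite mevalZ mevalX rmorphM rmorph_prod -mulrA; congr (_ * _).
  rewrite -big_split; apply: eq_bigr => k _ /=.
  by rewrite rmorphXn -exprMn -[f _]/(twist (t k) P) tc.
exists H => [M|P M].
  have [N GN] := Gc M; exists N => a b Na Nb m.
  rewrite mcoeffB !HE -mulrBl -rmorphB val_M vmon adde0 vf -mcoeffB.
  exact: GN.
have [N GN] := Gh (move_point P) M; exists N => a Na.
by rewrite Heval /twist -rmorphB vf; exact: GN.
Qed.

Lemma twist_pb (h : Zpb) : twist h \in pb_funs v t.
Proof.
have /pb_funsP[ha _] := valP h; apply: pb_funs_ge0; first exact: twist_affinoid.
by move=> P; rewrite /twist vf pb_ge0.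
Qed.

Definition twist_fun (h : Zpb) : Zpb := PbRing (twist_pb h).

Definition twist_red (a : Zred) : Zred := red (twist_fun (repr a)).

Lemma twist_redE (h : Zpb) : twist_red (red h) = red (twist_fun h).
Proof.
apply/eqP; rewrite red_eqE; apply/tn_idealP/top_nilpotentP.
have : repr (red h) - h \in tn_ideal (v := v) (t := t) by rewrite -red_eqE /red reprK.
move=> /tn_idealP/top_nilpotentP[d d0 hd]; exists d => // P.
rewrite -[X in v X]/(f (repr (red h) (move_point P)) - f (h (move_point P))).
by rewrite -rmorphB vf; exact: hd.
Qed.

Lemma twist_red_zmod_morphism : zmod_morphism twist_red.
Proof.
move=> a b.
have redE (c : Zred) : exists h : Zpb, c = red h by exists (repr c); rewrite /red reprK.
have [h ->] := redE a; have [h' ->] := redE b.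
rewrite -rmorphB !twist_redE -rmorphB; congr red; apply: val_inj; apply: funext => P.
exact: rmorphB.
Qed.

Lemma twist_red_monoid_morphism : monoid_morphism twist_red.
Proof.
have redE (c : Zred) : exists h : Zpb, c = red h by exists (repr c); rewrite /red reprK.
split=> [|a b].
  rewrite -(rmorph1 (red (v := v) (t := t))) twist_redE; congr red; apply: val_inj.
  by apply: funext => P; exact: rmorph1.
have [h ->] := redE a; have [h' ->] := redE b.
rewrite -rmorphM !twist_redE -rmorphM; congr red; apply: val_inj; apply: funext => P.
exact: rmorphM.
Qed.

HB.instance Definition _ :=
  GRing.isZmodMorphism.Build Zred Zred twist_red twist_red_zmod_morphism.
HB.instance Definition _ :=
  GRing.isMonoidMorphism.Build Zred Zred twist_red twist_red_monoid_morphism.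

Lemma twist_red_eq (h h' : Zpb) : (forall P, twist h P = h' P) ->
  twist_red (red h) = red h'.
Proof.
by move=> hh'; rewrite twist_redE; congr red; apply: val_inj; apply: funext.
Qed.

Hypothesis f_residue : forall x, (0 <= v x -> 0 < v (f x - x)%R)%E.

Lemma twist_red_cst (c : residue_field v) : twist_red (red_cst t c) = red_cst t c.
Proof.
have [a ->] : exists a : val_ring v, c = \pi_(residue_field v) a.
  by exists (repr c); rewrite reprK.
rewrite red_cstE twist_redE; apply/eqP; rewrite red_eqE.
apply/tn_idealP/top_nilpotentP.
have [d d0 hd] := val_gt0_fin (f_residue (valP a : (0 <= v (val a))%E)).
by exists d.
Qed.

(** The outer [f] in [twist] is invisible on residues. *)
Lemma twist_red_pt P (a : Zred) : red_pt (move_point P) a = red_pt P (twist_red a).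
Proof.
have [h ->] : exists h : Zpb, a = red h by exists (repr a); rewrite /red reprK.
rewrite twist_redE !red_ptE; apply/esym/eqP; rewrite res_eq ?pb_ge0 //.
by apply: f_residue; exact: pb_ge0.
Qed.

End TwistBy.
End Twist.

(** * The action of inertia *)

Section InverseInertia.
Variables (R : realType) (F : fieldType) (Fbar : closedFieldType) (C : fieldType).
Variables (v : valuation R C).
Variables (i : {rmorphism F -> Fbar}) (j : {rmorphism Fbar -> C}).
Variable sigma : inertia v i j.

Definition sigma_inv : C -> C := inertia_inv sigma.

Lemma sigma_inv_zmod_morphism : zmod_morphism sigma_inv.
Proof.
move=> x y; apply: (can_inj (inertiaK sigma)).
by rewrite rmorphB !inertia_invK.
Qed.

Lemma sigma_inv_monoid_morphism : monoid_morphism sigma_inv.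
Proof.
split=> [|x y]; apply: (can_inj (inertiaK sigma)).
  by rewrite rmorph1 inertia_invK.
by rewrite rmorphM !inertia_invK.
Qed.

HB.instance Definition _ :=
  GRing.isZmodMorphism.Build C C sigma_inv sigma_inv_zmod_morphism.
HB.instance Definition _ :=
  GRing.isMonoidMorphism.Build C C sigma_inv sigma_inv_monoid_morphism.

End InverseInertia.

Theorem lemma4p17 (R : realType) (p q : nat)
    (F : fieldType) (vF : valuation R F) (piF : F)
    (Fbar : closedFieldType) (C : fieldType) (v : valuation R C)
    (i : {rmorphism F -> Fbar}) (j : {rmorphism Fbar -> C})
    (F_local : local_field vF p q piF)
    (C_completion : completed_closure vF v i j)
    (pi2 alpha gamma1 gamma2 : C) (sigma : inertia v i j) :
  let pi := j (i piF) in
  LT2_generator q pi pi2 ->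
  alpha ^+ (2 * q ^ 2) = pi2 ->
  gamma1 ^+ q = alpha ^+ (q * (q - 1) ^ 2) ->
  gamma2 ^+ q = gamma1 ->
  sigma pi2 = pi2 ->
  exists zeta : C,
  [/\ zeta ^+ (2 * q ^ 2) = 1,
      sigma alpha = zeta * alpha
    & exists y w z : Z_pb v q pi pi2 alpha,
      [/\ forall P, y P = y_fun alpha P,
          forall P, w P = (y_fun alpha P)^-1,
          forall P, z P = Z1_fun alpha gamma1 gamma2 P,
          Z_red_presented (red y) (red w) (red z)
        & exists Phi : {rmorphism Z_red v q pi pi2 alpha ->
                                   Z_red v q pi pi2 alpha},
          [/\ bijective Phi,
              forall c : residue_field v, Phi (red_cst _ c) = red_cst _ c,
              acts_on_reduction sigma Phi,
              Phi (red y) = red_cst _ (res v zeta^-1) * red y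
            & Phi (red z) = red z]]].
Proof.
move=> pi pi2_gen alphaE gamma1E gamma2E s_pi2.
have q_gt1 := local_q_gt1 F_local; have q_gt0 : (0 < q)%N := ltnW q_gt1.
have C_pchar := completion_pchar F_local i j.
have vpi : v pi = 1%E := val_uniformizer F_local C_completion.
have a0 := alpha_neq0 q_gt1 vpi pi2_gen alphaE.
have q2_pchar : [pchar C].-nat (q ^ 2)%N by rewrite pnatX C_pchar.
pose zeta := sigma alpha / alpha; exists zeta.
have zeta_pow : zeta ^+ (2 * q ^ 2) = 1.
  rewrite /zeta expr_div_n -rmorphXn alphaE s_pi2 divff //.
  by rewrite -alphaE expf_neq0.
have s_alpha : sigma alpha = zeta * alpha by rewrite /zeta divfK.
(* in characteristic p the roots of unity of order 2 q^2 are the signs *)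
have zeta2 : zeta ^+ 2 = 1.
  by apply: (frob_inj q2_pchar); rewrite -exprM zeta_pow expr1n.
have zeta_even m : ~~ odd m -> zeta ^+ m = 1.
  by move=> me; rewrite -(even_halfK me) -mul2n exprM zeta2 expr1n.
have vzeta : v zeta = 0%E.
  by apply: (@val_Xfin _ _ _ 2 0) => //; rewrite zeta2 mul0rn val1.
split=> //.
pose si : {rmorphism C -> C} := sigma_inv sigma.
have vs x : v (sigma x) = v x by exact: (inertia_val F_local C_completion sigma x).
have vsi x : v (si x) = v x by rewrite -vs inertia_invK.
have s_pi : sigma pi = pi by exact: (inertia_base F_local C_completion sigma piF).
have ssi : cancel si sigma := inertia_invK sigma.
have sis : cancel sigma si := inertiaK sigma.
have si_pi : si pi = pi by rewrite -{1}s_pi sis.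
have si_pi2 : si pi2 = pi2 by rewrite -{1}s_pi2 sis.
have si_zeta : si zeta = zeta.
  have : zeta == 1 \/ zeta == -1 by apply/orP; rewrite -sqrf_eq1 zeta2.
  by case=> /eqP ->; rewrite ?rmorphN rmorph1.
have si_alpha : si alpha = zeta * alpha.
  have /(congr1 si) := s_alpha; rewrite sis rmorphM si_zeta => E.
  by rewrite [X in _ = _ * X]E mulrA -expr2 zeta2 mul1r.
exists (y_pb F_local C_completion pi2_gen alphaE).
exists (w_pb F_local C_completion pi2_gen alphaE).
exists (z_pb F_local C_completion pi2_gen alphaE gamma1E gamma2E).
split=> //; first exact: Z_presentation.
pose Phi : {rmorphism Z_red v q pi pi2 alpha -> Z_red v q pi pi2 alpha} :=
  twist_red vs vsi ssi si_pi si_pi2 vzeta s_alpha.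
pose Psi : {rmorphism Z_red v q pi pi2 alpha -> Z_red v q pi pi2 alpha} :=
  twist_red vsi vs sis s_pi s_pi2 vzeta si_alpha.
have s_res x : (0 <= v x -> 0 < v (sigma x - x)%R)%E.
  exact: (inertia_residue F_local C_completion sigma).
exists Phi; split.
- have redE (a : Z_red v q pi pi2 alpha) : exists h : Z_pb v q pi pi2 alpha, a = red h.
    by exists (repr a); rewrite /red reprK.
  have mapK (P : point C) : map_pt si (map_pt sigma P) = P /\ map_pt sigma (map_pt si P) = P.
    by case: P => u X Y; rewrite /map_pt /= !sis !ssi.
  exists Psi => a; have [h ->] := redE a; rewrite /Phi /Psi /= !twist_redE;
    apply: twist_red_eq || congr red; apply: val_inj; apply: funext => P.
  + rewrite -[LHS]/(si (sigma (h (move_point vsi si_pi si_pi2 (move_point vs s_pi s_pi2 P))))).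
    by rewrite sis; congr (h _); apply: val_inj; rewrite /= (mapK _).1.
  + rewrite -[LHS]/(sigma (si (h (move_point vs s_pi s_pi2 (move_point vsi si_pi si_pi2 P))))).
    by rewrite ssi; congr (h _); apply: val_inj; rewrite /= (mapK _).2.
- by move=> c; exact: twist_red_cst.
- split=> [P PZ|P Ps PsE a]; first exact: (Z11e1_map (f := si)).
  have -> : Ps = move_point vsi si_pi si_pi2 P by exact: val_inj.
  exact: twist_red_pt.
- pose b : val_ring v := insubd (0 : val_ring v) zeta^-1.
  have bE : val b = zeta^-1.
    by rewrite insubdK // integral_eltsE val_unit_ge0 // val_unitV.
  rewrite -[res v _]/(\pi_(residue_field v) b) red_cstE -rmorphM.
  apply: twist_red_eq => P.
  rewrite -[RHS]/(val b * (pt_Y2 (val P) / alpha)) bE /twist /=.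
  by rewrite /norm_Y2 rmorphM fmorphV /= ssi s_alpha invfM mulrCA.
apply: twist_red_eq => P.
have s_gamma1 : sigma gamma1 = gamma1.
  apply: (frob_inj C_pchar); rewrite -rmorphXn gamma1E rmorphXn s_alpha exprMn.
  by rewrite zeta_even ?mul1r // oddM oddX oddB //=; case: (odd q).
have s_gamma2 : sigma gamma2 = gamma2.
  by apply: (frob_inj C_pchar); rewrite -rmorphXn gamma2E s_gamma1.
have zeta_D : zeta ^+ (q ^ 2 - 1) = 1.
  have [q_odd|q_even] := boolP (odd q).
    by apply: zeta_even; rewrite oddB ?expn_gt0 ?q_gt0 // oddX q_odd.
  suff -> : zeta = 1 by rewrite expr1n.
  by apply: (frob_inj C_pchar); rewrite zeta_even // expr1n.
have zV m : zeta ^+ m = 1 -> zeta^-1 ^+ m = 1.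
  by move=> zm; rewrite exprVn zm invr1.
have xE : sigma (x_fun alpha (move_point vsi si_pi si_pi2 P)) = zeta^-1 ^+ q * x_fun alpha P.
  by rewrite /x_fun /= rmorphM fmorphV rmorphXn ssi s_alpha exprMn invfM exprVn mulrCA.
have yE : sigma (y_fun alpha (move_point vsi si_pi si_pi2 P)) = zeta^-1 * y_fun alpha P.
  by rewrite /y_fun /= rmorphM fmorphV ssi s_alpha invfM mulrCA.
have yD : sigma (y_fun alpha (move_point vsi si_pi si_pi2 P) ^+ (q ^ 2 - 1)) =
    y_fun alpha P ^+ (q ^ 2 - 1).
  by rewrite rmorphXn yE exprMn zV ?mul1r.
have ZE : sigma (Z_fun alpha gamma1 (move_point vsi si_pi si_pi2 P)) = Z_fun alpha gamma1 P.
  rewrite /Z_fun rmorphM fmorphV s_gamma1 rmorphD rmorph1 rmorphM rmorphXn xE yE.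
  congr ((1 + _) / _); rewrite exprMn mulrACA -exprD zV ?mul1r //.
  by apply: zeta_even; rewrite addnn odd_double.
rewrite /twist /z_pb /= /Z1_fun rmorphM fmorphV rmorphM !rmorphD fmorphV.
by rewrite yD ZE s_gamma2.
Qed.
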